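(* Let $d=1$, $\Omega=(0,1)$, $0<\delta<1/2$, and let $\gamma(x,y)=\tilde\gamma(|y-x|)$ satisfy the kernel assumptions (K1) and (K2) stated in the context, with $b\in C(0,1)$. Let $u$ be the solution of $$-\mathcal{L}u=b\ \text{ on }(0,1),\qquad u=0\ \text{ on }\Omega_I=(-\delta,0]\cup[1,1+\delta),$$ and let $u_h\in V^{pc,h}_{c,0}$ be the solution of the discrete problem $$-\int_{0}^{1}\mathcal{L}u_h(x)\,w_h(x)\,dx=\int_0^1 b(x)w_h(x)\,dx\qquad\forall w_h\in V^{pc,h}_{c,0}.$$ Assume $u\in C(0,1)$, $u\in H^2(0,\delta)$, $u\in H^2(\delta,1-\delta)$ and $u\in H^2(1-\delta,1)$. If $\delta$ and $1-\delta$ are both selected as mesh grid points, then there exists a constant $C$, independent of $h$, such that for sufficiently small $h$, $$\|u-u_h\|_{(0,1)}+h\|u'-u_h'\|_{(0,1)}\le C h^2\big(\|u\|_{2,(0,\delta)}+\|u\|_{2,(\delta,1-\delta)}+\|u\|_{2,(1-\delta,1)}\big).$$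
   Context: The nonlocal operator is $\mathcal{L}u(x)=\int_{\mathbb{R}}(u(y)-u(x))\gamma(x,y)\,dy$ for $x\in\Omega=(0,1)$; $\delta$ is the horizon. For $x\in\Omega\cup\Omega_I$ and $r>0$, $B_r(x)=\{y\in\Omega\cup\Omega_I:\ |y-x|\le r\}$. Kernel assumptions on the nonnegative symmetric kernel $\gamma$: (K1) there is a constant $\gamma_0>0$ such that for all $x\in\Omega\cup\Omega_I$: $\gamma(x,y)\ge\gamma_0$ for all $y\in B_{\delta/2}(x)$, and $\gamma(x,y)=0$ for all $y\in(\Omega\cup\Omega_I)\setminus B_\delta(x)$; (K2) $\gamma(x,y)=\tilde\gamma(|y-x|)\ge0$ and $\int_{\mathbb{R}}\tilde\gamma(|z|)\,dz=1$. Interactions are limited to distance $\delta$: $\tilde\gamma(r)=0$ for $r>\delta$. Standing assumption: $b\in L^2(0,1)$. The solution is the function $u\in L^2(\Omega\cup\Omega_I)$ with $u=0$ a.e. on $\Omega_I$ and $-\mathcal{L}u=b$ a.e. in $(0,1)$. $\|\cdot\|_D$ denotes the $L^2(D)$ norm and $\|\cdot\|_{2,D}$ the $H^2(D)$ norm; the derivative $u'$ is the weak (piecewise) derivative. Discretization: the meshes form a quasi-uniform family (as $h\to0$) of partitions of $\Omega\cup\Omega_I$ that simultaneously partition $[0,1]$ (so $0$ and $1$ are mesh points), $h$ being the largest element length. $V^{pc,h}_{c,0}$ is the space of functions on $\Omega\cup\Omega_I$ that are continuous and piecewise linear on $[0,1]$ with respect to the mesh and vanish outside $[0,1]$ (no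 condition on the values at $0$ and $1$). *)

(* Defs.v *)
From HB Require Import structures.
From mathcomp Require Import all_boot all_order all_algebra.
From mathcomp Require Import all_classical all_reals all_analysis.
Set Implicit Arguments.
Unset Strict Implicit.
Unset Printing Implicit Defensive.
Import Order.TTheory GRing.Theory Num.Theory.
Import numFieldNormedType.Exports.
Local Open Scope classical_set_scope.
Local Open Scope ring_scope.

Section FunctionSpaces.
Context {R : realType}.
Implicit Types (D : set R) (f g phi : R -> R).

(* A function on D is represented by a total function R -> R whose values
   outside D are irrelevant: f \_ D is its extension by zero. *)
Definition L2 D f : Prop := (f \_ D) \in Lfun (@lebesgue_measure R) 2%:E.

Definition L2norm D f : \bar R :=
  ('N[(@lebesgue_measure R)]_2%:E [EFin \o (f \_ D)])%E.

(* phi is in C_c^oo(D) *)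
Definition test_function D phi : Prop :=
  [/\ forall (n : nat) (x : R), derivable (derive1n n phi) x 1,
      compact (closure [set x | phi x != 0]) &
      closure [set x | phi x != 0] `<=` D].

Definition weak_derivative D f g : Prop :=
  [/\ locally_integrable D f, locally_integrable D g &
      forall phi, test_function D phi ->
        \int[lebesgue_measure]_(x in D) (f x * derive1 phi x) =
        - (\int[lebesgue_measure]_(x in D) (g x * phi x))].

(* Any two weak derivatives agree a.e. on D; wderiv picks one of them (and is
   the zero function when there is none). *)
Definition wderiv D f : R -> R :=
  xget (fun=> 0) [set g | weak_derivative D f g].

Definition H2 D f : Prop :=
  L2 D f /\ exists g1 g2, [/\ weak_derivative D f g1, weak_derivative D g1 g2,
                              L2 D g1 & L2 D g2].

Definition H2norm D f : \bar R :=
  ((L2norm D f ^+ 2 + L2norm D (wderiv D f) ^+ 2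
     + L2norm D (wderiv D (wderiv D f)) ^+ 2) `^ 2^-1)%E.

End FunctionSpaces.

Section NonlocalProblem.
Context {R : realType}.
Implicit Types (delta : R) (gamma : R -> R -> R) (tgamma u b : R -> R).

Definition Omega : set R := `]0, 1[.
Definition OmegaI delta : set R := `]- delta, 0] `|` `[1, 1 + delta[.

Definition interaction_ball delta (x r : R) : set R :=
  [set y | (Omega `|` OmegaI delta) y /\ `|y - x| <= r].

Definition kernel_K1 delta gamma : Prop :=
  exists2 gamma0 : R, 0 < gamma0 &
    forall x, (Omega `|` OmegaI delta) x ->
      (forall y, interaction_ball delta x (delta / 2) y ->
         gamma0 <= gamma x y) /\
      (forall y, ((Omega `|` OmegaI delta) `\` interaction_ball delta x delta) y
         -> gamma x y = 0).

Definition kernel_K2 gamma tgamma : Prop :=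
  [/\ forall x y, gamma x y = tgamma `|y - x| /\ 0 <= gamma x y,
      measurable_fun setT (fun z : R => tgamma `|z|) &
      (\int[(@lebesgue_measure R)]_z (tgamma `|z|)%:E = 1)%E].

Definition nonlocal_op gamma u (x : R) : R :=
  \int[lebesgue_measure]_y ((u y - u x) * gamma x y).

Definition nonlocal_solution delta gamma b u : Prop :=
  [/\ L2 (Omega `|` OmegaI delta) u,
      {ae (@lebesgue_measure R), forall x, OmegaI delta x -> u x = 0} &
      {ae (@lebesgue_measure R), forall x, Omega x ->
         - nonlocal_op gamma u x = b x}].

End NonlocalProblem.

Section Discretization.
Context {R : realType}.
Implicit Types (delta kappa : R) (s : seq R) (w : R -> R).

(* Following itv_partition, s lists the mesh points of [-delta, 1 + delta] in
   increasing order, without the first one, -delta. *)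
Definition is_mesh delta s : Prop :=
  [/\ itv_partition (- delta) (1 + delta) s, 0 \in s & 1 \in s].

(* the pairs of consecutive mesh points *)
Definition mesh_elements delta s : seq (R * R) := zip (- delta :: s) s.

Definition mesh_size delta s : R :=
  \big[Num.max/0]_(K <- mesh_elements delta s) (K.2 - K.1).

Definition quasi_uniform_family delta (I : Type) (mesh : I -> seq R) : Prop :=
  [/\ forall i, is_mesh delta (mesh i),
      exists kappa, forall i K, K \in mesh_elements delta (mesh i) ->
        mesh_size delta (mesh i) <= kappa * (K.2 - K.1) &
      forall e, 0 < e -> exists i, mesh_size delta (mesh i) < e].

(* V^{pc,h}_{c,0}; its elements are extended by zero to the whole line *)
Definition Vpc delta s : set (R -> R) :=
  [set w : R -> R | [/\ {within `[(0 : R), 1], continuous w},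
      forall K, K \in mesh_elements delta s -> `[K.1, K.2] `<=` `[(0 : R), 1] ->
        exists a c : R, forall x : R, x \in `[K.1, K.2] -> w x = a * x + c &
      forall x : R, x \notin `[0, 1] -> w x = 0]].

Definition discrete_solution delta (gamma : R -> R -> R) (b : R -> R) s
    (uh : R -> R) : Prop :=
  Vpc delta s uh /\
  forall wh, Vpc delta s wh ->
    - (\int[lebesgue_measure]_(x in `]0, 1[) (nonlocal_op gamma uh x * wh x)) =
    \int[lebesgue_measure]_(x in `]0, 1[) (b x * wh x).

End Discretization.

(* Main.v *)
Require Import Defs.
From mathcomp Require Import all_boot all_order all_algebra.
From mathcomp Require Import all_classical all_reals all_analysis.
From mathcomp Require Import measurable_realfun ring lra.
Set Implicit Arguments.
Unset Strict Implicit.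
Unset Printing Implicit Defensive.
Import Order.TTheory GRing.Theory Num.Theory.
Import numFieldNormedType.Exports.
Local Open Scope classical_set_scope.
Local Open Scope ring_scope.

(** Write k z for the kernel value at distance |z|. Since k has mass 1, for x in
    (0, 1) the operator is L w x = (int_z w (x + z) k z) - w x, so that the
    variational form is a(e, w) = <e, w> - int_z k z <e (. + z), w>.

    Stability. By Cauchy-Schwarz |a(e, w)| <= 2 |e| |w| in L2. Conversely, let
    e vanish off [0, 1] and let N z > 1. The translate of e by N z is orthogonal
    to e, so 2 |e|^2 = |e (. + N z) - e|^2 <= N^2 |e (. + z) - e|^2, that is
    <e (. + z), e> <= (1 - 1 / N^2) |e|^2. As k is bounded below near 0, this
    gain holds for a set of z of positive k-mass, which makes a coercive on L2
    ([conv_form_coercive]). Cea's argument then bounds the L2 error of u_h by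
    that of any member of the discrete space ([cea]).

    Approximation. On each of the three subintervals u' is an integral of u'',
    so on an element K of length l the oscillation of u' is at most
    int_K |u''| <= l^(1/2) |u''|_K. No element straddles delta or 1 - delta,
    because both are mesh points; hence the piecewise constant function with
    the same element means as u' is within h |u''| of u' in L2, and its
    primitive, the nodal interpolant of u, is within h^2 |u''| of u
    ([interp_deriv_error], [interp_L2_error]). Together with [cea] this bounds
    the L2 error, and the bound on the derivative follows by comparing u_h with
    the interpolant through the inverse estimate |w'|_K <= sqrt 12 / l |w|_K for
    affine w and quasi-uniformity ([discrete_inverse_estimate]).

    Weak derivatives. Norms of derivatives refer to an arbitrary weak derivative,
    so two bridges are needed. If g is a weak derivative of f on an interval,
    then f d - f c is the integral of g over ]c, d] whenever c and d are
    Lebesgue points of f ([weak_derivative_primitive]): test f against a smooth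
    ramp that tends to the indicator of ]c, d] and whose derivative is a
    difference of two approximate Dirac masses. This gives uniqueness of weak
    derivatives, and the representation of u' by u'' used above. Conversely, a
    continuous f whose increments are integrals of g has g as weak derivative
    ([primitive_weak_derivative], by Fubini); this identifies the weak
    derivatives on (0, 1) of u, which is only piecewise H^2, and of u_h. *)

(** * Real-valued integrable functions *)
Section Toolbox.
Context d (T : measurableType d) {R : realType}.
Variable mu : {measure set T -> \bar R}.
Implicit Types (D : set T) (f g : T -> R).

Lemma eq_integrable_fun D f g : measurable D -> (forall x, D x -> f x = g x) ->
  mu.-integrable D (EFin \o f) -> mu.-integrable D (EFin \o g).
Proof. by move=> mD fg; apply: eq_integrable => // x /[!inE] Dx /=; rewrite fg. Qed.

Lemma integrable_add D f g : measurable D -> mu.-integrable D (EFin \o f) ->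
  mu.-integrable D (EFin \o g) -> mu.-integrable D (EFin \o (fun x => f x + g x)).
Proof. by move=> mD fi gi; have := integrableD mD fi gi; exact: eq_integrable. Qed.

Lemma integrable_sub D f g : measurable D -> mu.-integrable D (EFin \o f) ->
  mu.-integrable D (EFin \o g) -> mu.-integrable D (EFin \o (fun x => f x - g x)).
Proof. by move=> mD fi gi; have := integrableB mD fi gi; exact: eq_integrable. Qed.

Lemma integrable_scale D f k : measurable D -> mu.-integrable D (EFin \o f) ->
  mu.-integrable D (EFin \o (fun x => k * f x)).
Proof. by move=> mD fi; have := integrableZl mD k fi; exact: eq_integrable. Qed.

Lemma integrable_abs D f : mu.-integrable D (EFin \o f) ->
  mu.-integrable D (EFin \o (fun x => `|f x|)).
Proof. exact: integrable_norm. Qed.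

Lemma integrable_dominated D f g : measurable_fun D f ->
  (forall x, D x -> `|f x| <= g x) -> measurable D ->
  mu.-integrable D (EFin \o g) -> mu.-integrable D (EFin \o f).
Proof.
move=> mf fg mD gi; apply: le_integrable gi => //; first exact/measurable_EFinP.
by move=> x Dx /=; rewrite lee_fin (le_trans (fg x Dx))// ler_norm.
Qed.

Lemma integrable_measurable_fun D f : mu.-integrable D (EFin \o f) -> measurable_fun D f.
Proof. by move=> /measurable_int/measurable_EFinP. Qed.

Lemma integrable_mul_bounded D f g M : measurable D -> mu.-integrable D (EFin \o f) ->
  measurable_fun D g -> (forall x, D x -> `|g x| <= M) ->
  mu.-integrable D (EFin \o (fun x => f x * g x)).
Proof.
move=> mD fi mg gM; apply: (@integrable_dominated _ _ (fun x => M * `|f x|)) => //.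
- by apply: measurable_funM => //; exact: integrable_measurable_fun fi.
- by move=> x Dx; rewrite normrM mulrC ler_wpM2r// gM.
- by apply: integrable_scale => //; exact: integrable_abs.
Qed.

Lemma integrable_const D k : measurable D -> (mu D < +oo)%E ->
  mu.-integrable D (EFin \o (fun=> k)).
Proof.
move=> mD muD; apply: measurable_bounded_integrable => //.
exists `|k|; split; first exact: num_real.
by move=> r kr x _ /=; exact: ltW.
Qed.

Lemma integrable_subset A D f : measurable A -> measurable D -> D `<=` A ->
  mu.-integrable A (EFin \o f) -> mu.-integrable D (EFin \o f).
Proof. exact: integrableS. Qed.

Lemma integrable_patch D f : measurable D ->
  mu.-integrable D (EFin \o f) <-> mu.-integrable setT (EFin \o (f \_ D)).
Proof. by move=> mD; rewrite -restrict_EFin; exact: integrable_mkcond. Qed.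

Lemma ae_imp (P Q : T -> Prop) : (forall x, P x -> Q x) ->
  {ae mu, forall x, P x} -> {ae mu, forall x, Q x}.
Proof.
move=> PQ; apply: filterS => //; exact: (ae_filter_ringOfSetsType mu).
Qed.

Lemma ae_and (P Q : T -> Prop) : {ae mu, forall x, P x} ->
  {ae mu, forall x, Q x} -> {ae mu, forall x, P x /\ Q x}.
Proof.
have F := ae_filter_ringOfSetsType mu.
by move=> aP aQ; apply: filterI.
Qed.

End Toolbox.

Section LebesgueToolbox.
Context {R : realType}.
Implicit Types (D : set R) (f g : R -> R).
Notation mu := (@lebesgue_measure R).

Lemma Rintegral_supp D f : (forall x, ~ D x -> f x = 0) ->
  \int[mu]_(x in D) f x = \int[mu]_x f x.
Proof.
move=> fD; rewrite Rintegral_mkcond; apply: eq_Rintegral => x _.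
rewrite patchE; case: ifPn => // /negP xD; rewrite fD// => Dx.
by apply: xD; rewrite inE.
Qed.

Lemma continuous_integrable_itv f (x y : R) : continuous f ->
  mu.-integrable `[x, y] (EFin \o f).
Proof.
move=> cf; apply: continuous_compact_integrable; first exact: segment_compact.
exact: continuous_subspaceT.
Qed.

Lemma locally_integrable_compact D f K : locally_integrable D f ->
  K `<=` D -> compact K -> mu.-integrable K (EFin \o f).
Proof.
move=> [mf oD fK] KD cK; apply/integrableP; split; last exact: fK.
apply/measurable_EFinP; apply: measurable_funS mf => //.
exact: open_measurable.
Qed.

Lemma locally_integrable_itv (a b : R) f (x y : R) :
  locally_integrable `]a, b[ f -> a < x -> y < b ->
  mu.-integrable `[x, y] (EFin \o f).
Proof.
move=> lf ax yb; apply: (locally_integrable_compact lf).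
  by apply: subset_itv; rewrite bnd_simp.
exact: segment_compact.
Qed.

Lemma itv_oc_cc (c d : R) : `]c, d] `<=` `[c, d].
Proof. by apply: subset_itvScc; rewrite bnd_simp. Qed.

End LebesgueToolbox.

(** * A smooth bump and a smooth step *)
Section Smooth.
Context {R : realType}.
Implicit Types f g : R -> R.

(** n-fold differentiability by recursion on the derivative: in this form products
    and affine changes of variable are handled by plain induction. *)
Fixpoint nderivable (n : nat) f : Prop :=
  if n is m.+1 then (forall x, derivable f x 1) /\ nderivable m (derive1 f) else True.

Definition smooth f := forall n, nderivable n f.

Lemma smooth_derivable f : smooth f ->
  forall (n : nat) (x : R), derivable (derive1n n f) x 1.
Proof.
move=> sf n x; elim: n f sf => [|n IHn] f sf.
  by have [+ _] := sf 1%N; exact.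
rewrite derive1Sn; apply: IHn => m.
by have [_] := sf m.+1.
Qed.

Lemma nderivableW n f : nderivable n.+1 f -> nderivable n f.
Proof. by elim: n f => // n IHn f [df dn]; split => //; exact: IHn. Qed.

Lemma derive1_fun (f g : R -> R) :
  (forall x : R, is_derive x 1 f (g x)) -> (derive1 f) = g.
Proof. by move=> fg; apply/funext => x; rewrite derive1E derive_val. Qed.

Lemma nderivableD n f g : nderivable n f -> nderivable n g -> nderivable n (f \+ g).
Proof.
elim: n f g => // n IHn f g [df dnf] [dg dng]; split => [x|].
  exact: derivableD.
rewrite (_ : derive1 _ = (derive1 f) \+ (derive1 g)); first exact: IHn.
by apply/funext => x; rewrite derive1E deriveD// -!derive1E.
Qed.

Lemma nderivableM n f g : nderivable n f -> nderivable n g -> nderivable n (f \* g).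
Proof.
elim: n f g => // n IHn f g [df dnf] [dg dng]; split => [x|].
  exact: derivableM.
rewrite (_ : derive1 _ = (f \* (derive1 g)) \+ (g \* (derive1 f))).
  apply: nderivableD; apply: IHn => //; exact: nderivableW.
by apply/funext => x; rewrite derive1E deriveM// -!derive1E.
Qed.

Lemma nderivable_cst n (c : R) : nderivable n (cst c).
Proof.
elim: n c => // n IHn c; split => [x|]; first exact: derivable_cst.
by rewrite (_ : derive1 _ = cst 0)//; apply/funext => x; rewrite derive1_cst.
Qed.

Lemma smooth_affine f (a b : R) : smooth f -> smooth (fun x => f (a * x + b)).
Proof.
move=> sf n; move: (sf n) => {sf}; elim: n f => // n IHn f [df dnf].
have D (x : R) : is_derive x 1 (fun x => f (a * x + b)) (a * (derive1 f) (a * x + b)).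
  have df' : is_derive (a * x + b) 1 f ((derive1 f) (a * x + b)).
    by rewrite derive1E; apply: DeriveDef.
  have da : is_derive x 1 (fun x : R => a * x + b : R) a.
    by apply: is_derive_eq; rewrite /= addr0 /GRing.scale/= mulr1.
  by rewrite mulrC; apply: (@is_derive1_comp _ f (fun x : R => a * x + b)).
split => [x|]; first by case: (D x).
rewrite (derive1_fun D).
apply: (@nderivableM n (cst a)); first exact: nderivable_cst.
exact: IHn.
Qed.


Lemma smooth_primitive f g :
  (forall x : R, is_derive x 1 f (g x)) -> smooth g -> smooth f.
Proof.
move=> fg sg [|n]//; split; first by move=> x; case: (fg x).
by rewrite (derive1_fun fg).
Qed.

(** The derivatives of exp (- 1 / x), extended by 0, are all of the form
    p (1 / x) exp (- 1 / x) with p a polynomial. *)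
Definition flat (p : {poly R}) (x : R) : R :=
  if 0 < x then p.[x^-1] * expR (- x^-1) else 0.

(** exp t dominates every power of t, here with two powers to spare, so that [flat p]
    has derivative 0 at 0. *)
Lemma flat_bound p : exists2 C : R, 0 <= C &
  forall x, `|flat p x| <= C * x ^+ 2.
Proof.
have Xb (n : nat) : exists2 C : R, 0 <= C & forall t : R, 0 < t ->
    t ^+ n * expR (- t) <= C * (t^-1) ^+ 2.
  exists (n.+2)`!%:R => // t t0.
  have F0 : 0 < (n.+2)`!%:R :> R by rewrite ltr0n fact_gt0.
  have /(_ (ltW t0)) := @expR_ge1Dxn R t n.+1.
  move=> H; have : t ^+ n.+2 / (n.+2)`!%:R <= expR t by lra.
  rewrite ler_pdivrMr// => H1.
  rewrite expRN exprVn ler_pdivrMr ?expR_gt0// mulrAC ler_pdivlMr ?exprn_gt0//.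
  by rewrite -exprD addn2 mulrC.
have Pb : forall n, exists2 C : R, 0 <= C & forall t : R, 0 < t ->
    `|p.[t]| * t ^+ n * expR (- t) <= C * (t^-1) ^+ 2.
  elim/poly_ind: p => [|p c IH] n.
    by exists 0 => // t t0; rewrite horner0 normr0 !mul0r.
  have [C1 C10 H1] := IH n.+1; have [C2 C20 H2] := Xb n.
  exists (C1 + `|c| * C2) => [|t t0]; first by rewrite addr_ge0// mulr_ge0.
  rewrite hornerMXaddC mulrDl; apply: le_trans (lerD (H1 t t0) _); last first.
    by rewrite -mulrA; apply: ler_wpM2l (H2 t t0); exact: normr_ge0.
  rewrite mulrA -mulrDl ler_wpM2r ?expR_ge0// exprS mulrA -mulrDl.
  rewrite ler_wpM2r ?exprn_ge0 ?(ltW t0)//.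
  by rewrite (le_trans (ler_normD _ _))// normrM (gtr0_norm t0).
have [C C0 H] := Pb 0%N; exists C => // x; rewrite /flat; case: ltP => x0.
  have := H _ (_ : 0 < x^-1); rewrite invr_gt0 invrK expr0 mulr1 => /(_ x0).
  by rewrite normrM (ger0_norm (expR_ge0 _)).
by rewrite normr0 mulr_ge0 ?sqr_ge0.
Qed.

(** The family [flat p] is stable under differentiation, whence smoothness. *)
Lemma is_derive_flat p (x : R) : is_derive x 1 (flat p) (flat ('X^2 * (p - p^`())) x).
Proof.
have [x0|x0|->] := ltgtP x 0.
- apply: (@near_eq_is_derive _ _ _ (cst 0)); last first.
    by rewrite /flat ltNge ltW//=; exact: is_derive_cst.
  by near do rewrite /flat ltNge ltW//=; exact: lt_nbhsl.
- apply: (@near_eq_is_derive _ R^o R^o (fun x : R => p.[x^-1] * expR (- x^-1) : R)).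
    by near do rewrite /flat ifT//; exact: lt_nbhsr.
  have dV : is_derive x 1 (fun x : R => x^-1) (- x ^- 2).
    have xn0 : id x != 0 by rewrite gt_eqF.
    by apply: (is_derive_eq (is_deriveV xn0 (is_derive_id _ _))); exact: mulr1.
  have d1 := @is_derive1_comp R (fun y => p.[y]) (fun x => x^-1) x _ _ _ dV.
  have d2 := @is_derive1_comp R expR (fun x => - x^-1) x _ _ _ (is_deriveN _).
  apply: is_derive_eq.
  rewrite /flat x0 /GRing.scale/= !hornerE.
  transitivity (p.[x^-1] * expR (- x^-1) * x ^- 2 -
      expR (- x^-1) * p^`().[x^-1] * x ^- 2); last by field; rewrite gt_eqF.
  by congr (_ * _ + _); rewrite ?opprK// -[RHS]mulrN -[in RHS](mulr1 (_ * p^`().[_])).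
have f0 q : flat q 0 = 0 by rewrite /flat ltxx.
have [C C0 HC] := flat_bound p.
have cv : h^-1 *: (flat p (h *: 1 + 0) - flat p 0) @[h --> 0^'] --> (0 : R^o).
  apply/cvgr0Pnorm_le => e e0; near=> h.
  have h0 : h != 0 by near: h; exact: nbhs_dnbhs_neq.
  rewrite f0 subr0 addr0 /GRing.scale/= mulr1 normrM normfV.
  rewrite ler_pdivrMl ?normr_gt0//; apply: (le_trans (HC h)).
  rewrite -[h ^+ 2]real_normK ?num_real// expr2 mulrA mulrC ler_wpM2l//.
  apply: (@le_trans _ _ ((C + 1) * `|h|)); first by rewrite ler_wpM2r// lerDl.
  rewrite mulrC -ler_pdivlMr ?ltr_wpDl//; near: h.
  apply: dnbhs0_le; rewrite divr_gt0// ltr_wpDl//.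
by rewrite f0; apply: DeriveDef; [apply/cvg_ex; exists 0|exact/cvg_lim].
Unshelve. all: by end_near. Qed.

Lemma smooth_flat p : smooth (flat p).
Proof.
move=> n; elim: n p => // n IHn p; split => [x|].
  by case: (is_derive_flat p x).
by rewrite (derive1_fun (is_derive_flat p)).
Qed.

Definition raw_bump (x : R) : R := flat 1 x * flat 1 (- 1 * x + 1).

Lemma smooth_raw_bump : smooth raw_bump.
Proof.
move=> n; apply: (@nderivableM n (flat 1)); first exact: smooth_flat.
exact: (smooth_affine _ _ (smooth_flat _)).
Qed.

Lemma flat1_ge0 x : 0 <= flat 1 x.
Proof. by rewrite /flat; case: ifP => // _; rewrite hornerE mul1r expR_ge0. Qed.

Lemma flat1_le1 x : flat 1 x <= 1.
Proof.
rewrite /flat; case: ifP => // x0; rewrite hornerE mul1r expR_le1.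
by rewrite oppr_le0 invr_ge0 ltW.
Qed.

Lemma raw_bump_ge0 x : 0 <= raw_bump x.
Proof. by rewrite mulr_ge0 ?flat1_ge0. Qed.

Lemma raw_bump_le1 x : raw_bump x <= 1.
Proof. by rewrite mulr_ile1 ?flat1_ge0 ?flat1_le1. Qed.

Lemma raw_bump_out x : x \notin `]0, 1[ -> raw_bump x = 0.
Proof.
rewrite in_itv/= negb_and -!leNgt /raw_bump => /orP[x0|x1].
  by rewrite [flat 1 x]/flat ltNge x0/= mul0r.
by rewrite {2}/flat ltNge (_ : -1 * x + 1 <= 0) ?mulr0//; lra.
Qed.

Lemma raw_bump_gt0 x : 0 < x -> x < 1 -> 0 < raw_bump x.
Proof.
move=> x0 x1; rewrite mulr_gt0// /flat ifT ?hornerE ?mul1r ?expR_gt0//; lra.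
Qed.

Lemma smooth_continuous f : smooth f -> continuous f.
Proof.
move=> sf x; have [+ _] := sf 1%N.
by move=> /(_ x) /derivable1_diffP/differentiable_continuous.
Qed.

Notation mu := (@lebesgue_measure R).

Let raw_bump_int a b : mu.-integrable `[a, b] (EFin \o raw_bump).
Proof.
apply: continuous_compact_integrable; first exact: segment_compact.
exact/continuous_subspaceT/smooth_continuous/smooth_raw_bump.
Qed.

Definition raw_step (x : R) := (\int[mu]_(t in `[(-1)%R, x]) raw_bump t)%R.

Lemma raw_step_le0 x : x <= 0 -> raw_step x = 0.
Proof.
move=> x0; rewrite /raw_step (@eq_Rintegral _ _ _ _ _ (fun=> 0)); first by rewrite Rintegral_cst// mul0r.
move=> t; rewrite inE/= in_itv/= => /andP[_ tx]; apply: raw_bump_out.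
by rewrite in_itv/= negb_and -leNgt (le_trans tx).
Qed.

Lemma is_derive_raw_step (x : R) : is_derive x 1 raw_step (raw_bump x).
Proof.
have [x1|x1] := ltP (-1) x.
  have [] := @continuous_FTC1_closed R raw_bump (-1) x (x + 1) _ _ x1 _.
  - by rewrite ltrDl.
  - exact: raw_bump_int.
  - exact/smooth_continuous/smooth_raw_bump.
  - by move=> d e; apply: DeriveDef => //; rewrite -derive1E.
rewrite raw_bump_out; last by rewrite in_itv/= negb_and -leNgt (le_trans x1).
apply: (@near_eq_is_derive _ _ _ (cst 0)).
near=> y; rewrite raw_step_le0//; apply: ltW; near: y; apply: lt_nbhsl.
by rewrite (le_lt_trans x1)// ltrN10.
Unshelve. all: by end_near. Qed.

Definition bump_mass := raw_step 1.

(** By the mean value theorem, as the bump is positive inside ]0, 1[. *)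
Lemma bump_mass_gt0 : 0 < bump_mass.
Proof.
have [||c] := @MVT R raw_step raw_bump 0 1 ltr01.
- by move=> x _; exact: is_derive_raw_step.
- apply: continuous_subspaceT => x; apply: differentiable_continuous.
  by apply/derivable1_diffP; case: (is_derive_raw_step x).
rewrite in_itv/= => /andP[c0 c1]; rewrite (raw_step_le0 (lexx _)) !subr0 mulr1.
by rewrite /bump_mass => ->; exact: raw_bump_gt0.
Qed.

Lemma raw_step_ge1 x : 1 <= x -> raw_step x = bump_mass.
Proof.
rewrite le_eqVlt => /predU1P[<-//|x1].
have [||c] := @MVT R raw_step raw_bump 1 x x1.
- by move=> y _; exact: is_derive_raw_step.
- apply: continuous_subspaceT => y; apply: differentiable_continuous.
  by apply/derivable1_diffP; case: (is_derive_raw_step y).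
rewrite in_itv/= => /andP[c0 _]; rewrite (raw_bump_out (x := c)); last first.
  by rewrite in_itv/= negb_and -!leNgt (ltW c0) orbT.
by rewrite mul0r => /eqP; rewrite subr_eq0 => /eqP.
Qed.

Lemma raw_step_nondecreasing : {homo raw_step : x y / x <= y}.
Proof.
move=> x y; rewrite le_eqVlt => /predU1P[<-//|xy].
have [||c _] := @MVT R raw_step raw_bump x y xy.
- by move=> z _; exact: is_derive_raw_step.
- apply: continuous_subspaceT => z; apply: differentiable_continuous.
  by apply/derivable1_diffP; case: (is_derive_raw_step z).
by move=> e; rewrite -subr_ge0 e mulr_ge0 ?raw_bump_ge0// subr_ge0 ltW.
Qed.

Definition bump (x : R) := bump_mass^-1 * raw_bump x.
Definition step (x : R) := bump_mass^-1 * raw_step x.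

Lemma is_derive_step (x : R) : is_derive x 1 step (bump x).
Proof. by have h := is_derive_raw_step x; apply: is_derive_eq. Qed.

Lemma smooth_bump : smooth bump.
Proof.
move=> n; apply: (@nderivableM n (cst bump_mass^-1)); first exact: nderivable_cst.
exact: smooth_raw_bump.
Qed.

Lemma smooth_step : smooth step.
Proof. exact: smooth_primitive is_derive_step smooth_bump. Qed.

Lemma step_le0 x : x <= 0 -> step x = 0.
Proof. by move=> x0; rewrite /step raw_step_le0// mulr0. Qed.

Lemma step_ge1 x : 1 <= x -> step x = 1.
Proof. by move=> x1; rewrite /step raw_step_ge1// mulVf// gt_eqF// bump_mass_gt0. Qed.

Lemma step_itv x : 0 <= step x <= 1.
Proof.
have [x0|x0] := leP x 0; first by rewrite step_le0// lexx ler01.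
have [x1|x1] := leP 1 x; first by rewrite step_ge1// lexx ler01.
rewrite -(step_le0 (lexx 0)) -(step_ge1 (lexx 1)).
rewrite /step !ler_pM2l ?invr_gt0 ?bump_mass_gt0//.
by rewrite !raw_step_nondecreasing// ltW.
Qed.

Lemma bump_out x : x \notin `]0, 1[ -> bump x = 0.
Proof. by move=> x01; rewrite /bump raw_bump_out// mulr0. Qed.

Lemma bump_itv x : 0 <= bump x <= bump_mass^-1.
Proof.
have M0 : 0 <= bump_mass^-1 by rewrite invr_ge0 ltW// bump_mass_gt0.
by rewrite /bump mulr_ge0 ?raw_bump_ge0//= ler_piMr// raw_bump_le1.
Qed.

End Smooth.

(** * Smooth ramps and their derivatives *)
Section Ramps.
Context {R : realType}.
Implicit Types (D : set R) (f g : R -> R).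
Notation mu := (@lebesgue_measure R).

(** The bump rescaled to ]c, c + e[ with mass 1: an approximate Dirac mass at c. *)
Definition pulse (e c x : R) := e^-1 * bump ((x - c) / e).
(** For small e a smooth approximation of the indicator of ]c, d]; its derivative
    is the difference of the pulses at c and d. *)
Definition ramp (e c d x : R) := step ((x - c) / e) - step ((x - d) / e).

Lemma is_derive_step_scaled (e c x : R) :
  is_derive x 1 (fun x => step ((x - c) / e)) (pulse e c x).
Proof.
have da : is_derive x 1 (fun x : R => (x - c) / e : R) e^-1.
  by apply: is_derive_eq; rewrite /= ?subr0 /GRing.scale/= ?mulr1 ?mulr0 ?add0r.
rewrite /pulse mulrC.
exact: (@is_derive1_comp _ step (fun x : R => (x - c) / e) x _ _ (is_derive_step _)).
Qed.

Lemma is_derive_ramp (e c d x : R) :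
  is_derive x 1 (ramp e c d) (pulse e c x - pulse e d x).
Proof.
by apply: is_deriveB; exact: is_derive_step_scaled.
Qed.

Lemma smooth_step_scaled (e c : R) : smooth (fun x => step ((x - c) / e)).
Proof.
rewrite (_ : (fun x => _) = (fun x => step (e^-1 * x + - (c / e)))).
  exact: smooth_affine smooth_step.
by apply/funext => x; congr step; ring.
Qed.

Lemma smooth_ramp (e c d : R) : smooth (ramp e c d).
Proof.
have -> : ramp e c d = (fun x => step ((x - c) / e)) \+
    (cst (-1) \* (fun x => step ((x - d) / e))).
  by apply/funext => x; rewrite /ramp/= mulN1r.
move=> n; apply: nderivableD; first exact: smooth_step_scaled.
by apply: nderivableM; [exact: nderivable_cst|exact: smooth_step_scaled].
Qed.

Lemma ramp_out (e c d x : R) : 0 < e -> c <= d -> x \notin `[c, d + e] ->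
  ramp e c d x = 0.
Proof.
move=> e0 cd; rewrite in_itv/= negb_and -!ltNge /ramp => /orP[xc|xd].
  rewrite !step_le0 ?subrr//; rewrite pmulr_lle0 ?invr_gt0//; lra.
rewrite !step_ge1 ?subrr//; rewrite ler_pdivlMr//; lra.
Qed.

Lemma ramp_itv (e c d x : R) : `|ramp e c d x| <= 1.
Proof.
rewrite /ramp; have /andP[a1 a2] := step_itv ((x - c) / e).
by have /andP[b1 b2] := step_itv ((x - d) / e); rewrite ler_norml; lra.
Qed.

Lemma pulse_out (e c x : R) : 0 < e -> x \notin `]c, c + e[ -> pulse e c x = 0.
Proof.
move=> e0; rewrite in_itv/= negb_and -!leNgt /pulse => xce.
rewrite bump_out ?mulr0// in_itv/= negb_and -!leNgt.
by case/orP: xce => h; apply/orP; [left|right];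
  rewrite ?pmulr_lle0 ?invr_gt0 ?ler_pdivlMr//; lra.
Qed.

Lemma test_function_ramp (a b e c d : R) : 0 < e -> a < c -> c <= d ->
  d + e < b -> test_function `]a, b[ (ramp e c d).
Proof.
move=> e0 ac cd db.
have cl : closure [set x | ramp e c d x != 0] `<=` `[c, d + e].
  rewrite closureE; apply: smallest_sub; first exact: itv_closed.
  move=> x /=; apply: contra_neqP => /negP; exact: ramp_out.
split.
- exact: smooth_derivable (smooth_ramp _ _ _).
- apply: (subclosed_compact _ _ cl); first exact: closed_closure.
  exact: segment_compact.
- apply: (subset_trans cl) => x /=; rewrite !in_itv/= => /andP[cx xd].
  by rewrite (lt_le_trans ac cx) (le_lt_trans xd db).
Qed.

Lemma pulse_ge0 (e c x : R) : 0 < e -> 0 <= pulse e c x.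
Proof.
move=> e0; rewrite mulr_ge0// ?invr_ge0 ?(ltW e0)//.
by have /andP[] := bump_itv ((x - c) / e).
Qed.

Lemma continuous_pulse (e c : R) : continuous (pulse e c).
Proof.
apply: smooth_continuous.
have -> : pulse e c = cst e^-1 \* (fun x => bump (e^-1 * x + - (c / e))).
  by apply/funext => x; rewrite /pulse /=; congr (_ * bump _); ring.
move=> n; apply: nderivableM; first exact: nderivable_cst.
exact: smooth_affine smooth_bump _.
Qed.

Lemma pulse_mass (e c : R) : 0 < e -> \int[mu]_x pulse e c x = 1.
Proof.
move=> e0; rewrite -(@Rintegral_supp _ `[c, c + e]); last first.
  move=> x /negP xD; apply: pulse_out => //; apply: contra xD.
  exact: subset_itvW.
rewrite /Rintegral (@continuous_FTC2 _ _ (fun x => step ((x - c) / e))).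
- rewrite /= subrr mul0r (step_le0 (lexx 0)) subr0 step_ge1// ler_pdivlMr// mul1r.
  by rewrite addrAC subrr add0r.
- by rewrite ltrDl.
- exact/continuous_subspaceT/continuous_pulse.
- split.
  + by move=> x _; case: (is_derive_step_scaled e c x).
  + apply: cvg_at_right_filter.
    exact: (smooth_continuous (smooth_step_scaled e c)).
  + apply: cvg_at_left_filter.
    exact: (smooth_continuous (smooth_step_scaled e c)).
- move=> x _; rewrite derive1E.
  exact: (@derive_val _ _ _ _ _ _ _ (is_derive_step_scaled e c x)).
Qed.

End Ramps.

(** * Approximate Dirac masses at Lebesgue points *)
Section PulseLimit.
Context {R : realType}.
Implicit Types (D : set R) (f g : R -> R).
Notation mu := (@lebesgue_measure R).

(** The pulse is at most a constant times the mean value over the ball of radius e,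
    so the error is controlled by the mean oscillation that vanishes at Lebesgue
    points. *)
Lemma pulse_cvg (a b c : R) f : locally_integrable `]a, b[ f ->
  a < c -> c < b -> lebesgue_pt f c ->
  \int[mu]_(x in `]a, b[) (f x * pulse e c x) @[e --> 0^'+] --> f c.
Proof.
move=> lf ac cb fc; apply/cvgrPdist_le => eta eta0.
pose M := (@bump_mass R)^-1.
have M0 : 0 < M by rewrite invr_gt0 bump_mass_gt0.
have nd : \forall e \near 0^'+, (davg f c e < (eta / (2 * M))%:E)%E.
  apply: (fc (fun x => (x < (eta / (2 * M))%:E)%E)).
  apply: open_nbhs_nbhs; split; first exact: open_ereal_lt_ereal.
  by rewrite /= lte_fin divr_gt0// mulr_gt0.
near=> e.
have e0 : 0 < e by [].
have ace : a < c - e.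
  rewrite ltrBrDr -ltrBrDl; near: e; apply: nbhs_right_lt; rewrite subr_gt0//.
have ceb : c + e < b.
  rewrite -ltrBrDl; near: e; apply: nbhs_right_lt; rewrite subr_gt0//.
have supp (h : R -> R) A : `]c, c + e[ `<=` A ->
    \int[mu]_(x in A) (h x * pulse e c x) = \int[mu]_x (h x * pulse e c x).
  move=> cA; apply: Rintegral_supp => x xA; rewrite pulse_out ?mulr0//.
  by apply/negP => xc; apply: xA; exact: cA.
have ballE : ball c e = `]c - e, c + e[%classic by rewrite ball_itv.
have mB : measurable (ball c e) by exact: measurable_ball.
have cB : `]c, c + e[ `<=` ball c e.
  by rewrite ballE; apply: subset_itvr; rewrite bnd_simp lerBlDr lerDl ltW.
have fiB : mu.-integrable (ball c e) (EFin \o f).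
  apply: (@integrableS _ _ _ mu `[c - e, c + e] (ball c e)) => //; last first.
    exact: locally_integrable_itv lf ace ceb.
  by rewrite ballE; exact: subset_itvW.
have bp (h : R -> R) : mu.-integrable (ball c e) (EFin \o h) ->
    mu.-integrable (ball c e) (EFin \o (fun x => h x * pulse e c x)).
  move=> hi; apply: (@integrable_mul_bounded _ _ _ _ _ _ _ (e^-1 * M)) => //.
    apply: (@measurable_funS _ _ _ _ setT) => //.
    by apply: continuous_measurable_fun; exact: continuous_pulse.
  move=> x _; rewrite ger0_norm ?pulse_ge0//.
  by rewrite ler_pM2l ?invr_gt0//; case/andP: (bump_itv ((x - c) / e)).
have cst_i k : mu.-integrable (ball c e) (EFin \o (fun=> k)).
  apply: integrable_const => //; rewrite [ltLHS](_ : _ = (e *+ 2)%:E) ?ltry//.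
  exact: lebesgue_measure_ball (ltW e0).
have fci : mu.-integrable (ball c e) (EFin \o (fun x => f x - f c)) by exact: integrable_sub.
have -> : f c - \int[mu]_(x in `]a, b[) (f x * pulse e c x) =
  - \int[mu]_(x in ball c e) ((f x - f c) * pulse e c x).
  have -> : \int[mu]_(x in ball c e) ((f x - f c) * pulse e c x) =
    \int[mu]_(x in ball c e) (f x * pulse e c x) -
    \int[mu]_(x in ball c e) (f c * pulse e c x).
    rewrite -RintegralB//; last 2 first.
    - exact: bp.
    - exact: (bp (fun=> f c) (cst_i (f c))).
    by apply: eq_Rintegral => x _; rewrite mulrBl.
  rewrite (supp f (ball c e))// (supp (cst (f c)) (ball c e))// opprB; congr (_ - _).
    have pi : mu.-integrable (ball c e) (EFin \o (pulse e c)).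
      by have := bp _ (cst_i 1); apply: eq_integrable_fun => // x _; rewrite mul1r.
    rewrite -(supp (cst (f c)) (ball c e))// RintegralZl//.
    rewrite (_ : \int[mu]_(_ in _) _ = 1) ?mulr1// -(pulse_mass c e0).
    apply: Rintegral_supp => x xA; rewrite pulse_out//.
    by apply/negP => xc; apply: xA; exact: cB.
  rewrite (supp f)// => x /=; rewrite !in_itv/= => /andP[cx xc].
  by rewrite (lt_trans ac cx) (lt_trans xc ceb).
rewrite normrN (le_trans (le_normr_Rintegral _ _))//; first exact: bp.
apply: (@le_trans _ _ (\int[mu]_(x in ball c e) (e^-1 * M * `|f x - f c|))).
  apply: le_Rintegral => //.
  - exact/integrable_abs/bp.
  - by apply: integrable_scale => //; exact: integrable_abs.
  - move=> x _; rewrite normrM (ger0_norm (pulse_ge0 _ _ e0)) mulrC.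
    rewrite ler_wpM2r// ler_pM2l ?invr_gt0//.
    by case/andP: (bump_itv ((x - c) / e)).
rewrite RintegralZl//; last exact: integrable_abs.
have dav : (davg f c e < (eta / (2 * M))%:E)%E by near: e.
move: dav; rewrite /davg /iavg (lebesgue_measure_ball _ (ltW e0)).
rewrite inver mulrn_eq0/= gt_eqF//.
have /(_ mB) := @integrable_fin_num _ _ _ mu _ _ _ (integrable_abs fci).
move=> /fineK <-; rewrite -EFinM lte_fin => H.
rewrite -mulrA ler_pdivrMl//.
move: H; rewrite mulrC ltr_pdivrMr ?mulr2n ?addr_gt0//.
set I := fine _ => H.
rewrite mulrC -ler_pdivlMr//; apply: (le_trans (ltW H)).
rewrite le_eqVlt; apply/orP; left; apply/eqP; field.
by rewrite gt_eqF.
Unshelve. all: by end_near. Qed.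

End PulseLimit.

(** * Increments of a weakly differentiable function *)
Section WeakToPrimitive.
Context {R : realType}.
Implicit Types (D : set R) (f g : R -> R).
Notation mu := (@lebesgue_measure R).

Lemma ramp_cvg (c d x : R) (u : R^nat) : c < d -> (forall n, 0 < u n) ->
  u n @[n --> \oo] --> 0 ->
  ramp (u n) c d x @[n --> \oo] --> (\1_`]c, d] x : R).
Proof.
move=> cd u0 uc.
have stp y : step ((x - y) / u n) @[n --> \oo] --> ((y < x)%R%:R : R).
  have [yx|xy] := ltP y x; last first.
    rewrite (_ : (fun n => _) = cst 0); first exact: cvg_cst.
    apply/funext => n; rewrite step_le0//.
    by rewrite pmulr_lle0 ?invr_gt0// subr_le0.
  apply: cvg_near_cst; near=> n.
  rewrite step_ge1// ler_pdivlMr// mul1r.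
  near: n; have : 0 < x - y by rewrite subr_gt0.
  by move=> xy; apply: (cvgr_le _ uc).
rewrite indicE (_ : (_ \in _)%:R = (c < x)%R%:R - (d < x)%R%:R :> R).
  exact: cvgB.
rewrite mem_setE in_itv/=; have [xd|xd] := leP x d; first by rewrite subr0 andbT.
by rewrite andbF (lt_trans cd xd) subrr.
Unshelve. all: by end_near. Qed.

Lemma measurable_ramp (e c d : R) : measurable_fun setT (ramp e c d).
Proof.
by apply: continuous_measurable_fun; apply/smooth_continuous/smooth_ramp.
Qed.

(** Testing with [ramp e c d] and letting e tend to 0: the derivative of the ramp
    yields f c - f d by [pulse_cvg], the ramp itself yields the integral of g by
    dominated convergence. *)
Lemma weak_derivative_primitive (a b c d : R) f g :
  weak_derivative `]a, b[ f g -> a < c -> c < d -> d < b ->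
  lebesgue_pt f c -> lebesgue_pt f d ->
  \int[mu]_(x in `]c, d]) g x = f d - f c.
Proof.
move=> [lf lg fg] ac cd db fc fd.
(* The ramp of width u n is supported in [c, d + u n], which must stay in ]a, b[. *)
pose e0 := (b - d) / 2; pose u (n : nat) := e0 * n.+1%:R^-1.
have e00 : 0 < e0 by rewrite divr_gt0// subr_gt0.
have de0b : d + e0 < b by rewrite /e0; lra.
have u0 n : 0 < u n by rewrite mulr_gt0// invr_gt0.
have ue0 n : u n <= e0 by rewrite /u ger_pMr// invf_le1// ler1n.
have uc : u n @[n --> \oo] --> 0.
  rewrite -(mulr0 e0); apply: cvgM; first exact: cvg_cst.
  exact: cvg_harmonic.
pose K := `[c, d + e0]%classic.
have mK : measurable K by exact: measurable_itv.
have KD : K `<=` `]a, b[ by apply: subset_itv; rewrite bnd_simp.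
have fK : mu.-integrable K (EFin \o f) by exact: locally_integrable_itv lf ac de0b.
have gK : mu.-integrable K (EFin \o g) by exact: locally_integrable_itv lg ac de0b.
have pulse_supp y n : y = c \/ y = d -> forall x, ~ K x -> pulse (u n) y x = 0.
  move=> ycd x xK; apply: pulse_out => //; apply/negP => xy; apply: xK.
  move: xy; rewrite /K /= !in_itv/= => /andP[yx xy].
  have := ue0 n; case: ycd => yE; rewrite yE in yx xy => un; lra.
have ramp_supp n x : ~ K x -> ramp (u n) c d x = 0.
  move=> xK; apply: ramp_out => //; first exact: ltW.
  apply/negP => xy; apply: xK; move: xy; rewrite /K /= !in_itv/=.
  by move=> /andP[-> xd]; rewrite (le_trans xd)// lerD2l.
have restr h : (forall x, ~ K x -> h x = 0) ->
    \int[mu]_(x in `]a, b[) h x = \int[mu]_(x in K) h x.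
  move=> hK; rewrite (Rintegral_supp hK); apply: Rintegral_supp => x xD.
  by apply: hK => /KD.
have fpi y n : mu.-integrable K (EFin \o (fun x => f x * pulse (u n) y x)).
  apply: (@integrable_mul_bounded _ _ _ _ _ _ _ ((u n)^-1 * bump_mass^-1)) => //.
    apply: (@measurable_funS _ _ _ _ setT) => //.
    by apply: continuous_measurable_fun; exact: continuous_pulse.
  move=> x _; rewrite ger0_norm ?pulse_ge0//.
  by rewrite ler_pM2l ?invr_gt0//; case/andP: (bump_itv ((x - y) / u n)).
have key n : \int[mu]_(x in `]a, b[) (f x * pulse (u n) c x) -
    \int[mu]_(x in `]a, b[) (f x * pulse (u n) d x) =
    - \int[mu]_(x in K) (g x * ramp (u n) c d x).
  have tr : test_function `]a, b[ (ramp (u n) c d).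
    apply: test_function_ramp => //; first exact: ltW.
    by rewrite (le_lt_trans _ de0b)// lerD2l.
  have := fg _ tr.
  rewrite (restr (fun x => g x * _)); last by move=> x /ramp_supp ->; rewrite mulr0.
  move=> <-.
  rewrite (restr (fun x => f x * pulse (u n) c x)); last first.
    by move=> x xK; rewrite pulse_supp ?mulr0//; left.
  rewrite (restr (fun x => f x * pulse (u n) d x)); last first.
    by move=> x xK; rewrite pulse_supp ?mulr0//; right.
  have dr x : derive1 (ramp (u n) c d) x = pulse (u n) c x - pulse (u n) d x.
    rewrite derive1E.
    exact: (@derive_val _ _ _ _ _ _ _ (is_derive_ramp (u n) c d x)).
  rewrite restr; last first.
    by move=> x xK; rewrite dr !pulse_supp ?subrr ?mulr0//; [right|left].
  rewrite -RintegralB//.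
  by apply: eq_Rintegral => x _; rewrite dr mulrBr.
have lim1 : \int[mu]_(x in `]a, b[) (f x * pulse (u n) c x) -
    \int[mu]_(x in `]a, b[) (f x * pulse (u n) d x) @[n --> \oo] --> f c - f d.
  apply: cvgB.
  - have /cvg_at_rightP := pulse_cvg lf ac (lt_trans cd db) fc.
    by apply; split.
  - have /cvg_at_rightP := pulse_cvg lf (lt_trans ac cd) db fd.
    by apply; split.
have lim2 : \int[mu]_(x in K) (g x * ramp (u n) c d x) @[n --> \oo] -->
    \int[mu]_(x in K) (g x * \1_`]c, d] x).
  have gri n : mu.-integrable K (EFin \o (fun x => g x * ramp (u n) c d x)).
    apply: (@integrable_mul_bounded _ _ _ _ _ _ _ 1) => //.
      by apply: (@measurable_funS _ _ _ _ setT) => //; exact: measurable_ramp.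
    by move=> x _; exact: ramp_itv.
  have gri' : mu.-integrable K (EFin \o (fun x => g x * \1_`]c, d] x)).
    apply: (@integrable_mul_bounded _ _ _ _ _ _ _ 1) => //.
    by move=> x _; rewrite indicE; case: (_ \in _); rewrite ?normr1 ?normr0.
  have [] := @dominated_convergence _ _ _ mu K mK
    (fun n x => (g x * ramp (u n) c d x)%:E) (fun x => (g x * \1_`]c, d] x)%:E)
    (fun x => `|g x|%:E).
  - by move=> n; have /measurable_int := gri n.
  - by have /measurable_int := gri'.
  - apply: aeW => x Kx; apply: cvg_EFin; first by near=> n.
    by apply: cvgM; [exact: cvg_cst|exact: ramp_cvg].
  - exact: integrable_abs.
  - apply: aeW => x n Kx; rewrite /= lee_fin normrM ler_piMr//.
    exact: ramp_itv.
  have -> : (\int[mu]_(x in K) (g x * \1_`]c, d] x)%:E)%E =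
    (fine (\int[mu]_(x in K) (g x * \1_`]c, d] x)%:E))%:E.
    by rewrite fineK//; exact: integrable_fin_num.
  by move=> _ _ /fine_cvg.
have := cvgN lim2; move: lim1; under eq_fun do rewrite key.
move=> l1 /(_ _) l2; have E := cvg_unique (@Rhausdorff R) l1 l2.
have -> : \int[mu]_(x in `]c, d]) g x = \int[mu]_(x in K) (g x * \1_`]c, d] x).
  rewrite Rintegral_mkcond -(@Rintegral_supp _ K).
    apply: eq_Rintegral => x _; rewrite patchE indicE.
    by case: ifP; rewrite ?mulr1 ?mulr0.
  move=> x xK; rewrite patchE; case: ifPn => // xcd; exfalso; apply: xK.
  move: xcd; rewrite inE /K/= !in_itv/= => /andP[cx xd].
  by rewrite (ltW cx) (le_trans xd)// lerDl ltW.
by apply: oppr_inj; rewrite -E opprB.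
Unshelve. all: by end_near. Qed.

End WeakToPrimitive.

(** * Uniqueness of weak derivatives *)
Section Uniqueness.
Context {R : realType}.
Implicit Types (D : set R) (f g h : R -> R).
Notation mu := (@lebesgue_measure R).

(** A function with vanishing integrals has a constant primitive; by the Lebesgue
    differentiation theorem it is almost everywhere the derivative of that primitive. *)
Lemma ae_eq0_closed (x y : R) h : mu.-integrable `[x, y] (EFin \o h) ->
  (forall c d, x <= c -> c < d -> d < y -> \int[mu]_(t in `]c, d]) h t = 0) ->
  {ae mu, forall t, t \in `]x, y[ -> h t = 0}.
Proof.
move=> ih h0.
pose H := h \_ `]x, y[.
have iH : mu.-integrable setT (EFin \o H).
  apply: (integrable_patch mu h (measurable_itv _)).1.
  by apply: (@integrable_subset _ _ _ mu `[x, y]%classic) => //; exact: subset_itvW.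
have lH : locally_integrable setT H.
  exact: (open_integrable_locally openT iH).
have F0 t : t < y -> \int[mu]_(s in `]-oo, t]) H s = 0.
  move=> ty; rewrite Rintegral_mkcond.
  pose Ht := h \_ `]x, t].
  have -> : H \_ `]-oo, t] = Ht.
    apply/funext => s; rewrite /Ht /H !patchE !mem_setE !in_itv/=.
    have [st|ts] := leP s t; last by rewrite andbF.
    by rewrite (le_lt_trans st ty).
  rewrite -Rintegral_mkcond.
  have [tx|xt] := leP t x; first by rewrite set_itv_ge ?Rintegral_set0// bnd_simp -leNgt.
  exact: h0.
have iy t : mu.-integrable `]-oo, t]%classic (EFin \o H).
  exact: (@integrable_subset _ _ _ mu setT).
have FT := @FTC1 R H -oo%O iy lH.
apply: ae_imp FT => t /(_ (ltNyr _)) [_ Ht]; rewrite in_itv/= => /andP[xt ty].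
have -> : h t = H t by rewrite /H patchE mem_setE in_itv/= xt ty.
rewrite -Ht derive1E (@near_eq_derive _ _ _ _ (cst 0)) ?derive_cst ?oner_neq0//.
near=> s; apply: F0; near: s; exact: lt_nbhsl.
Unshelve. all: by end_near. Qed.

Lemma test_function_bounded D phi : test_function D phi ->
  exists M, forall x, `|phi x| <= M.
Proof.
move=> [dphi cK _].
have cphi : continuous phi.
  by move=> x; apply: differentiable_continuous; apply/derivable1_diffP; exact: (dphi 0%N).
set K := closure _ in cK.
have [M [_ HM]] := compact_bounded (continuous_compact (continuous_subspaceT (fun x => (cphi x))) cK).
exists (`|M| + 1) => x; have [xK|xK] := pselect (K x).
  apply: (HM (`|M| + 1)); last by exists x.
  by rewrite (le_lt_trans (ler_norm M))// ltrDl.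
have -> : phi x = 0; last by rewrite normr0 addr_ge0.
by apply/eqP; apply: contra_notT xK => px; exact: subset_closure.
Qed.

Lemma test_function_continuous D phi : test_function D phi -> continuous phi.
Proof.
move=> [dphi _ _] x; apply: differentiable_continuous.
by apply/derivable1_diffP; exact: (dphi 0%N).
Qed.

Lemma integrable_test D f phi : locally_integrable D f -> test_function D phi ->
  mu.-integrable D (EFin \o (fun x => f x * phi x)).
Proof.
move=> lf tphi; have [M HM] := test_function_bounded tphi.
have cphi := test_function_continuous tphi.
have [_ cK KD] := tphi; set K := closure _ in cK KD.
have mK : measurable K by exact: compact_measurable.
have oD : open D by case: lf.
have mD : measurable D by exact: open_measurable.
have fK := locally_integrable_compact lf KD cK.
have fphiK : mu.-integrable K (EFin \o (fun x => f x * phi x)).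
  apply: (@integrable_mul_bounded _ _ _ _ _ _ _ M) => //.
  by apply: (@measurable_funS _ _ _ _ setT) => //; exact: continuous_measurable_fun.
apply/integrableP; split.
  apply/measurable_EFinP/measurable_funM; first by case: lf.
  by apply: (@measurable_funS _ _ _ _ setT) => //; exact: continuous_measurable_fun.
move/integrableP : fphiK => [_]; apply: le_lt_trans.
rewrite [leRHS]integral_mkcond [leLHS]integral_mkcond.
rewrite le_eqVlt; apply/orP; left; apply/eqP; apply: eq_integral => x _.
rewrite !patchE; have [xK|xK] := boolP (x \in K).
  by rewrite ifT// inE; apply: KD; rewrite -inE.
have phi0 : phi x = 0.
  by apply/eqP; apply: contraNT xK => px; rewrite inE; exact: subset_closure.
by case: ifP => // _; rewrite /= phi0 mulr0 normr0.
Qed.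

(** Uniqueness is reduced to the weak derivatives of 0, for which every point is a
    Lebesgue point. *)
Lemma weak_derivative_sub D f g g' : weak_derivative D f g ->
  weak_derivative D f g' -> weak_derivative D (cst 0) (g \- g').
Proof.
move=> [lf lg fg] [_ lg' fg']; have [_ oD _] := lf; split.
- apply: open_integrable_locally => //.
  by apply: eq_integrable (integrable0 _ _) => //; exact: open_measurable.
- exact: locally_integrableB.
- move=> phi tphi; under eq_Rintegral do rewrite mul0r.
  have mD : measurable D by exact: open_measurable.
  have -> : \int[mu]_(x in D) ((g \- g') x * phi x) =
     \int[mu]_(x in D) (g x * phi x) - \int[mu]_(x in D) (g' x * phi x).
    rewrite -RintegralB//; try exact: integrable_test.
    by apply: eq_Rintegral => x _; rewrite /= mulrBl.
  rewrite -[X in - (X - _)]opprK -fg// fg'//; first by rewrite opprK subrr oppr0 Rintegral_cst// mul0r.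
Qed.

Lemma continuous_lebesgue_ptE (a b c : R) f : measurable_fun `]a, b[ f ->
  c \in `]a, b[ -> {for c, continuous f} -> lebesgue_pt f c.
Proof.
move=> mf cab fc; apply: (@continuous_lebesgue_pt _ _ _ `]a, b[%classic) => //.
Qed.


Lemma ae_eq0_open (a b : R) h : locally_integrable `]a, b[ h ->
  (forall c d, a < c -> c < d -> d < b -> \int[mu]_(t in `]c, d]) h t = 0) ->
  {ae mu, forall t, t \in `]a, b[ -> h t = 0}.
Proof.
move=> lh h0.
have : {ae mu, forall t, forall n : nat,
    t \in `]a + n.+1%:R^-1, b - n.+1%:R^-1[ -> h t = 0}.
  apply/ae_foralln => n; have n0 : 0 < n.+1%:R^-1 :> R by [].
  move: n0; set e := n.+1%:R^-1 => n0.
  apply: ae_eq0_closed; first by apply: (locally_integrable_itv lh); lra.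
  by move=> c d *; apply: h0; lra.
apply: ae_imp => t H; rewrite in_itv/= => /andP[at_ tb].
have [n n1] : exists n : nat, n.+1%:R^-1 < Num.min (t - a) (b - t).
  have m0 : 0 < Num.min (t - a) (b - t) by rewrite lt_min !subr_gt0 at_.
  have [N _ HN] := near_infty_natSinv_lt (PosNum m0).
  by exists N; exact: (HN N (leqnn N)).
move: n1; rewrite lt_min => /andP[n1 n2].
apply: (H n); rewrite in_itv/=.
by move: n1 n2; set e := n.+1%:R^-1 => n1 n2; apply/andP; split; lra.
Qed.

Lemma weak_derivative_unique (a b : R) f g g' :
  weak_derivative `]a, b[ f g -> weak_derivative `]a, b[ f g' ->
  {ae mu, forall t, t \in `]a, b[ -> g t = g' t}.
Proof.
move=> fg fg'; have w := weak_derivative_sub fg fg'.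
have lp c : lebesgue_pt (cst 0 : R -> R) c.
  apply: (@continuous_lebesgue_pt _ _ _ setT) => //; last exact: cvg_cst.
  by split => //; exact: openT.
have : {ae mu, forall t, t \in `]a, b[ -> (g \- g') t = 0}.
  apply: ae_eq0_open; first by case: w.
  move=> c d ac cd db.
  by rewrite (weak_derivative_primitive w ac cd db (lp c) (lp d)) subrr.
by apply: ae_imp => t /[apply] /eqP; rewrite subr_eq0 => /eqP.
Qed.

Lemma wderivP D f g : weak_derivative D f g -> weak_derivative D f (wderiv D f).
Proof. by move=> fg; rewrite /wderiv; case: xgetP => [h -> //|/(_ g)]. Qed.

(** Up to a null set, [wderiv] is the weak derivative that one has at hand. *)
Lemma wderiv_ae (a b : R) f g : weak_derivative `]a, b[ f g ->
  {ae mu, forall t, t \in `]a, b[ -> wderiv `]a, b[ f t = g t}.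
Proof. by move=> fg; exact: weak_derivative_unique (wderivP fg) fg. Qed.

Lemma weak_derivative_ae (a b : R) f f' g :
  locally_integrable `]a, b[ f' ->
  {ae mu, forall t, t \in `]a, b[ -> f t = f' t} ->
  weak_derivative `]a, b[ f g -> weak_derivative `]a, b[ f' g.
Proof.
move=> lf' ff' [lf lg fg]; split => // phi tphi; rewrite -fg//.
have dphi : measurable_fun `]a, b[ (derive1 phi).
  have [sm _ _] := tphi.
  apply: (@measurable_funS _ _ _ _ setT) => //.
  apply: continuous_measurable_fun => x; apply: differentiable_continuous.
  by apply/derivable1_diffP; exact: (sm 1%N).
congr fine; apply: ae_eq_integral => //.
- by apply/measurable_EFinP/measurable_funM => //; case: lf'.
- by apply/measurable_EFinP/measurable_funM => //; case: lf.
- by apply: ae_imp ff' => t H tab; rewrite H.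
Qed.

End Uniqueness.

(** * Fubini's theorem for real-valued integrals *)
Section RFubini.
Context {R : realType}.
Notation mu := (@lebesgue_measure R).
Implicit Types F : R * R -> R.

(** The swapped function is integrable because both iterated integrals of the
    absolute value are finite at the same time. *)
Lemma Rfubini_swap F : (mu \x mu)%E.-integrable setT (EFin \o F) ->
  (mu \x mu)%E.-integrable setT (EFin \o (fun z => F (z.2, z.1))).
Proof.
move=> iF; have mF := measurable_int _ iF.
apply/integrable21ltyP.
  have -> : EFin \o (fun z => F (z.2, z.1)) = (EFin \o F) \o (fun z : R * R => (z.2, z.1)) by [].
  apply: measurableT_comp => //; exact: measurable_swap.
by have /integrable12ltyP := iF; apply.
Qed.

Lemma ae_integrable_fst F : (mu \x mu)%E.-integrable setT (EFin \o F) ->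
  {ae mu, forall x, mu.-integrable setT (EFin \o (fun y => F (x, y)))}.
Proof. by move=> iF; have := ae_integrable1 iF; exact: ae_imp. Qed.

(** The inner integrals exist only almost everywhere as finite numbers; replacing
    them by their real value changes the outer integrand on a null set. *)
Lemma Rfubini F : (mu \x mu)%E.-integrable setT (EFin \o F) ->
  mu.-integrable setT (EFin \o (fun x => \int[mu]_y F (x, y))) /\
  (\int[mu]_x (\int[mu]_y F (x, y)) = fine (\int[(mu \x mu)%E]_z (F z)%:E))%R.
Proof.
move=> iF; have iFF := integrable_fubini_F iF.
have mFF := measurable_int _ iFF.
have aeF : ae_eq mu setT (fubini_F mu (EFin \o F))
    (EFin \o (fun x => \int[mu]_y F (x, y))).
  apply: ae_imp (ae_integrable_fst iF) => x ix _.
  by rewrite /= /Rintegral fineK//; exact: integrable_fin_num.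
have mr : measurable_fun setT (EFin \o (fun x => \int[mu]_y F (x, y))).
  apply/measurable_EFinP.
  have -> : (fun x => \int[mu]_y F (x, y)) = fine \o fubini_F mu (EFin \o F) by [].
  by apply: measurableT_comp => //; exact: fine_measurable.
split.
  apply/integrableP; split => //.
  have /integrableP[_] := iFF; apply: le_lt_trans.
  rewrite le_eqVlt; apply/orP; left; apply/eqP.
  apply: ae_eq_integral => //; try exact: measurableT_comp.
  exact/ae_eq_abse/ae_eq_sym.
rewrite /Rintegral.
transitivity (fine (\int[mu]_x fubini_F mu (EFin \o F) x)).
  by congr fine; apply/esym; exact: ae_eq_integral.
by rewrite integral12_prod_meas1.
Qed.

Lemma Rfubini_snd F : (mu \x mu)%E.-integrable setT (EFin \o F) ->
  mu.-integrable setT (EFin \o (fun y => \int[mu]_x F (x, y))) /\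
  (\int[mu]_y (\int[mu]_x F (x, y)) = fine (\int[(mu \x mu)%E]_z (F z)%:E))%R.
Proof.
move=> iF; have iS := Rfubini_swap iF; have [i1 i2] := Rfubini iS.
split; first exact: i1.
rewrite i2; congr fine; rewrite -(integral12_prod_meas1 iS).
by rewrite -(integral21_prod_meas1 iF).
Qed.

Lemma integrable_tensor (G H : R -> R) : mu.-integrable setT (EFin \o G) ->
  mu.-integrable setT (EFin \o H) ->
  (mu \x mu)%E.-integrable setT (EFin \o (fun z => G z.1 * H z.2)).
Proof.
move=> iG iH; have mG := integrable_measurable_fun iG; have mH := integrable_measurable_fun iH.
apply/integrable12ltyP.
  apply/measurable_EFinP/measurable_funM.
  - exact: (measurableT_comp mG (@measurable_fst _ _ _ _)).
  - exact: (measurableT_comp mH (@measurable_snd _ _ _ _)).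
have IH : (\int[mu]_y `|(H y)%:E| < +oo)%E by case/integrableP : iH.
have IG : (\int[mu]_y `|(G y)%:E| < +oo)%E by case/integrableP : iG.
under eq_integral => x _.
  rewrite (_ : (\int[mu]_y _)%E = (`|(G x)%:E| * \int[mu]_y `|(H y)%:E|)%E); last first.
    rewrite -ge0_integralZl//; first last.
      by do 2 apply: measurableT_comp => //.
    by apply: eq_integral => y _; rewrite /= normrM EFinM.
  over.
rewrite ge0_integralZr//; first by rewrite lte_mul_pinfty// ?integral_ge0// ge0_fin_numE// integral_ge0.
- by do 2 apply: measurableT_comp => //.
- exact: integral_ge0.
Qed.

End RFubini.

(** * Primitives are weakly differentiable *)
Section PrimitiveWeak.
Context {R : realType}.
Notation mu := (@lebesgue_measure R).
Implicit Types (D : set R) (f g : R -> R).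

(** The support is compact, so it has a least and a greatest element, strictly
    inside ]a, b[. *)
Lemma test_support (a b : R) phi : a < b -> test_function `]a, b[ phi ->
  exists c d : R, [/\ a < c, c < d, d < b &
    closure [set x | phi x != 0] `<=` `]c, d[].
Proof.
move=> ab [_ cK KD]; set K := closure _ in cK KD *.
have [->|K0] := eqVneq K set0.
  exists (a + (b - a) / 3), (b - (b - a) / 3).
  by split => //; lra.
have {}K0 : K !=set0 by apply/set0P.
have idc : {within K, continuous (fun x : R => x)}.
  by apply: continuous_subspaceT => x; exact: cvg_id.
have [m mK Hm] := compact_EVT_min K0 cK idc.
have [M MK HM] := compact_EVT_max K0 cK idc.
have := KD _ (set_mem mK); have := KD _ (set_mem MK).
rewrite /= !in_itv/= => /andP[aM Mb] /andP[am mb].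
have mM := HM _ mK.
exists ((a + m) / 2), ((M + b) / 2); split; [lra|lra|lra|].
move=> x xK /=; rewrite in_itv/=.
have := Hm x (mem_set xK); have := HM x (mem_set xK) => h1 h2.
by apply/andP; split; lra.
Qed.

(** Off the closed support the function vanishes in a neighbourhood. *)
Lemma derive1_out phi x : ~ closure [set x | phi x != 0] x ->
  derive1 phi x = 0 :> R.
Proof.
move=> xK; rewrite derive1E (@near_eq_derive _ _ _ _ (cst 0)) ?derive_cst ?oner_neq0//.
have : nbhs x (~` closure [set x | phi x != 0]).
  apply: open_nbhs_nbhs; split => //.
  by rewrite openC; exact: closed_closure.
apply: filterS => y yK; apply/eqP; apply: contra_notT yK => py.
exact: subset_closure.
Qed.

Lemma test_derive1_continuous D phi : test_function D phi -> continuous (derive1 phi).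
Proof.
move=> [sm _ _] x; apply: differentiable_continuous.
by apply/derivable1_diffP; exact: (sm 1%N).
Qed.

Lemma test_FTC2 D phi (x y : R) : test_function D phi -> x < y ->
  \int[mu]_(t in `[x, y]) derive1 phi t = phi y - phi x.
Proof.
move=> tphi xy; have cphi := test_function_continuous tphi.
have [sm _ _] := tphi.
rewrite /Rintegral (@continuous_FTC2 _ _ phi)//.
- exact/continuous_subspaceT/(test_derive1_continuous tphi).
- split.
  + by move=> t _; exact: (sm 0%N).
  + exact/cvg_at_right_filter/cphi.
  + exact/cvg_at_left_filter/cphi.
Qed.

(** Inserting f x = f c + int_(]c, x]) g into the integral of f phi' and exchanging
    the order of integration replaces phi' by - phi, as phi vanishes at both ends
    of an interval that contains its support. *)
Lemma primitive_weak_derivative (a b : R) f g : a < b ->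
  {in `]a, b[, continuous f} -> locally_integrable `]a, b[ g ->
  (forall c d, a < c -> c <= d -> d < b ->
     \int[mu]_(t in `]c, d]) g t = f d - f c) ->
  weak_derivative `]a, b[ f g.
Proof.
move=> ab cf lg fg.
have oD : open (`]a, b[%classic : set R) by exact: interval_open.
have cfK K : K `<=` `]a, b[ -> {within K, continuous f}.
  move=> KD; apply: continuous_in_subspaceT => x /set_mem /KD/= xab.
  exact: cf.
have lf : locally_integrable `]a, b[ f.
  split => //.
    by apply: open_continuous_measurable_fun => // x /set_mem; exact: cf.
  move=> K KD cK.
  have /integrableP[_] := @continuous_compact_integrable R f K cK (cfK K KD).
  by [].
split => // phi tphi.
have [c [d [ac cd db supp]]] := test_support ab tphi.
pose K := `]c, d]%classic.
have mK : measurable K by exact: measurable_itv.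
have KD : K `<=` `]a, b[ by apply: subset_itv; rewrite bnd_simp ?ltW.
have supK : closure [set x | phi x != 0] `<=` K.
  by apply: subset_trans supp _; apply: subset_itvW.
have phi0 x : ~ K x -> phi x = 0.
  move=> xK; apply/eqP; apply: contra_notT xK => px; apply: supK.
  exact: subset_closure.
have dphi0 x : ~ K x -> derive1 phi x = 0 by move=> xK; apply: derive1_out => /supK.
have restr h : (forall x, ~ K x -> h x = 0) ->
    \int[mu]_(x in `]a, b[) h x = \int[mu]_(x in K) h x.
  move=> hK; rewrite (Rintegral_supp hK); apply: Rintegral_supp => x xD.
  by apply: hK => /KD.
have phic : phi c = 0 by apply: phi0; rewrite /K/= in_itv/= ltxx.
have phid : phi d = 0.
  apply/eqP; apply: contraT => pd.
  have : closure [set x | phi x != 0] d by exact: subset_closure.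
  move=> /supp.
  by rewrite /= in_itv/= ltxx andbF.
have cdphi := test_derive1_continuous tphi.
have idphi : mu.-integrable K (EFin \o derive1 phi).
  apply: (@integrable_subset _ _ _ mu `[c, d]%classic) => //; first exact: itv_oc_cc.
  exact: continuous_integrable_itv.
have igK : mu.-integrable K (EFin \o g).
  apply: (@integrable_subset _ _ _ mu `[c, d]%classic) => //; first exact: itv_oc_cc.
  exact: locally_integrable_itv lg _ _.
pose G := g \_ K; pose P := (derive1 phi) \_ K.
have iG : mu.-integrable setT (EFin \o G) by exact: (integrable_patch mu g mK).1 igK.
have iP : mu.-integrable setT (EFin \o P) by exact: (integrable_patch mu _ mK).1 idphi.
(* Both iterated integrals of F are computed: integrating first in the second
   variable gives - g phi, in the first one (f - f c) phi'. *)
pose F (z : R * R) := G z.1 * P z.2 * (z.1 <= z.2)%R%:R.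
have iF : (mu \x mu)%E.-integrable setT (EFin \o F).
  apply: (@integrable_mul_bounded _ _ _ _ _ _ _ 1) => //; first exact: integrable_tensor.
    rewrite (_ : (fun z => _) = (fun z : R * R => if z.1 <= z.2 then 1 else 0)); last first.
      by apply/funext => z; case: (z.1 <= z.2).
    apply: measurable_fun_ifT => //; apply: measurable_fun_ler => //.
  by move=> z _; case: (z.1 <= z.2); rewrite ?normr1 ?normr0.
have [_ F1] := Rfubini iF.
have [_ F2] := Rfubini_snd iF.
rewrite restr; last by move=> x /dphi0 ->; rewrite mulr0.
rewrite [in RHS]restr; last by move=> x /phi0 ->; rewrite mulr0.
have inner1 t : \int[mu]_x F (t, x) = - (G t * phi t).
  rewrite /F /=; have [tK|tK] := boolP (t \in K); last first.
    rewrite /G patchE (negbTE tK) mul0r oppr0.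
    by under eq_Rintegral do rewrite !mul0r; rewrite Rintegral_cst// mul0r.
  move: (tK); rewrite inE /K/= in_itv/= => /andP[ct td].
  have -> : (fun x => G t * P x * (t <= x)%R%:R) =
      (fun x => G t * (derive1 phi \_ `[t, d]) x).
    apply/funext => x; rewrite /P !patchE !mem_setE !in_itv/= -mulrA; congr (_ * _).
    have [tx|xt] := leP t x; last by rewrite mulr0.
    by rewrite mulr1 (lt_le_trans ct tx).
  have idp : mu.-integrable `[t, d] (EFin \o derive1 phi) by exact: continuous_integrable_itv.
  rewrite RintegralZl//; last exact: (integrable_patch mu _ (measurable_itv _)).1.
  rewrite -Rintegral_mkcond -mulrN; congr (_ * _).
  move: td; rewrite le_eqVlt => /predU1P[->|td].
    by rewrite set_itv1 Rintegral_set1 phid oppr0.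
  by rewrite (test_FTC2 tphi td) phid sub0r.
have inner2 x : \int[mu]_t F (t, x) = (f x - f c) * P x.
  rewrite /F /=; have [xK|xK] := boolP (x \in K); last first.
    rewrite /P patchE (negbTE xK) mulr0.
    by under eq_Rintegral do rewrite mulr0 mul0r; rewrite Rintegral_cst// mul0r.
  move: (xK); rewrite inE /K/= in_itv/= => /andP[cx xd].
  have -> : (fun t => G t * P x * (t <= x)%R%:R) =
      (fun t => (g \_ `]c, x]) t * P x).
    apply/funext => t; rewrite /G !patchE !mem_setE !in_itv/= mulrAC; congr (_ * _).
    have [tx|xt] := leP t x; last by rewrite andbF mulr0.
    by rewrite mulr1 (le_trans tx xd).
  have igx : mu.-integrable `]c, x] (EFin \o g).
    by apply: (@integrable_subset _ _ _ mu K) => //; apply: subset_itvl; rewrite bnd_simp.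
  rewrite RintegralZr//; last exact: (integrable_patch mu _ (measurable_itv _)).1.
  by rewrite -Rintegral_mkcond fg// ?ltW// (le_lt_trans xd).
have EE : \int[mu]_x - (G x * phi x) = \int[mu]_x ((f x - f c) * P x).
  transitivity (\int[mu]_t (\int[mu]_x F (t, x))).
    by apply: eq_Rintegral => t _; rewrite inner1.
  by rewrite F1 -F2; apply: eq_Rintegral => x _; rewrite inner2.
have igp : mu.-integrable K (EFin \o (fun x => g x * phi x)).
  by apply: (@integrable_subset _ _ _ mu `]a, b[%classic) => //; exact: integrable_test.
have -> : \int[mu]_(x in K) (f x * derive1 phi x) = \int[mu]_x ((f x - f c) * P x).
  have ifp : mu.-integrable K (EFin \o (fun x => f x * derive1 phi x)).
    have [M HM] : exists M, forall x, K x -> `|derive1 phi x| <= M.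
      have [M [_ HM]] := compact_bounded (continuous_compact
        (continuous_subspaceT (fun x => cdphi x)) (@segment_compact _ c d)).
      exists (M + 1) => x Kx; apply: (HM (M + 1)); first by rewrite ltrDl.
      by exists x => //; exact: itv_oc_cc.
    apply: (@integrable_mul_bounded _ _ _ _ _ _ _ M) => //.
      apply: (@integrable_subset _ _ _ mu `[c, d]%classic) => //; first exact: itv_oc_cc.
      exact: locally_integrable_itv lf _ _.
    by apply: (@measurable_funS _ _ _ _ setT) => //; exact: continuous_measurable_fun.
  have -> : \int[mu]_x ((f x - f c) * P x) =
      \int[mu]_(x in K) (f x * derive1 phi x - f c * derive1 phi x).
    rewrite [RHS]Rintegral_mkcond; apply: eq_Rintegral => x _.
    by rewrite /P !patchE; case: ifP; rewrite ?mulr0// mulrBl.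
  rewrite RintegralB//; last exact: integrable_scale.
  rewrite RintegralZl// (_ : \int[mu]_(x in K) derive1 phi x = 0) ?mulr0 ?subr0//.
  rewrite Rintegral_itv_obnd_cbnd//.
  by rewrite (test_FTC2 tphi cd) phic phid subrr.
rewrite -EE -[RHS]mulN1r -RintegralZl// [RHS]Rintegral_mkcond.
apply: eq_Rintegral => x _; rewrite /G !patchE; case: ifP; rewrite ?mulN1r//.
by rewrite mul0r oppr0.
Qed.

End PrimitiveWeak.

(** * Square integrable functions on the line and their translates *)
Section L2.
Context {R : realType}.
Notation mu := (@lebesgue_measure R).
Implicit Types (f g : R -> R).

Definition square_integrable f := measurable_fun setT f /\ (\int[mu]_x (f x ^+ 2)%:E < +oo)%E.

Definition norm2sq f : R := \int[mu]_x (f x ^+ 2).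
Definition inner f g : R := \int[mu]_x (f x * g x).

Lemma sqint_measurable f : square_integrable f -> measurable_fun setT f. Proof. by case. Qed.

Lemma sqint_sqr f : square_integrable f -> mu.-integrable setT (EFin \o (fun x => f x ^+ 2)).
Proof.
move=> [mf f2]; apply/integrableP; split.
  by apply/measurable_EFinP; exact: measurable_funX.
by under eq_integral => x _ do rewrite /= ger0_norm ?sqr_ge0//.
Qed.

Lemma norm2sqE f : square_integrable f -> ((norm2sq f)%:E = \int[mu]_x (f x ^+ 2)%:E)%E.
Proof.
move=> sf; rewrite /norm2sq /Rintegral fineK//.
by apply: (@integrable_fin_num _ _ _ mu); [|exact: sqint_sqr].
Qed.

Lemma norm2sq_ge0 f : 0 <= norm2sq f.
Proof. by apply: Rintegral_ge0 => x _; exact: sqr_ge0. Qed.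

Lemma sqint_mul f g : square_integrable f -> square_integrable g ->
  mu.-integrable setT (EFin \o (fun x => f x * g x)).
Proof.
move=> sf sg; apply: (@integrable_dominated _ _ _ mu setT _ (fun x => f x ^+ 2 + g x ^+ 2)) => //.
- by apply: measurable_funM; exact: sqint_measurable.
- move=> x _; rewrite normrM.
  have := sqr_ge0 (`|f x| - `|g x|); rewrite sqrrB !real_normK ?num_real//.
  have := mulr_ge0 (normr_ge0 (f x)) (normr_ge0 (g x)); lra.
- by apply: integrable_add => //; exact: sqint_sqr.
Qed.

Lemma sqintP f : mu.-integrable setT (EFin \o (fun x => f x ^+ 2)) ->
  measurable_fun setT f -> square_integrable f.
Proof.
move=> /integrableP[_ H] mf; split => //; apply: le_lt_trans H.
rewrite le_eqVlt; apply/orP; left; apply/eqP; apply: eq_integral => x _.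
by rewrite /= ger0_norm ?sqr_ge0.
Qed.

Lemma sqintD f g : square_integrable f -> square_integrable g -> square_integrable (fun x => f x + g x).
Proof.
move=> sf sg; apply: sqintP; last by apply: measurable_funD; exact: sqint_measurable.
apply: (@eq_integrable_fun _ _ _ mu setT (fun x => f x ^+ 2 + (2 * (f x * g x) + g x ^+ 2))) => //.
  by move=> x _; ring.
apply: integrable_add => //; first exact: sqint_sqr.
by apply: integrable_add => //; [apply: integrable_scale => //; exact: sqint_mul|exact: sqint_sqr].
Qed.

Lemma sqintZ f k : square_integrable f -> square_integrable (fun x => k * f x).
Proof.
move=> sf; apply: sqintP; last by apply: measurable_funM => //; exact: sqint_measurable.
apply: (@eq_integrable_fun _ _ _ mu setT (fun x => k ^+ 2 * f x ^+ 2)) => //.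
  by move=> x _; rewrite exprMn.
by apply: integrable_scale => //; exact: sqint_sqr.
Qed.

Lemma sqintB f g : square_integrable f -> square_integrable g -> square_integrable (fun x => f x - g x).
Proof.
move=> sf sg; have := sqintD sf (sqintZ (-1) sg).
by rewrite (_ : (fun x => _) = (fun x => f x - g x))//; apply/funext => x; rewrite mulN1r.
Qed.

Lemma innerC f g : inner f g = inner g f.
Proof. by apply: eq_Rintegral => x _; rewrite mulrC. Qed.

Lemma innerff f : inner f f = norm2sq f.
Proof. by apply: eq_Rintegral => x _; rewrite expr2. Qed.

Lemma innerBl f g h : square_integrable f -> square_integrable g -> square_integrable h ->
  inner (fun x => f x - g x) h = inner f h - inner g h.
Proof.
move=> sf sg sh; rewrite /inner -RintegralB//; try exact: sqint_mul.
by apply: eq_Rintegral => x _; rewrite mulrBl.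
Qed.

Lemma innerBr f g h : square_integrable f -> square_integrable g -> square_integrable h ->
  inner h (fun x => f x - g x) = inner h f - inner h g.
Proof. by move=> sf sg sh; rewrite innerC innerBl// !(innerC h). Qed.

Lemma innerZr f g k : square_integrable f -> square_integrable g -> inner f (fun x => k * g x) = k * inner f g.
Proof.
move=> sf sg; rewrite /inner -RintegralZl//; last exact: sqint_mul.
by apply: eq_Rintegral => x _; ring.
Qed.

Lemma norm2sqZ f k : square_integrable f -> norm2sq (fun x => k * f x) = k ^+ 2 * norm2sq f.
Proof.
move=> sf; rewrite /norm2sq -RintegralZl//; last exact: sqint_sqr.
by apply: eq_Rintegral => x _; rewrite exprMn.
Qed.

Lemma norm2sqB f g : square_integrable f -> square_integrable g ->
  norm2sq (fun x => f x - g x) = norm2sq f - 2 * inner f g + norm2sq g.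
Proof.
move=> sf sg; rewrite -!innerff innerBl//; last exact: sqintB.
by rewrite !innerBr// (innerC g f); ring.
Qed.

(** The quadratic polynomial t |-> |f - t g|^2 is nonnegative. *)
Lemma cauchy_schwarz f g : square_integrable f -> square_integrable g -> inner f g ^+ 2 <= norm2sq f * norm2sq g.
Proof.
move=> sf sg.
have H t : 0 <= norm2sq f - 2 * t * inner f g + t ^+ 2 * norm2sq g.
  have := norm2sq_ge0 (fun x => f x - t * g x).
  by rewrite norm2sqB// ?innerZr// ?norm2sqZ//; [rewrite mulrA|exact: sqintZ].
have := norm2sq_ge0 g; rewrite le_eqVlt => /predU1P[g0|g0]; last first.
  have := H (inner f g / norm2sq g).
  rewrite (_ : _ + _ = norm2sq f - inner f g ^+ 2 / norm2sq g); last by field; rewrite gt_eqF.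
  by rewrite subr_ge0 ler_pdivrMr.
rewrite -g0 mulr0; suff -> : inner f g = 0 by rewrite expr0n.
apply/eqP; apply: contraT => i0.
have := H ((norm2sq f + 1) / (2 * inner f g)); rewrite -g0.
rewrite (_ : _ + _ = -1); last by field.
by rewrite ler0N1.
Qed.

Lemma norm_inner_le f g : square_integrable f -> square_integrable g -> `|inner f g| <= Num.sqrt (norm2sq f) * Num.sqrt (norm2sq g).
Proof.
move=> sf sg; rewrite -sqrtrM ?norm2sq_ge0// -sqrtr_sqr ler_sqrt ?mulr_ge0 ?norm2sq_ge0//.
exact: cauchy_schwarz.
Qed.

Lemma ae_eq_norm2sq f g : measurable_fun setT f -> measurable_fun setT g ->
  {ae mu, forall x, f x = g x} -> norm2sq f = norm2sq g.
Proof.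
move=> mf mg fg; congr fine; apply: ae_eq_integral => //.
- by apply/measurable_EFinP; exact: measurable_funX.
- by apply/measurable_EFinP; exact: measurable_funX.
- by apply: ae_imp fg => x H _; rewrite H.
Qed.

(** Both measures agree on half-open intervals, which determine the measure. *)
Lemma lebesgue_measure_shift (z : R) (A : set R) : measurable A ->
  pushforward mu (fun x : measurableTypeR R => x + z : measurableTypeR R) A = mu A.
Proof.
move=> mA; apply/esym/lebesgue_measure_unique;
  [exact: measurable_funD|move=> mz _ [[a b]] _ <-|exact: mA].
rewrite /=.
rewrite /pushforward.
have -> : (fun x => x + z) @^-1` `]a, b] = `]a - z, b - z]%classic.
  by apply/seteqP; split => x; rewrite /= !in_itv/= ltrBlDr lerBrDr.
by rewrite !lebesgue_measure_itv/= !lte_fin ltrD2r -!EFinB; case: ifP => // _; congr EFin; lra.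
Qed.

Lemma ge0_integral_shift (z : R) (f : R -> \bar R) : measurable_fun setT f ->
  (forall x, 0 <= f x)%E -> (\int[mu]_x f (x + z)%R = \int[mu]_x f x)%E.
Proof.
move=> mf f0.
have mz : measurable_fun setT (fun x : measurableTypeR R => x + z : measurableTypeR R).
  exact: measurable_funD.
transitivity (\int[pushforward mu (fun x : measurableTypeR R => (x + z)%R : measurableTypeR R)]_x f x)%E.
  by rewrite ge0_integral_pushforward.
by apply: eq_measure_integral => A mA _; exact: lebesgue_measure_shift.
Qed.


(** The positive and the negative part of the integrand are translated separately. *)
Lemma integral_shift (z : R) (f : R -> \bar R) : measurable_fun setT f ->
  (\int[mu]_x f (x + z)%R = \int[mu]_x f x)%E.
Proof.
move=> mf; rewrite integralE [RHS]integralE.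
have -> : ((fun x => f (x + z)%R)^\+ = (f^\+ \o (fun x => (x + z)%R)))%E.
  exact: (funepos_comp f).
have -> : ((fun x => f (x + z)%R)^\- = (f^\- \o (fun x => (x + z)%R)))%E.
  exact: (funeneg_comp f).
congr (_ - _)%E.
- by rewrite -[RHS](ge0_integral_shift z)//; exact: measurable_funepos.
- by rewrite -[RHS](ge0_integral_shift z)//; exact: measurable_funeneg.
Qed.

Lemma measurable_shift (z : R) (f : R -> R) : measurable_fun setT f ->
  measurable_fun setT (fun x : R => f (x + z)).
Proof.
move=> mf; apply: (measurableT_comp mf); exact: measurable_funD.
Qed.

Lemma sqint_shift (z : R) f : square_integrable f -> square_integrable (fun x => f (x + z)).
Proof.
move=> [mf f2]; split; first exact: measurable_shift.
rewrite (ge0_integral_shift z (f := fun x => (f x ^+ 2)%:E))//.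
- by apply/measurable_EFinP; exact: measurable_funX.
- by move=> x; rewrite lee_fin sqr_ge0.
Qed.

Lemma norm2sq_shift (z : R) f : measurable_fun setT f -> norm2sq (fun x => f (x + z)) = norm2sq f.
Proof.
move=> mf; congr fine; rewrite (ge0_integral_shift z (f := fun x => (f x ^+ 2)%:E))//.
- by apply/measurable_EFinP; exact: measurable_funX.
- by move=> x; rewrite lee_fin sqr_ge0.
Qed.

Lemma sqrt_norm2sq_triangle f g : square_integrable f -> square_integrable g ->
  Num.sqrt (norm2sq (fun x => f x + g x)) <= Num.sqrt (norm2sq f) + Num.sqrt (norm2sq g).
Proof.
move=> sf sg.
have -> : norm2sq (fun x => f x + g x) = norm2sq f + 2 * inner f g + norm2sq g.
  have -> : (fun x => f x + g x) = (fun x => f x - (-1) * g x).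
    by apply/funext => x; ring.
  rewrite norm2sqB//; last exact: sqintZ.
  by rewrite innerZr// norm2sqZ//; ring.
have a0 : 0 <= Num.sqrt (norm2sq f) + Num.sqrt (norm2sq g) by rewrite addr_ge0// sqrtr_ge0.
rewrite -[leRHS](ger0_norm a0) -sqrtr_sqr ler_sqrt ?sqr_ge0//.
rewrite sqrrD !sqr_sqrtr ?norm2sq_ge0//.
have := le_trans (ler_norm _) (norm_inner_le sf sg); lra.
Qed.

(** Telescoping N unit steps and the triangle inequality; each step has the same
    norm by translation invariance. *)
Lemma norm2sq_iter_shift f (z : R) (n : nat) : square_integrable f ->
  norm2sq (fun x => f (x + n%:R * z) - f x) <=
  n%:R ^+ 2 * norm2sq (fun x => f (x + z) - f x).
Proof.
move=> sf; have sd := sqintB (sqint_shift z sf) sf.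
suff H : Num.sqrt (norm2sq (fun x => f (x + n%:R * z) - f x)) <=
    n%:R * Num.sqrt (norm2sq (fun x => f (x + z) - f x)).
  move: H (norm2sq_ge0 (fun x => f (x + n%:R * z) - f x))
    (norm2sq_ge0 (fun x => f (x + z) - f x)).
  move: (norm2sq _) (norm2sq (fun x => f (x + z) - f x)) => p q H p0 q0.
  rewrite -(sqr_sqrtr p0) -(sqr_sqrtr q0) -exprMn.
  by rewrite ler_sqr ?nnegrE ?mulr_ge0// sqrtr_ge0.
elim: n => [|n IH].
  have -> : (fun x => f (x + 0%:R * z) - f x) = (fun x => 0 * f x).
    by apply/funext => x; rewrite !mul0r addr0 subrr.
  by rewrite norm2sqZ// expr0n/= !mul0r sqrtr0.
have -> : (fun x => f (x + n.+1%:R * z) - f x) =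
    (fun x => (f (x + z + n%:R * z) - f (x + z)) + (f (x + z) - f x)).
  apply/funext => x; rewrite addrA subrK; congr (f _ - _).
  by rewrite -natr1; ring.
apply: (le_trans (sqrt_norm2sq_triangle _ _)) => //.
  exact: (sqint_shift z (sqintB (sqint_shift (n%:R * z) sf) sf)).
rewrite -natr1 mulrDl mul1r lerD2r.
rewrite (norm2sq_shift z (f := fun x => f (x + n%:R * z) - f x))//.
by apply: measurable_funB; [apply: measurable_shift|]; exact: sqint_measurable.
Qed.

End L2.

(** * The convolution form and its coercivity *)
Section KernelForm.
Context {R : realType}.
Notation mu := (@lebesgue_measure R).
Variable k : R -> R.
Hypothesis mk : measurable_fun setT k.
Hypothesis k0 : forall z, 0 <= k z.
Hypothesis k1 : (\int[mu]_z (k z)%:E = 1)%E.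
Implicit Types (f g w e : R -> R).

(** The form (f, w) |-> <k * f, w> for an even kernel k, written as an average over
    translations; in this shape bounds for single translates integrate directly. *)
Definition conv_form f w : R := \int[mu]_z (k z * inner (fun x => f (x + z)) w).

Lemma kernel_integrable : mu.-integrable setT (EFin \o k).
Proof.
apply/integrableP; split; first exact/measurable_EFinP.
by under eq_integral => z _ do rewrite /= ger0_norm//; rewrite k1 ltry.
Qed.

Lemma kernel_mass : \int[mu]_z k z = 1.
Proof. by rewrite /Rintegral k1. Qed.

(** The product of f (x + z) and w x is at most f (x + z)^2 + w x^2, whose integral
    in x does not depend on z. *)
Lemma conv_form_integrable f w : square_integrable f -> square_integrable w ->
  (mu \x mu)%E.-integrable setT
    (EFin \o (fun p : R * R => k p.2 * (f (p.1 + p.2) * w p.1))).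
Proof.
move=> sf sw.
have mF : measurable_fun setT (fun p : R * R => k p.2 * (f (p.1 + p.2) * w p.1)).
  apply: measurable_funM.
    exact: (measurableT_comp mk (@measurable_snd _ _ _ _)).
  apply: measurable_funM.
    have mp : measurable_fun setT (fun p : R * R => p.1 + p.2).
      by apply: measurable_funD; [exact: measurable_fst|exact: measurable_snd].
    exact: (measurableT_comp (sqint_measurable sf) mp).
  exact: (measurableT_comp (sqint_measurable sw) (@measurable_fst _ _ _ _)).
apply/integrable21ltyP; first exact/measurable_EFinP.
pose M := norm2sq f + norm2sq w.
apply: (@le_lt_trans _ _ (\int[mu]_z ((k z)%:E * M%:E))%E); last first.
  rewrite ge0_integralZr//; last by rewrite lee_fin addr_ge0// norm2sq_ge0.
  - by rewrite k1 mul1e ltry.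
  - exact/measurable_EFinP.
  - by move=> z _; rewrite lee_fin.
apply: ge0_le_integral => //.
- by move=> z _; exact: integral_ge0.
- have mFn : measurable_fun setT (fun p : R * R => `|(k p.2 * (f (p.1 + p.2) * w p.1))%:E|%E).
    by apply: measurableT_comp => //; exact/measurable_EFinP.
  have HG := @measurable_fun_fubini_tonelli_G _ _ _ _ R mu _ mFn (fun=> abse_ge0 _).
  refine HG.
- by apply/measurable_EFinP; apply: measurable_funM.
move=> z _ /=.
under eq_integral => x _ do rewrite normrM EFinM (ger0_norm (k0 z)).
have sfz := sqint_shift z sf.
rewrite ge0_integralZl//; last 2 first.
- apply/measurable_EFinP; apply: measurableT_comp => //.
  by apply: measurable_funM; exact: sqint_measurable.
- by rewrite lee_fin.
apply: lee_wpmul2l; first by rewrite lee_fin.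
rewrite /M EFinD -(norm2sq_shift z (sqint_measurable sf)) norm2sqE// norm2sqE//.
rewrite -ge0_integralD//; last 4 first.
- by move=> x _; rewrite lee_fin sqr_ge0.
- by apply/measurable_EFinP; apply: measurable_funX; exact: sqint_measurable.
- by move=> x _; rewrite lee_fin sqr_ge0.
- by apply/measurable_EFinP; apply: measurable_funX; exact: sqint_measurable.
apply: ge0_le_integral => //.
- apply/measurable_EFinP; apply: measurableT_comp => //.
  by apply: measurable_funM; exact: sqint_measurable.
- apply: emeasurable_funD; apply/measurable_EFinP; apply: measurable_funX; exact: sqint_measurable.
move=> x _; rewrite -EFinD lee_fin normrM.
have := sqr_ge0 (`|f (x + z)| - `|w x|); rewrite sqrrB !real_normK ?num_real//.
have := mulr_ge0 (normr_ge0 (f (x + z))) (normr_ge0 (w x)); lra.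
Qed.

(** Integration in x at fixed z; [conv_form_fst] is the opposite order, which is how
    the nonlocal operator produces the form. *)
Lemma conv_form_inner f w z : square_integrable f -> square_integrable w ->
  \int[mu]_x (k z * (f (x + z) * w x)) = k z * inner (fun x => f (x + z)) w.
Proof.
by move=> sf sw; rewrite RintegralZl//; apply: sqint_mul => //; exact: sqint_shift.
Qed.

Lemma conv_form_integrable_shift f w : square_integrable f -> square_integrable w ->
  mu.-integrable setT (EFin \o (fun z => k z * inner (fun x => f (x + z)) w)).
Proof.
move=> sf sw; have [+ _] := Rfubini_snd (conv_form_integrable sf sw).
by apply: eq_integrable_fun => // z _; exact: conv_form_inner.
Qed.

Lemma conv_form_fst f w : square_integrable f -> square_integrable w ->
  mu.-integrable setT
    (EFin \o (fun x => \int[mu]_z (k z * (f (x + z) * w x)))) /\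
  \int[mu]_x (\int[mu]_z (k z * (f (x + z) * w x))) = conv_form f w.
Proof.
move=> sf sw; have iF := conv_form_integrable sf sw.
have [i1 e1] := Rfubini iF; have [_ e2] := Rfubini_snd iF.
split; first exact: i1.
rewrite e1 -e2; apply: eq_Rintegral => z _; exact: conv_form_inner.
Qed.

Lemma conv_formBl f g w : square_integrable f -> square_integrable g -> square_integrable w ->
  conv_form (fun x => f x - g x) w = conv_form f w - conv_form g w.
Proof.
move=> sf sg sw; rewrite /conv_form -RintegralB//; try exact: conv_form_integrable_shift.
apply: eq_Rintegral => z _; rewrite -mulrBr -innerBl//; exact: sqint_shift.
Qed.

Lemma conv_formBr f g w : square_integrable f -> square_integrable g -> square_integrable w ->
  conv_form w (fun x => f x - g x) = conv_form w f - conv_form w g.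
Proof.
move=> sf sg sw; rewrite /conv_form -RintegralB//; try exact: conv_form_integrable_shift.
apply: eq_Rintegral => z _; rewrite -mulrBr -innerBr//; exact: sqint_shift.
Qed.

Lemma conv_form_bound f w : square_integrable f -> square_integrable w ->
  `|conv_form f w| <= Num.sqrt (norm2sq f) * Num.sqrt (norm2sq w).
Proof.
move=> sf sw; set M := _ * _; have ik := conv_form_integrable_shift sf sw.
apply: (le_trans (le_normr_Rintegral _ ik)) => //.
apply: (@le_trans _ _ (\int[mu]_z (k z * M))).
  apply: le_Rintegral => //.
  - exact: integrable_abs ik.
  - apply: (@integrable_mul_bounded _ _ _ mu setT k (fun=> M) `|M|) => //.
    exact: kernel_integrable.
  - move=> z _; rewrite normrM (ger0_norm (k0 z)) ler_wpM2l//.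
    rewrite /M -(norm2sq_shift z (sqint_measurable sf)); apply: norm_inner_le => //.
    exact: sqint_shift.
by rewrite RintegralZr ?kernel_mass ?mul1r//; exact: kernel_integrable.
Qed.

(** N translations by z separate e from itself, so one translation must already
    decrease the correlation with e by a definite factor. *)
Lemma inner_shift_le e (z : R) (N : nat) : square_integrable e -> (forall x, x \notin `[0, 1] -> e x = 0) ->
  (0 < N)%N -> 1 < N%:R * z ->
  inner (fun x => e (x + z)) e <= (1 - (N%:R ^+ 2)^-1) * norm2sq e.
Proof.
move=> se e0 N0 Nz; have me := sqint_measurable se.
have H := norm2sq_iter_shift z N se.
(* The supports of e and of its translate by N z meet in a null set at most. *)
have far : norm2sq (fun x => e (x + N%:R * z) - e x) = 2 * norm2sq e.
  rewrite norm2sqB//; last exact: sqint_shift.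
  rewrite norm2sq_shift// (_ : inner _ _ = 0); first by ring.
  rewrite /inner (_ : (fun x => _) = fun=> 0) ?Rintegral_cst ?mul0r//.
  apply/funext => x; have [x01|x01] := boolP (x \in `[0, 1]); last by rewrite (e0 _ x01) mulr0.
  rewrite e0 ?mul0r// in_itv/= negb_and -!ltNge.
  by move: x01; rewrite in_itv/= => /andP[x0 x1]; apply/orP; right; lra.
move: H; rewrite far norm2sqB//; last exact: sqint_shift.
rewrite norm2sq_shift// => H.
have N2 : 0 < (N%:R ^+ 2 : R) by rewrite exprn_gt0// ltr0n.
have {H} : (N%:R ^+ 2)^-1 * (2 * norm2sq e) <= norm2sq e - 2 * inner (fun x => e (x + z)) e + norm2sq e.
  by rewrite ler_pdivrMl.
lra.
Qed.

(** Averaging [inner_shift_le] over the z in [d, 2 d], which carry k-mass at least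
    g0 * d; elsewhere Cauchy-Schwarz suffices. *)
Lemma conv_form_coercive e (d g0 : R) (N : nat) : square_integrable e ->
  (forall x, x \notin `[0, 1] -> e x = 0) ->
  0 < d -> 0 <= g0 -> (forall z, 0 <= z -> z <= 2 * d -> g0 <= k z) ->
  (0 < N)%N -> 1 < N%:R * d ->
  conv_form e e <= (1 - g0 * d / N%:R ^+ 2) * norm2sq e.
Proof.
move=> se e0 d0 g00 kg N0 Nd.
have n0 := norm2sq_ge0 e.
have N2 : 0 < (N%:R ^+ 2 : R) by rewrite exprn_gt0// ltr0n.
pose c := (N%:R ^+ 2)^-1 * norm2sq e.
have c0 : 0 <= c by rewrite mulr_ge0// invr_ge0 ltW.
have ik := kernel_integrable.
pose J := `[d, 2 * d]%classic : set R.
have iJ : mu.-integrable setT (EFin \o (fun z => (g0 * c) * \1_J z)).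
  apply: integrable_scale => //.
  exact: integrable_indic_itv.
(* The gain of inner_shift_le is only used for z in J, where both N z > 1 and
   the lower bound on k are available. *)
have H : conv_form e e <= \int[mu]_z (k z * norm2sq e - g0 * c * \1_J z).
  apply: le_Rintegral => //; first exact: conv_form_integrable_shift.
    by apply: integrable_sub => //; apply: (@integrable_mul_bounded _ _ _ mu setT k (fun=> norm2sq e) `|norm2sq e|).
  move=> z _; rewrite indicE.
  have [zJ|zJ] := boolP (z \in J); last first.
    rewrite mulr0 subr0 ler_wpM2l//.
    have := le_trans (ler_norm _) (norm_inner_le (sqint_shift z se) se).
    by rewrite (norm2sq_shift z (sqint_measurable se)) -expr2 sqr_sqrtr.
  move: zJ; rewrite inE /J/= in_itv/= => /andP[dz z2d].
  have Nz : 1 < N%:R * z by rewrite (lt_le_trans Nd)// ler_wpM2l.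
  have := inner_shift_le se e0 N0 Nz; rewrite mulrBl mul1r -/c => I.
  rewrite mulr1; apply: (@le_trans _ _ (k z * (norm2sq e - c))).
    by rewrite ler_wpM2l.
  rewrite mulrBr lerB// ler_wpM2r// kg//; lra.
apply: (le_trans H); rewrite RintegralB//; last first.
  by apply: (@integrable_mul_bounded _ _ _ mu setT k (fun=> norm2sq e) `|norm2sq e|).
rewrite RintegralZr// kernel_mass mul1r RintegralZl//; last exact: integrable_indic_itv.
have -> : \int[mu]_z \1_J z = d.
  have mJ : measurable J by exact: measurable_itv.
  rewrite /Rintegral integral_indic// setIT.
  rewrite [X in fine X](_ : _ = (2 * d - d)%:E); first by rewrite /=; ring.
  rewrite [LHS](lebesgue_measure_itv `[d, 2 * d]) /= lte_fin ifT//; lra.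
by rewrite le_eqVlt; apply/orP; left; apply/eqP; rewrite /c; ring.
Qed.


(** Cea's lemma: e is the error, e - w the difference between the solution and a
    competitor, and w the part that orthogonality removes. *)
Lemma quasi_optimal e w (c : R) : square_integrable e -> square_integrable w -> 0 < c ->
  inner e w = conv_form e w -> c * norm2sq e <= inner e e - conv_form e e ->
  norm2sq e <= 4 / c ^+ 2 * norm2sq (fun x => e x - w x).
Proof.
move=> se sw c0 orth co; have sd := sqintB se sw.
set p := norm2sq e in co *; set q := norm2sq _.
have p0 : 0 <= p := norm2sq_ge0 e.
have q0 : 0 <= q := norm2sq_ge0 _.
have E : inner e e - conv_form e e = inner e (fun x => e x - w x) - conv_form e (fun x => e x - w x).
  by rewrite (innerBr se sw se) (conv_formBr se sw se) orth opprB addrA subrK.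
have bd : c * p <= 2 * (Num.sqrt p * Num.sqrt q).
  apply: (le_trans co); rewrite E.
  apply: (le_trans (ler_norm _)); apply: (le_trans (ler_normB _ _)).
  by rewrite mulr2n mulrDl mul1r; apply: lerD; [exact: norm_inner_le|exact: conv_form_bound].
move: bd; rewrite -{1 3}(sqr_sqrtr p0) -(sqr_sqrtr q0) sqrtr_sqr (ger0_norm (sqrtr_ge0 _)).
move: (Num.sqrt p) (Num.sqrt q) (sqrtr_ge0 p) (sqrtr_ge0 q) => a b a0 b0.
clear - c0 a0 b0; move: a0; rewrite le_eqVlt => /predU1P[<- _|a0 bd].
  by rewrite expr0n/= mulr_ge0 ?sqr_ge0// divr_ge0 ?sqr_ge0.
have H2 : c * a <= 2 * b.
  by rewrite -(ler_pM2r a0) -mulrA -expr2 (le_trans bd)// (mulrC a) mulrA.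
rewrite mulrAC ler_pdivlMr ?exprn_gt0// (_ : 4 * b ^+ 2 = (2 * b) ^+ 2); last by ring.
by rewrite mulrC -exprMn lerXn2r// nnegrE mulr_ge0// ltW.
Qed.

End KernelForm.

(** * The finite element space *)
Section Vpc.
Context {R : realType}.
Notation mu := (@lebesgue_measure R).
Implicit Types (f g w e u : R -> R) (delta : R) (s : seq R).

Lemma measurable_patch D f : measurable D -> measurable_fun D f ->
  measurable_fun setT (f \_ D).
Proof. by move=> mD mf; exact: (measurable_restrictT f mD).1. Qed.

Lemma Vpc_out delta s w x : Vpc delta s w -> x \notin `[0, 1] -> w x = 0.
Proof. by move=> [_ _ +] x01; exact. Qed.

Lemma Vpc_restrict delta s w : Vpc delta s w -> w = w \_ `[0, 1].
Proof.
move=> Vw; apply/funext => x; rewrite patchE mem_setE.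
by case: ifPn => // x01; exact: Vpc_out Vw x01.
Qed.

Lemma Vpc_meas delta s w : Vpc delta s w -> measurable_fun setT w.
Proof.
move=> Vw; rewrite (Vpc_restrict Vw); apply: measurable_patch => //.
by apply: subspace_continuous_measurable_fun => //; case: Vw.
Qed.

Lemma Vpc_bounded delta s w : Vpc delta s w -> exists M, forall x, `|w x| <= M.
Proof.
move=> Vw; have [cw _ w0] := Vw.
have [M [_ HM]] := compact_bounded (continuous_compact cw (@segment_compact _ 0 1)).
exists (`|M| + 1) => x; have [x01|x01] := boolP (x \in `[0, 1]); last first.
  by rewrite w0// normr0 addr_ge0.
apply: (HM (`|M| + 1)); last by exists x.
by rewrite (le_lt_trans (ler_norm M))// ltrDl.
Qed.

Lemma Vpc_sqint delta s w : Vpc delta s w -> square_integrable w.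
Proof.
move=> Vw; have [M HM] := Vpc_bounded Vw; have mw := Vpc_meas Vw.
have [_ _ w0] := Vw.
apply: sqintP => //.
apply: (@integrable_dominated _ _ _ mu setT _ (fun x => M ^+ 2 * \1_(`[0, 1]%classic) x)) => //.
- exact: measurable_funX.
- move=> x _; rewrite indicE mem_setE; have [x01|x01] := boolP (x \in `[0, 1]).
    by rewrite mulr1 normrX lerXn2r ?nnegrE// (le_trans _ (HM x)).
  by rewrite w0// expr0n/= normr0 mulr0.
- by apply: integrable_scale => //; exact: integrable_indic_itv.
Qed.

Lemma VpcB delta s v w : Vpc delta s v -> Vpc delta s w ->
  Vpc delta s (fun x => v x - w x).
Proof.
move=> [cv lv v0] [cw lw w0]; split.
- by move=> x; apply: cvgB; [exact: cv|exact: cw].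
- move=> K Ks K01; have [a [c H]] := lv K Ks K01; have [a' [c' H']] := lw K Ks K01.
  by exists (a - a'), (c - c') => x xK; rewrite H// H'//; ring.
- by move=> x x01; rewrite v0// w0// subrr.
Qed.

(** Functions of the discrete space need not vanish at 0 and 1, but these two points
    form a null set. *)
Lemma Rintegral_Omega h : mu.-integrable setT (EFin \o h) ->
  (forall x, x \notin `[0, 1] -> h x = 0) ->
  \int[mu]_(x in `]0, 1[) h x = \int[mu]_x h x.
Proof.
move=> ih h0; rewrite -(@Rintegral_supp _ `[0, 1]%classic); last first.
  by move=> x /negP; exact: h0.
rewrite -Rintegral_itv_obnd_cbnd; last exact: (@integrable_subset _ _ _ mu setT).
by rewrite -Rintegral_itv_bndo_bndc//; exact: (@integrable_subset _ _ _ mu setT).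
Qed.

End Vpc.

(** * The nonlocal operator as a convolution *)
Section NonlocalOp.
Context {R : realType}.
Notation mu := (@lebesgue_measure R).
Implicit Types (f g w e u : R -> R) (s : seq R).
Variables (delta : R) (gamma : R -> R -> R) (tgamma : R -> R).
Hypothesis d0 : 0 < delta.
Hypothesis d1 : delta < 1 / 2.
Hypothesis K1 : kernel_K1 delta gamma.
Hypothesis K2 : kernel_K2 gamma tgamma.
Hypothesis tg0 : forall r, delta < r -> tgamma r = 0.

(** The kernel as a function of the displacement y - x. *)
Definition radial (z : R) := tgamma `|z|.

Lemma measurable_radial : measurable_fun setT radial. Proof. by case: K2. Qed.

Lemma gammaE x y : gamma x y = radial (y - x).
Proof. by case: K2 => + _ _ => /(_ x y)[]. Qed.

Lemma radial_ge0 z : 0 <= radial z.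
Proof. by case: K2 => + _ _ => /(_ 0 z)[]; rewrite gammaE subr0. Qed.

Lemma radial_mass : (\int[mu]_z (radial z)%:E = 1)%E. Proof. by case: K2. Qed.

Lemma interaction_domainP x : (Omega `|` OmegaI delta) x <-> - delta < x /\ x < 1 + delta.
Proof.
rewrite /Omega /OmegaI /=; split.
  by move: d0; rewrite !in_itv/= => ? -[/andP[? ?]|[/andP[? ?]|/andP[? ?]]]; split; lra.
move=> [x0 x1]; have [xl|xl] := leP x 0; first by right; left; rewrite /= in_itv/= x0.
have [xr|xr] := leP 1 x; first by right; right; rewrite /= in_itv/= xr.
by left; rewrite in_itv/= xl.
Qed.

(** Read off at x = 1 / 2, since delta / 2 < 1 / 2 keeps y in the domain. *)
Lemma radial_lower_bound : exists2 g0, 0 < g0 & forall z, `|z| <= delta / 2 -> g0 <= radial z.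
Proof.
have [g0 g00 H] := K1; exists g0 => // z zd.
move: d0 d1 => d0' d1'.
have [|+ _] := H (1 / 2); first by apply/interaction_domainP; split; lra.
move=> /(_ (1 / 2 + z)); rewrite gammaE addrAC subrr add0r; apply.
split; last by rewrite addrAC subrr add0r.
by apply/interaction_domainP; move: zd; rewrite ler_norml => /andP[? ?]; split; lra.
Qed.

(** For x in (0, 1) the kernel only sees the points of Omega and OmegaI, so the values
    of g elsewhere, and on null sets, do not matter; the mass of the kernel is 1. *)
Lemma nonlocal_opE g g' x : Omega x ->
  measurable_fun (Omega `|` OmegaI delta) g -> measurable_fun setT g' ->
  {ae mu, forall y, (Omega `|` OmegaI delta) y -> g y = g' y} -> g x = g' x ->
  mu.-integrable setT (EFin \o (fun z => g' (x + z) * radial z)) ->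
  nonlocal_op gamma g x = \int[mu]_z (g' (x + z) * radial z) - g' x.
Proof.
move=> Ox mg mg' gg' gx ig'; move: d0 d1 => d0' d1'.
have mE : measurable (Omega `|` OmegaI delta : set R).
  rewrite /Omega /OmegaI; apply: measurableU; first exact: measurable_itv.
  by apply: measurableU; exact: measurable_itv.
have mkx : measurable_fun setT (fun y : R => radial (y - x)).
  by apply: (measurable_shift (- x)); exact: measurable_radial.
pose v := g \_ (Omega `|` OmegaI delta).
have mv : measurable_fun setT v by exact: measurable_patch.
have -> : nonlocal_op gamma g x = \int[mu]_y ((v y - g x) * radial (y - x)).
  apply: eq_Rintegral => y _; rewrite gammaE /v patchE; case: ifPn => // yE.
  rewrite (_ : radial (y - x) = 0) ?mulr0//; apply: tg0.
  rewrite ltNge; apply/negP => yx; move/negP: yE; apply; rewrite inE.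
  apply/interaction_domainP; move: yx; rewrite ler_norml => /andP[].
  by move: Ox; rewrite /Omega /= in_itv/= => /andP[? ?] ? ?; split; lra.
have -> : \int[mu]_y ((v y - g x) * radial (y - x)) = \int[mu]_y ((g' y - g x) * radial (y - x)).
  congr fine; apply: ae_eq_integral => //.
  - by apply/measurable_EFinP; apply: measurable_funM => //; exact: measurable_funB.
  - by apply/measurable_EFinP; apply: measurable_funM => //; exact: measurable_funB.
  - apply: ae_imp gg' => y H _; rewrite /v patchE; case: ifPn => [/set_mem/H -> //|yE].
    rewrite (_ : radial (y - x) = 0) ?mulr0//; apply: tg0.
    rewrite ltNge; apply/negP => yx; move/negP: yE; apply; rewrite inE.
    apply/interaction_domainP; move: yx; rewrite ler_norml => /andP[].
    by move: Ox; rewrite /Omega /= in_itv/= => /andP[? ?] ? ?; split; lra.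
have -> : \int[mu]_y ((g' y - g x) * radial (y - x)) = \int[mu]_z ((g' (x + z) - g x) * radial z).
  rewrite /Rintegral -(integral_shift x (f := fun y => ((g' y - g x) * radial (y - x))%:E)).
    by congr fine; apply: eq_integral => z _; rewrite addrK (addrC z).
  by apply/measurable_EFinP; apply: measurable_funM => //; exact: measurable_funB.
have ik := kernel_integrable measurable_radial radial_ge0 radial_mass.
under eq_Rintegral do rewrite mulrBl.
rewrite RintegralB//; last exact: integrable_scale.
by rewrite RintegralZl// (kernel_mass radial_mass) mulr1 gx.
Qed.

(** Fubini applied to the convolution form with the indicator of [0, 1]. *)
Lemma ae_conv_integrable f : square_integrable f ->
  {ae mu, forall x, Omega x -> mu.-integrable setT (EFin \o (fun z => f (x + z) * radial z))}.
Proof.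
move=> sf.
have s1 : square_integrable (\1_(`[0, 1]%classic) : R -> R).
  apply: sqintP => //.
  apply: (@eq_integrable_fun _ _ _ mu setT (\1_(`[0, 1]%classic))) => //; last exact: integrable_indic_itv.
  by move=> x _; rewrite indicE; case: (_ \in _); rewrite ?expr1n ?expr0n.
have := ae_integrable_fst (conv_form_integrable measurable_radial radial_ge0 radial_mass sf s1).
apply: ae_imp => x + Ox; apply: eq_integrable_fun => // z _ /=.
by rewrite indicE mem_set ?mulr1 1?mulrC//; exact: subset_itvW Ox.
Qed.

End NonlocalOp.

(** * The Lebesgue space on a set, by extension by zero *)
Section L2bridge.
Context {R : realType}.
Notation mu := (@lebesgue_measure R).
Implicit Types (f g : R -> R) (D : set R).

Lemma L2_sqint D f : L2 D f -> square_integrable (f \_ D).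
Proof.
move=> Lf; apply: sqintP; first exact: (Lfun2_integrable_sqr Lf).
by move: Lf; rewrite /L2 inE => /andP[+ _]; rewrite inE.
Qed.

Lemma L2normE D f : (L2norm D f = (\int[mu]_x ((f \_ D) x ^+ 2)%:E) `^ 2^-1)%E.
Proof.
rewrite /L2norm unlock; congr (_ `^ _)%E; apply: eq_integral => x _.
by rewrite poweR_EFin /= powR_mulrn// real_normK// num_real.
Qed.

Lemma sqint_L2 D f : square_integrable (f \_ D) -> L2 D f.
Proof.
move=> [mf f2]; rewrite /L2 inE; apply/andP; split; first by rewrite inE.
rewrite inE; change (L2norm D f < +oo)%E; rewrite L2normE.
exact: poweR_lty.
Qed.

Lemma L2_meas D f : measurable D -> L2 D f -> measurable_fun D f.
Proof. by move=> mD /L2_sqint [mf _]; exact: (measurable_restrictT f mD).2. Qed.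

End L2bridge.

Lemma sub_eq_of_oppr_sub (R : realType) (a b c d : R) :
  - (c - d) = a - b -> a - d = b - c.
Proof. by move=> H; lra. Qed.

(** * Galerkin orthogonality *)
Section Galerkin.
Context {R : realType}.
Notation mu := (@lebesgue_measure R).
Implicit Types (f g w e u : R -> R) (s : seq R).
Variables (delta : R) (gamma : R -> R -> R) (tgamma : R -> R).
Hypothesis d0 : 0 < delta.
Hypothesis d1 : delta < 1 / 2.
Hypothesis K1 : kernel_K1 delta gamma.
Hypothesis K2 : kernel_K2 gamma tgamma.
Hypothesis tg0 : forall r, delta < r -> tgamma r = 0.

Local Notation k := (radial tgamma).
Let mk := measurable_radial K2.
Let k_ge0 := radial_ge0 K2.
Let k_mass := radial_mass K2.

Lemma conv_form_at f w x : mu.-integrable setT (EFin \o (fun z => f (x + z) * k z)) ->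
  \int[mu]_z (k z * (f (x + z) * w x)) = (\int[mu]_z (f (x + z) * k z)) * w x.
Proof.
move=> ifk; rewrite -RintegralZr//; apply: eq_Rintegral => z _.
by ring.
Qed.

(** The left-hand side is the integral of L f against w, once the inner integrals
    make sense. *)
Lemma conv_form_Omega f w : square_integrable f -> square_integrable w -> (forall x, x \notin `[0, 1] -> w x = 0) ->
  \int[mu]_(x in `]0, 1[) (\int[mu]_z (k z * (f (x + z) * w x)) - f x * w x) =
  conv_form k f w - inner f w.
Proof.
move=> sf sw w0; have [i1 <-] := conv_form_fst mk k_ge0 k_mass sf sw.
have i2 := sqint_mul sf sw.
rewrite /inner -RintegralB// Rintegral_Omega//; first exact: integrable_sub.
move=> x x01; rewrite (w0 _ x01) mulr0 subr0.
by under eq_Rintegral do rewrite !mulr0; rewrite Rintegral_cst// mul0r.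
Qed.

(** Members of the discrete space are bounded, so here no exceptional null set of x
    has to be discarded. *)
Lemma Vpc_conv s w x : Vpc delta s w ->
  mu.-integrable setT (EFin \o (fun z => w (x + z) * k z)).
Proof.
move=> Vw; have [M HM] := Vpc_bounded Vw.
apply: (@eq_integrable_fun _ _ _ mu setT (fun z => k z * w (z + x))) => //.
  by move=> z _; rewrite mulrC (addrC z).
apply: (@integrable_mul_bounded _ _ _ mu setT k (fun z => w (z + x)) M) => //.
- exact: kernel_integrable mk k_ge0 k_mass.
- exact: (measurable_shift x (Vpc_meas Vw)).
Qed.

Lemma discrete_form s uh w : Vpc delta s uh -> Vpc delta s w ->
  \int[mu]_(x in `]0, 1[) (nonlocal_op gamma uh x * w x) = conv_form k uh w - inner uh w.
Proof.
move=> Vu Vw; rewrite -conv_form_Omega; [|exact: Vpc_sqint Vu|exact: Vpc_sqint Vw|by move=> x; exact: Vpc_out Vw].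
apply: eq_Rintegral => x /set_mem x01.
rewrite (nonlocal_opE d0 d1 K2 tg0 (g' := uh))//.
- by rewrite conv_form_at ?mulrBl//; exact: Vpc_conv Vu.
- by apply: (@measurable_funS _ _ _ _ setT) => //; exact: Vpc_meas Vu.
- exact: Vpc_meas Vu.
- exact: aeW.
- exact: Vpc_conv Vu.
Qed.

Variables (b u : R -> R).
Hypothesis Lb : L2 Omega b.
Hypothesis sol : nonlocal_solution delta gamma b u.

(** The solution, cut off to vanish outside Omega; this changes it on OmegaI only
    on a null set. *)
Definition ext0 f := f \_ (Omega : set R).

Lemma measurable_interaction_domain : measurable (Omega `|` OmegaI delta : set R).
Proof.
rewrite /Omega /OmegaI; apply: measurableU; first exact: measurable_itv.
by apply: measurableU; exact: measurable_itv.
Qed.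

Lemma ext0_sqint : square_integrable (ext0 u).
Proof.
have [/L2_sqint su _ _] := sol; have [mu_ u2] := su.
have ms : measurable_fun setT (ext0 u).
  apply: measurable_patch; first exact: measurable_itv.
  have := (measurable_restrictT u measurable_interaction_domain).2 mu_.
  by apply: measurable_funS; [exact: measurable_interaction_domain|exact: subsetUl].
split => //; apply: le_lt_trans u2; apply: ge0_le_integral => //.
- by move=> x _; rewrite lee_fin sqr_ge0.
- by apply/measurable_EFinP; exact: measurable_funX.
- by apply/measurable_EFinP; exact: measurable_funX.
move=> x _; rewrite lee_fin /ext0 !patchE; case: ifPn => xO.
  by rewrite ifT// inE; left; rewrite -inE.
by rewrite expr0n/= sqr_ge0.
Qed.

(** The equation holds almost everywhere, and almost everywhere the operator is the
    convolution, so that integration against w gives the form. *)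
Lemma exact_form s w : Vpc delta s w ->
  \int[mu]_(x in `]0, 1[) (b x * w x) = inner (ext0 u) w - conv_form k (ext0 u) w.
Proof.
move=> Vw; have [Lu uI ub] := sol; have su := ext0_sqint.
have sw := Vpc_sqint Vw.
have [i1 _] := conv_form_fst mk k_ge0 k_mass su sw.
have i2 := sqint_mul su sw.
rewrite -opprB -conv_form_Omega//; last by move=> x; exact: Vpc_out Vw.
rewrite -mulN1r -RintegralZl//; last first.
  by apply: (@integrable_subset _ _ _ mu setT) => //; exact: integrable_sub.
congr fine; apply: ae_eq_integral => //.
- apply/measurable_EFinP; apply: measurable_funM.
    exact: (L2_meas (measurable_itv _) Lb).
  by apply: (@measurable_funS _ _ _ _ setT) => //; exact: sqint_measurable.
- apply/measurable_EFinP; apply: (@measurable_funS _ _ _ _ setT) => //.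
  by apply: measurable_funM => //; exact: (integrable_measurable_fun (integrable_sub _ i1 i2)).
have ac := ae_conv_integrable K2 su.
have := ae_and ub ac; apply: ae_imp => x [ubx acx] Ox.
rewrite /= -(ubx Ox) mulN1r mulNr; congr (- _)%:E.
rewrite (nonlocal_opE d0 d1 K2 tg0 (g' := ext0 u))//.
- by rewrite conv_form_at ?mulrBl//; exact: acx.
- exact: (L2_meas measurable_interaction_domain Lu).
- exact: sqint_measurable.
- apply: ae_imp uI => y uy Ey; rewrite /ext0 patchE; case: ifPn => // yO.
  by apply: uy; case: Ey => // Oy; move/negP : yO; rewrite inE.
- by rewrite /ext0 patchE mem_set.
- exact: acx.
Qed.

Lemma galerkin_orthogonality s uh w : discrete_solution delta gamma b s uh -> Vpc delta s w ->
  inner (fun x => ext0 u x - uh x) w = conv_form k (fun x => ext0 u x - uh x) w.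
Proof.
move=> [Vu Hu] Vw; have su := ext0_sqint; have sw := Vpc_sqint Vw; have suh := Vpc_sqint Vu.
have := Hu _ Vw; rewrite (discrete_form Vu Vw) (exact_form Vw) => H.
rewrite (innerBl su suh sw) (conv_formBl mk k_ge0 k_mass su suh sw).
by move: H; exact: sub_eq_of_oppr_sub.
Qed.

End Galerkin.

(** * Quasi-optimality in L2 *)
Section Cea.
Context {R : realType}.
Implicit Types (delta : R) (gamma : R -> R -> R) (tgamma : R -> R).

(** The constant depends on the kernel only: N is any integer with N * delta / 4 > 1. *)
Lemma cea delta gamma tgamma : 0 < delta -> delta < 1 / 2 ->
  kernel_K1 delta gamma -> kernel_K2 gamma tgamma ->
  (forall r, delta < r -> tgamma r = 0) ->
  exists2 c : R, 0 < c & forall b u s uh v,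
    L2 Omega b -> nonlocal_solution delta gamma b u ->
    discrete_solution delta gamma b s uh -> Vpc delta s v ->
    norm2sq (fun x => ext0 u x - uh x) <= c * norm2sq (fun x => ext0 u x - v x).
Proof.
move=> d0 d1 K1 K2 tg0.
have [g0 g00 kg] := radial_lower_bound d0 d1 K1 K2.
(* J = [delta / 4, delta / 2] is where the kernel is bounded below and translates
   have a definite length. *)
pose d := delta / 4.
have d_0 : 0 < d by rewrite divr_gt0.
have dd : 2 * d <= delta / 2 by rewrite /d; lra.
pose N := (Num.bound d^-1).+1.
have Nd : 1 < N%:R * d.
  have di : 0 <= d^-1 by rewrite invr_ge0 ltW.
  rewrite -ltr_pdivrMr// mul1r (lt_le_trans (archi_boundP di))//.
  by rewrite /N ler_nat leqnSn.
pose c := g0 * d / N%:R ^+ 2.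
have c0 : 0 < c by rewrite divr_gt0 ?mulr_gt0// exprn_gt0.
exists (4 / c ^+ 2) => [|b u s uh v Lb sol dsol Vv]; first by rewrite divr_gt0// exprn_gt0.
have su := ext0_sqint sol; have [Vu _] := dsol.
have suh := Vpc_sqint Vu; have sv := Vpc_sqint Vv.
have s_e := sqintB su suh; have sw := sqintB sv suh.
have G := galerkin_orthogonality d0 d1 K2 tg0 Lb sol dsol (VpcB Vv Vu).
have h1 x : x \notin `[0, 1] -> ext0 u x - uh x = 0.
  move=> x01; rewrite (Vpc_out Vu x01) subr0 /ext0 patchE ifF//.
  by apply/negbTE; apply: contra x01; rewrite mem_setE; exact: subset_itvW.
have h2 z : 0 <= z -> z <= 2 * d -> g0 <= radial tgamma z.
  by move=> z0 zd; apply: kg; rewrite (ger0_norm z0) (le_trans zd dd).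
have co := conv_form_coercive (measurable_radial K2) (radial_ge0 K2) (radial_mass K2) s_e h1 d_0 (ltW g00) h2 (ltn0Sn _) Nd.
have := quasi_optimal (measurable_radial K2) (radial_ge0 K2) (radial_mass K2) s_e sw c0 G.
rewrite (_ : (fun x => _ - (_ - _)) = (fun x => ext0 u x - v x)); last first.
  by apply/funext => x; rewrite opprB addrA subrK.
by apply; rewrite innerff lerBrDr -lerBrDl (le_trans co)// mulrBl mul1r.
Qed.

End Cea.

(** * Meshes, additive relations and piecewise constant functions *)
Section Mesh.
Context {R : realType}.
Notation mu := (@lebesgue_measure R).
Implicit Types (a x y : R) (s : seq R) (K : R * R) (c : R * R -> R).

(** [mesh_elements] for an arbitrary first mesh point, so as to allow induction. *)
Definition elements a s : seq (R * R) := zip (a :: s) s.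

Lemma elements_lt a s K : path <%R a s -> K \in elements a s -> K.1 < K.2.
Proof.
elim: s a => [//|q s IH] a /= /andP[aq qs].
by rewrite inE => /predU1P[-> //|]; exact: IH.
Qed.

Lemma path_ge a s x : path <%R a s -> x \in s -> a < x.
Proof.
move=> /(order_path_min lt_trans) /allP; exact.
Qed.

Lemma elements_fst a s K : path <%R a s -> K \in elements a s -> a <= K.1.
Proof.
elim: s a => [//|q s IH] a /= /andP[aq qs].
by rewrite inE => /predU1P[-> //|/(IH _ qs)]; apply: le_trans; exact: ltW.
Qed.

Lemma path_last a s : path <%R a s -> a <= last a s.
Proof.
elim: s a => //= q s IH a /andP[aq qs].
by rewrite (le_trans (ltW aq))// IH.
Qed.

Lemma element_fst_mem a s K : K \in elements a s -> K.1 \in a :: s.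
Proof.
elim: s a => [//|q s IH] a; rewrite [elements _ _]/= inE => /predU1P[->|/IH].
  by rewrite inE eqxx.
by rewrite [in X in _ -> X]inE orbC => ->.
Qed.

(** A mesh point never lies strictly inside an element. *)
Lemma elements_split a s K p : path <%R a s -> p \in a :: s ->
  K \in elements a s -> K.2 <= p \/ p <= K.1.
Proof.
elim: s a => [//|q s IH] a /= /andP[aq qs].
rewrite /elements /= !in_cons => pa Ka.
have [pE|pa'] := eqVneq p a.
  right; rewrite pE; apply: (@elements_fst a (q :: s)) => /=; first by rewrite aq.
  by rewrite /elements /= in_cons.
move: pa; rewrite (negbTE pa') /= => pq.
move: Ka => /predU1P[-> /=|KE]; last by apply: (IH q) => //; rewrite in_cons.
left; move: pq => /predU1P[-> //|/(path_ge qs)/ltW//].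
Qed.

(** Induction along the mesh: a transitive relation that holds on every element
    holds from the first mesh point to any other one. *)
Lemma mesh_chain (P : R -> R -> Prop) a s : path <%R a s ->
  (forall x, P x x) ->
  (forall x y z, x <= y -> y <= z -> P x y -> P y z -> P x z) ->
  (forall K, K \in elements a s -> P K.1 K.2) ->
  forall y, y \in a :: s -> P a y.
Proof.
move=> + P0 PT; elim: s a => [a _ _ y|q s IH a /= /andP[aq qs] PK y].
  by rewrite inE => /eqP ->.
rewrite inE => /predU1P[->//|yq].
apply: (PT a q y) => //; first exact: ltW.
- by move: yq; rewrite inE => /predU1P[-> //|/(path_ge qs)/ltW].
- by apply: (PK (a, q)); rewrite inE eqxx.
- by apply: IH => // K KE; apply: PK; rewrite inE KE orbT.
Qed.

Lemma mesh_chain_last (P : R -> R -> Prop) a s : path <%R a s ->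
  (forall x, P x x) ->
  (forall x y z, x <= y -> y <= z -> P x y -> P y z -> P x z) ->
  (forall K, K \in elements a s -> P K.1 K.2) -> P a (last a s).
Proof. by move=> ps P0 PT PK; apply: (mesh_chain ps P0 PT PK); exact: mem_last. Qed.

(** Variant for arbitrary intervals, when the relation is known on all subintervals
    of elements. *)
Lemma mesh_chain_sub (P : R -> R -> Prop) a s : path <%R a s ->
  (forall x, P x x) ->
  (forall x y z, x <= y -> y <= z -> P x y -> P y z -> P x z) ->
  (forall K x y, K \in elements a s -> K.1 <= x -> x <= y -> y <= K.2 -> P x y) ->
  forall x y, a <= x -> x <= y -> y <= last a s -> P x y.
Proof.
move=> ps P0 PT PK x y ax xy yl.
(* Clamping the mesh to [x, y] turns the claim into mesh_chain_last. *)
pose cl t := Num.max x (Num.min t y).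
have clm t t' : t <= t' -> cl t <= cl t'.
  by move=> tt'; rewrite /cl ge_max !le_max lexx/= le_min !ge_min tt' lexx orbT/= orbT.
have := @mesh_chain_last (fun p q => P (cl p) (cl q)) a s ps.
have -> : cl a = x by rewrite /cl min_l ?max_l// (le_trans ax).
have -> : cl (last a s) = y by rewrite /cl min_r ?max_r.
apply => [t|p q r pq qr|K Ks]; first exact: P0.
  by apply: PT; exact: clm.
have Kl := elements_lt ps Ks.
have [yK|Ky] := leP y K.1.
  by rewrite /cl !min_r// (le_trans yK)// ltW.
have [Kx|xK] := leP K.2 x.
  rewrite /cl !max_l// ge_min ?Kx// (le_trans (ltW Kl) Kx)//.
apply: (PK K) => //.
- by rewrite /cl (min_l (ltW Ky)) le_max lexx orbT.
- by apply: clm; exact: ltW.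
- by rewrite /cl ge_max (ltW xK) ge_min lexx.
Qed.

(** Elements are half-open on the left, so that they partition ]a, last a s]. *)
Fixpoint piecewise_cst c a s x : R :=
  if s is q :: s' then if a < x <= q then c (a, q) else piecewise_cst c q s' x else 0.

Lemma piecewise_cstE c a s K x : path <%R a s -> K \in elements a s ->
  K.1 < x -> x <= K.2 -> piecewise_cst c a s x = c K.
Proof.
elim: s a => [//|q s IH] a /= /andP[aq qs].
rewrite inE => /predU1P[-> /= ax xq|KE Kx xK]; first by rewrite ax xq.
have := elements_fst qs KE => qK.
by rewrite [x <= q]leNgt (le_lt_trans qK Kx) andbF IH.
Qed.

Lemma measurable_piecewise_cst c a s : measurable_fun setT (piecewise_cst c a s).
Proof.
elim: s a => [|q s IH] a /=; first exact: measurable_cst.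
apply: measurable_fun_ifT => //.
apply: measurable_and.
  by apply: measurable_fun_ltr.
exact: measurable_fun_ler.
Qed.

Lemma piecewise_cst_bounded c a s : exists M, forall x, `|piecewise_cst c a s x| <= M.
Proof.
elim: s a => [|q s IH] a /=; first by exists 0 => x; rewrite normr0.
have [M HM] := IH q; exists (Num.max `|c (a, q)| M) => x.
by case: ifP => _; rewrite le_max ?lexx// HM orbT.
Qed.

Lemma piecewise_cst_out c a s x : path <%R a s -> x <= a \/ last a s < x -> piecewise_cst c a s x = 0.
Proof.
elim: s a => [//|q s IH] a /= /andP[aq qs] H.
have ql := path_last qs.
case: ifPn => [/andP[ax xq]|_].
  by case: H => H; [move: (lt_le_trans ax H)|move: (lt_le_trans H (le_trans xq ql))]; rewrite ltxx.
by apply: IH => //; case: H => H; [left; rewrite (le_trans H)// ltW|right].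
Qed.

Lemma mesh_size_ge delta s K : K \in mesh_elements delta s ->
  K.2 - K.1 <= mesh_size delta s.
Proof.
move=> Ks; rewrite /mesh_size.
exact: (@bigmax_sup_seq _ _ _ _ _ K xpredT _ (fun K : R * R => K.2 - K.1) Ks).
Qed.

Lemma mesh_sum_le (phi psi : R -> R) (C : R) a s : path <%R a s -> 0 <= C ->
  measurable_fun setT phi -> measurable_fun setT psi ->
  (forall x, 0 <= phi x) -> (forall x, 0 <= psi x) ->
  (forall K, K \in elements a s ->
    (\int[mu]_(x in `]K.1, K.2]) (phi x)%:E <= C%:E * \int[mu]_(x in `]K.1, K.2]) (psi x)%:E)%E) ->
  (\int[mu]_(x in `]a, last a s]) (phi x)%:E <=
   C%:E * \int[mu]_(x in `]a, last a s]) (psi x)%:E)%E.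
Proof.
move=> ps C0 mphi mpsi phi0 psi0.
pose P x y := (\int[mu]_(t in `]x, y]) (phi t)%:E <=
   C%:E * \int[mu]_(t in `]x, y]) (psi t)%:E)%E.
apply: (mesh_chain_last (P := P) ps).
  by move=> x; rewrite /P set_itvoc0 !integral_set0 mule0.
move=> x y z xy yz Pxy Pyz; rewrite /P.
have E (f : R -> R) : measurable_fun setT f -> (forall x, 0 <= f x) ->
    (\int[mu]_(t in `]x, z]) (f t)%:E =
    \int[mu]_(t in `]x, y]) (f t)%:E + \int[mu]_(t in `]y, z]) (f t)%:E)%E.
  move=> mf f0; rewrite (@itv_bndbnd_setU _ _ (BRight x) (BRight y) (BRight z)) ?bnd_simp//.
  rewrite ge0_integral_setU//=.
  - apply: (@measurable_funS _ _ _ _ setT) => //; exact/measurable_EFinP.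
  - by move=> t _; rewrite lee_fin.
  - apply/disj_setPS => t [/=]; rewrite !in_itv/= => /andP[_ ty] /andP[yt _].
    by move: (lt_le_trans yt ty); rewrite ltxx.
rewrite !E// ge0_muleDr; first exact: leeD.
all: by apply: integral_ge0 => t _; rewrite lee_fin.
Qed.

End Mesh.

(** * Elementwise approximation by means *)
Section ElementEstimates.
Context {R : realType}.
Notation mu := (@lebesgue_measure R).
Implicit Types (x y p q : R) (f g : R -> R) (s : seq R) (K : R * R).

Lemma Rintegral_oc_add f x y z : mu.-integrable setT (EFin \o f) ->
  x <= y -> y <= z ->
  \int[mu]_(t in `]x, z]) f t = \int[mu]_(t in `]x, y]) f t + \int[mu]_(t in `]y, z]) f t.
Proof.
move=> fi xy yz.
rewrite (@itv_bndbnd_setU _ _ (BRight x) (BRight y) (BRight z)) ?bnd_simp//.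
rewrite Rintegral_setU//.
- by apply: (@integrable_subset _ _ _ mu setT) => //; apply: measurableU.
- apply/disj_setPS => t [/=]; rewrite !in_itv/= => /andP[_ ty] /andP[yt _].
  by move: (lt_le_trans yt ty); rewrite ltxx.
Qed.

Lemma mu_oc p q : p <= q -> mu `]p, q] = (q - p)%:E.
Proof.
rewrite le_eqVlt => /predU1P[->|pq]; first by rewrite set_itvoc0 measure0 subrr.
by rewrite lebesgue_measure_itv/= lte_fin pq.
Qed.

Lemma Rintegral_oc_cst p q k : p <= q -> \int[mu]_(t in `]p, q]) k = k * (q - p).
Proof. by move=> pq; rewrite Rintegral_cst// [X in fine X](mu_oc pq). Qed.

Lemma integrable_oc_cst p q k : mu.-integrable `]p, q] (EFin \o (fun=> k)).
Proof.
apply: integrable_const => //; rewrite [ltLHS]lebesgue_measure_itv.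
by case: ifP => _; rewrite ?ltry// -EFinB ltry.
Qed.

Lemma ge0_ae_le_Rintegral D f g : measurable D -> measurable_fun D f ->
  mu.-integrable D (EFin \o g) ->
  (forall x, D x -> 0 <= f x) -> (forall x, D x -> 0 <= g x) ->
  {ae mu, forall x, D x -> f x <= g x} ->
  \int[mu]_(x in D) f x <= \int[mu]_(x in D) g x.
Proof.
move=> mD mf ig f0 g0 fg.
have H : (\int[mu]_(x in D) (f x)%:E <= \int[mu]_(x in D) (g x)%:E)%E.
  apply: ae_ge0_le_integral => //.
  - exact/measurable_EFinP.
  - exact: (measurable_int _ ig).
have gf : (\int[mu]_(x in D) (g x)%:E)%E \is a fin_num.
  by apply: (@integrable_fin_num _ _ _ mu).
rewrite /Rintegral fine_le//.
rewrite ge0_fin_numE; last exact: integral_ge0.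
by rewrite (le_lt_trans H)// -ge0_fin_numE//; exact: integral_ge0.
Qed.

Lemma sqint_patch D f : measurable D -> square_integrable f -> square_integrable (f \_ D).
Proof.
move=> mD sf; apply: sqintP; last by apply: (measurable_restrictT f mD).1;
  apply: (@measurable_funS _ _ _ _ setT) => //; exact: sqint_measurable.
apply: (@integrable_dominated _ _ _ mu setT _ (fun x => f x ^+ 2)) => //.
- apply: measurable_funX; apply: (measurable_restrictT f mD).1.
  by apply: (@measurable_funS _ _ _ _ setT) => //; exact: sqint_measurable.
- move=> x _; rewrite patchE; case: ifP => _; first by rewrite ger0_norm ?sqr_ge0.
  by rewrite expr0n/= normr0 sqr_ge0.
- exact: sqint_sqr.
Qed.

Lemma sqint_indic_oc p q : square_integrable (\1_(`]p, q]%classic) : R -> R).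
Proof.
apply: sqintP => //.
apply: (@eq_integrable_fun _ _ _ mu setT (\1_(`]p, q]%classic))) => //; last exact: integrable_indic_itv.
by move=> x _; rewrite indicE; case: (_ \in _); rewrite ?expr1n ?expr0n.
Qed.

Lemma sqint_integrable_oc f p q : square_integrable f -> mu.-integrable `]p, q] (EFin \o f).
Proof.
move=> sf; apply: (integrable_patch mu f (measurable_itv _)).2.
apply: (@eq_integrable_fun _ _ _ mu setT (fun x => f x * \1_(`]p, q]%classic) x)) => //.
  by move=> x _; rewrite patchE indicE; case: (_ \in _); rewrite ?mulr1 ?mulr0.
by apply: sqint_mul => //; exact: sqint_indic_oc.
Qed.

Lemma sqint_norm f : square_integrable f -> square_integrable (fun x => `|f x|).
Proof.
move=> sf; apply: sqintP; last by apply: measurableT_comp => //; exact: sqint_measurable.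
apply: (@eq_integrable_fun _ _ _ mu setT (fun x => f x ^+ 2)) => //; last exact: sqint_sqr.
by move=> x _; rewrite real_normK// num_real.
Qed.

(** [cauchy_schwarz] against the indicator of ]p, q]. *)
Lemma cauchy_schwarz_oc f p q : square_integrable f -> p <= q ->
  (\int[mu]_(t in `]p, q]) `|f t|) ^+ 2 <= (q - p) * \int[mu]_(t in `]p, q]) (f t ^+ 2).
Proof.
move=> sf pq.
have := cauchy_schwarz (sqint_patch (measurable_itv `]p, q]) (sqint_norm sf)) (sqint_indic_oc p q).
have -> : inner ((fun x => `|f x|) \_ `]p, q]) (\1_(`]p, q]%classic)) = \int[mu]_(t in `]p, q]) `|f t|.
  rewrite [RHS]Rintegral_mkcond; apply: eq_Rintegral => x _.
  by rewrite patchE indicE; case: (_ \in _); rewrite ?mulr1 ?mulr0.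
have -> : norm2sq ((fun x => `|f x|) \_ `]p, q]) = \int[mu]_(t in `]p, q]) (f t ^+ 2).
  rewrite [RHS]Rintegral_mkcond; apply: eq_Rintegral => x _.
  rewrite !patchE; case: (_ \in _); first by rewrite real_normK// num_real.
  by rewrite expr0n.
have -> : norm2sq (\1_(`]p, q]%classic)) = q - p.
  rewrite -[RHS]mul1r -Rintegral_oc_cst// [RHS]Rintegral_mkcond.
  apply: eq_Rintegral => x _; rewrite patchE indicE.
  by case: (_ \in _); rewrite ?expr1n ?expr0n.
by rewrite mulrC.
Qed.

Variables (a : R) (s : seq R) (G G2 : R -> R).
Hypothesis ps : path <%R a s.
Hypothesis sG : square_integrable G.
Hypothesis iG : mu.-integrable setT (EFin \o G).
Hypothesis sG2 : square_integrable G2.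
Hypothesis osc : forall K, K \in elements a s -> exists2 P : R -> Prop,
  {ae mu, forall x, `]K.1, K.2]%classic x -> P x} &
  forall x t, `]K.1, K.2]%classic x -> `]K.1, K.2]%classic t -> P x -> P t ->
    `|G x - G t| <= \int[mu]_(z in `]K.1, K.2]) `|G2 z|.

Definition element_mean K := (\int[mu]_(t in `]K.1, K.2]) G t) / (K.2 - K.1).
Definition mesh_mean := piecewise_cst element_mean a s.
(** The primitive of G minus its elementwise mean. It vanishes at the mesh points, so
    it is the error of nodal interpolation of a primitive of G. *)
Definition defect x := \int[mu]_(t in `]a, x]) (G t - mesh_mean t).

Lemma piecewise_cst_integrable c : mu.-integrable setT (EFin \o piecewise_cst c a s).
Proof.
have [M HM] := piecewise_cst_bounded c a s.
apply: (@integrable_dominated _ _ _ mu setT _ (fun x => M * \1_(`]a, last a s]%classic) x)) => //.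
- exact: measurable_piecewise_cst.
- move=> x _; rewrite indicE mem_setE in_itv/=.
  have [xa|ax] := leP x a; first by rewrite mulr0 piecewise_cst_out ?normr0//; left.
  have [xl|lx] := leP x (last a s); first by rewrite mulr1.
  by rewrite mulr0 piecewise_cst_out ?normr0//; right.
- by apply: integrable_scale => //; exact: integrable_indic_itv.
Qed.

Lemma piecewise_cst_sqint c : square_integrable (piecewise_cst c a s).
Proof.
have [M HM] := piecewise_cst_bounded c a s.
apply: sqintP; last exact: measurable_piecewise_cst.
apply: (@eq_integrable_fun _ _ _ mu setT (fun x => piecewise_cst c a s x * piecewise_cst c a s x)) => //.
apply: (@integrable_mul_bounded _ _ _ mu setT _ _ M) => //; first exact: piecewise_cst_integrable.
exact: measurable_piecewise_cst.
Qed.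

Let D x := G x - mesh_mean x.
Let iD : mu.-integrable setT (EFin \o D).
Proof. by apply: integrable_sub => //; exact: piecewise_cst_integrable. Qed.
Let sD : square_integrable D. Proof. by apply: sqintB => //; exact: piecewise_cst_sqint. Qed.

Lemma mesh_meanE K x : K \in elements a s -> K.1 < x -> x <= K.2 -> mesh_mean x = element_mean K.
Proof. by move=> KE Kx xK; rewrite /mesh_mean (piecewise_cstE _ ps KE). Qed.

Lemma integral_element0 K : K \in elements a s -> \int[mu]_(t in `]K.1, K.2]) D t = 0.
Proof.
move=> KE; have Kl := elements_lt ps KE.
rewrite /D RintegralB//; [|exact: (@integrable_subset _ _ _ mu setT)|apply: (@integrable_subset _ _ _ mu setT) => //; exact: piecewise_cst_integrable].
have -> : \int[mu]_(t in `]K.1, K.2]) mesh_mean t = element_mean K * (K.2 - K.1).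
  rewrite -(Rintegral_oc_cst _ (ltW Kl)); apply: eq_Rintegral => t.
  by rewrite inE/= in_itv/= => /andP[Kt tK]; exact: mesh_meanE.
by rewrite /element_mean divfK ?subrr// gt_eqF// subr_gt0.
Qed.

Lemma defect_mesh p : p \in a :: s -> defect p = 0.
Proof.
apply: (mesh_chain (P := fun x y => \int[mu]_(t in `]x, y]) D t = 0) ps).
- by move=> x; rewrite set_itvoc0 Rintegral_set0.
- by move=> x y z xy yz h1 h2; rewrite (Rintegral_oc_add iD xy yz) h1 h2 addr0.
- exact: integral_element0.
Qed.

(** At almost every x, G x - mean is an average of differences G x - G t, each at most
    the integral of |G2| over the element; then Cauchy-Schwarz. *)
Lemma element_oscillation K : K \in elements a s ->
  \int[mu]_(x in `]K.1, K.2]) (D x ^+ 2) <=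
  (K.2 - K.1) ^+ 2 * \int[mu]_(x in `]K.1, K.2]) (G2 x ^+ 2).
Proof.
move=> KE; have Kl := elements_lt ps KE; have [P aP HP] := osc KE.
set l := K.2 - K.1; have l0 : 0 < l by rewrite subr_gt0.
set V := \int[mu]_(z in `]K.1, K.2]) `|G2 z| in HP.
set S := \int[mu]_(x in _) (G2 x ^+ 2).
have V0 : 0 <= V by apply: Rintegral_ge0.
have VS : V ^+ 2 <= l * S by apply: cauchy_schwarz_oc => //; exact: ltW.
have iGK := @integrable_subset _ _ _ mu setT `]K.1, K.2]%classic G measurableT (measurable_itv _) (@subsetT _ _) iG.
have dev x : `]K.1, K.2]%classic x -> P x -> `|D x| <= V.
  move=> Kx Px; move: (Kx); rewrite /= in_itv/= => /andP[K1x xK2].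
  rewrite /D (mesh_meanE KE)// -(ler_pM2l l0) -{1}(gtr0_norm l0) -normrM.
  have -> : l * (G x - element_mean K) = \int[mu]_(t in `]K.1, K.2]) (G x - G t).
    rewrite RintegralB//; last exact: integrable_oc_cst.
    by rewrite (Rintegral_oc_cst _ (ltW Kl)) /element_mean -/l mulrBr [l * (_ / l)]mulrC divfK ?gt_eqF// mulrC.
  have ixt : mu.-integrable `]K.1, K.2] (EFin \o (fun t => G x - G t)).
    by apply: integrable_sub => //; exact: integrable_oc_cst.
  apply: (le_trans (le_normr_Rintegral _ ixt)) => //.
  rewrite mulrC -(Rintegral_oc_cst _ (ltW Kl)).
  apply: ge0_ae_le_Rintegral => //.
  - exact: (integrable_measurable_fun (integrable_abs ixt)).
  - exact: integrable_oc_cst.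
  - by apply: ae_imp aP => t Pt Kt; apply: HP => //; exact: Pt.
rewrite expr2 -mulrA mulrC -(Rintegral_oc_cst _ (ltW Kl)).
apply: ge0_ae_le_Rintegral => //.
- by apply: (@measurable_funS _ _ _ _ setT) => //; apply: measurable_funX; exact: sqint_measurable.
- exact: integrable_oc_cst.
- by move=> x _; exact: sqr_ge0.
- by move=> x _; rewrite (le_trans _ VS)// sqr_ge0.
apply: ae_imp aP => x Px Kx; apply: le_trans VS.
by rewrite -[D x ^+ 2]real_normK ?num_real// lerXn2r ?nnegrE// dev//; exact: Px.
Qed.

(** Since the defect vanishes at the left end of the element, it is the integral of
    G - mean from there; then Cauchy-Schwarz and [element_oscillation]. *)
Lemma element_defect K x : K \in elements a s -> K.1 < x -> x <= K.2 ->
  defect x ^+ 2 <= (K.2 - K.1) ^+ 3 * \int[mu]_(t in `]K.1, K.2]) (G2 t ^+ 2).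
Proof.
move=> KE Kx xK; have Kl := elements_lt ps KE.
have aK := elements_fst ps KE.
have K1m : K.1 \in a :: s.
  exact: element_fst_mem KE.
have -> : defect x = \int[mu]_(t in `]K.1, x]) D t.
  have := Rintegral_oc_add iD aK (ltW Kx); rewrite -/(defect x).
  by move=> ->; rewrite -/(defect K.1) defect_mesh// add0r.
have iDK p q := @integrable_subset _ _ _ mu setT `]p, q]%classic D measurableT (measurable_itv _) (@subsetT _ _) iD.
apply: (@le_trans _ _ ((\int[mu]_(t in `]K.1, K.2]) `|D t|) ^+ 2)).
  rewrite -[leLHS]real_normK ?num_real// lerXn2r ?nnegrE ?Rintegral_ge0//.
  apply: (le_trans (le_normr_Rintegral _ (iDK K.1 x))) => //.
  have iDn : mu.-integrable setT (EFin \o (fun t => `|D t|)) by exact: integrable_abs.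
  by rewrite (Rintegral_oc_add iDn (ltW Kx) xK) lerDl Rintegral_ge0.
apply: (le_trans (cauchy_schwarz_oc sD (ltW Kl))).
rewrite exprS -mulrA ler_wpM2l ?subr_ge0 ?(ltW Kl)//; exact: element_oscillation.
Qed.

End ElementEstimates.

(** * Regularity on one subinterval *)
Section Pieces.
Context {R : realType}.
Notation mu := (@lebesgue_measure R).
Implicit Types (a b : R) (f g u : R -> R).

Lemma L2_ae a b f g : measurable_fun `]a, b[ f ->
  {ae mu, forall t, t \in `]a, b[ -> f t = g t} -> L2 `]a, b[ g -> L2 `]a, b[ f.
Proof.
move=> mf fg /L2_sqint [mg g2]; apply: sqint_L2.
have mfp : measurable_fun setT (f \_ `]a, b[) by exact: (measurable_restrictT f (measurable_itv _)).1.
split => //; apply: le_lt_trans g2.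
rewrite le_eqVlt; apply/orP; left; apply/eqP; apply: ae_eq_integral => //.
- by apply/measurable_EFinP; exact: measurable_funX.
- by apply/measurable_EFinP; exact: measurable_funX.
- apply: ae_imp fg => x fgx _; rewrite !patchE mem_setE.
  by case: ifPn => // /fgx ->.
Qed.

Lemma L2_integrable a b f : L2 `]a, b[ f ->
  mu.-integrable setT (EFin \o (f \_ `]a, b[)).
Proof.
move=> /L2_sqint sf.
apply: (@eq_integrable_fun _ _ _ mu setT ((f \_ `]a, b[) \_ `]a, b])) => //.
  move=> x _; rewrite !patchE !mem_setE !in_itv/=.
  by case: (a < x) => //=; case: (ltgtP x b).
by apply: (integrable_patch mu _ (measurable_itv _)).1; exact: sqint_integrable_oc.
Qed.

(** The functions picked by [wderiv] agree almost everywhere with the witnesses of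
    H^2 regularity and inherit their properties. *)
Lemma H2_wderiv a b u : H2 `]a, b[ u ->
  [/\ weak_derivative `]a, b[ u (wderiv `]a, b[ u),
      weak_derivative `]a, b[ (wderiv `]a, b[ u) (wderiv `]a, b[ (wderiv `]a, b[ u)),
      L2 `]a, b[ (wderiv `]a, b[ u) &
      L2 `]a, b[ (wderiv `]a, b[ (wderiv `]a, b[ u))].
Proof.
move=> [_ [g1 [g2 [w1 w2 L1 L2_]]]].
have wu := wderivP w1; have ae1 := wderiv_ae w1.
have w2' : weak_derivative `]a, b[ (wderiv `]a, b[ u) g2.
  apply: weak_derivative_ae w2; first by case: wu.
  by apply: ae_imp ae1 => t H tab; rewrite H.
have ww := wderivP w2'; have ae2 := wderiv_ae w2'.
split => //.
- by apply: L2_ae ae1 L1; case: wu => _ [].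
- by apply: L2_ae ae2 L2_; case: ww => _ [].
Qed.

(** Almost every point is a Lebesgue point of f. *)
Lemma ae_primitive a b f g : weak_derivative `]a, b[ f g -> L2 `]a, b[ f ->
  exists2 P : R -> Prop, {ae mu, forall x, P x} &
   forall x t, `]a, b[%classic x -> `]a, b[%classic t -> P x -> P t -> x < t ->
     f t - f x = \int[mu]_(z in `]x, t]) g z.
Proof.
move=> w Lf.
have lf : locally_integrable setT (f \_ `]a, b[).
  exact: (open_integrable_locally openT (L2_integrable Lf)).
exists (lebesgue_pt (f \_ `]a, b[)); first exact: lebesgue_differentiation lf.
move=> x t xD tD Px Pt xt.
(* Lebesgue points are only available for functions on the whole line. *)
have w' : weak_derivative `]a, b[ (f \_ `]a, b[) g.
  apply: weak_derivative_ae w.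
    apply: open_integrable_locally; first exact: interval_open.
    exact: (@integrable_subset _ _ _ mu setT `]a, b[%classic _ measurableT (measurable_itv _) (@subsetT _ _) (L2_integrable Lf)).
  by apply: aeW => z zD; rewrite patchE mem_setE zD.
move: (xD) (tD); rewrite /= !in_itv/= => /andP[ax xb] /andP[at_ tb].
rewrite (weak_derivative_primitive w' ax xt tb Px Pt).
by rewrite !patchE !mem_set.
Qed.

Lemma continuous_primitive a b u g x y : weak_derivative `]a, b[ u g ->
  {in `]a, b[, continuous u} -> a < x -> x <= y -> y < b ->
  u y - u x = \int[mu]_(z in `]x, y]) g z.
Proof.
move=> w cu ax; rewrite le_eqVlt => /predU1P[->|xy] yb.
  by rewrite subrr set_itvoc0 Rintegral_set0.
have mu_ : measurable_fun `]a, b[ u by case: w => [[]].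
have xD : x \in `]a, b[ by rewrite in_itv/= ax (lt_trans xy).
have yD : y \in `]a, b[ by rewrite in_itv/= yb (lt_trans ax).
rewrite (weak_derivative_primitive w ax xy yb)//.
- exact: continuous_lebesgue_ptE mu_ xD (cu _ xD).
- exact: continuous_lebesgue_ptE mu_ yD (cu _ yD).
Qed.

(** [continuous_primitive] extends to an end point of the interval where u is
    continuous, because integrals depend continuously on their bounds. *)
Lemma piece_primitive a b u g x y : a < b -> weak_derivative `]a, b[ u g ->
  L2 `]a, b[ g -> {in `]a, b[, continuous u} ->
  a <= x -> x <= y -> y <= b ->
  (x = a -> {for a, continuous u}) -> (y = b -> {for b, continuous u}) ->
  u y - u x = \int[mu]_(z in `]x, y]) (g \_ `]a, b[) z.
Proof.
move=> ab w Lg cu.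
pose F := g \_ `]a, b[.
have iF : mu.-integrable setT (EFin \o F) := L2_integrable Lg.
have iFc p q : mu.-integrable `[p, q] (EFin \o F) by exact: (@integrable_subset _ _ _ mu setT).
have base p q : a < p -> p <= q -> q < b -> u q - u p = \int[mu]_(z in `]p, q]) F z.
  move=> ap pq qb; rewrite (continuous_primitive w cu ap pq qb).
  apply: eq_Rintegral => z; rewrite inE/= in_itv/= => /andP[pz zq].
  by rewrite /F patchE mem_setE in_itv/= (lt_trans ap pz) (le_lt_trans zq qb).
have ocE p q : \int[mu]_(z in `]p, q]) F z = \int[mu]_(z in `[p, q]) F z.
  by apply: Rintegral_itv_obnd_cbnd; exact: (@integrable_subset _ _ _ mu setT).
have right p : a < p -> p <= b -> {for b, continuous u} -> u b - u p = \int[mu]_(z in `]p, b]) F z.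
  move=> ap; rewrite le_eqVlt => /predU1P[-> _|pb cb].
    by rewrite subrr set_itvoc0 Rintegral_set0.
  have l1 : u q - u p @[q --> b^'-] --> u b - u p.
    by apply: cvgB; [exact: cvg_at_left_filter|exact: cvg_cst].
  have l2 := parameterized_integral_cvg_at_left pb (iFc p b).
  rewrite ocE; apply: (cvg_unique (@Rhausdorff R) l1).
  apply: cvg_trans l2; apply: near_eq_cvg; near=> q.
  rewrite /parameterized_integral -ocE base//.
  by near: q; exact: nbhs_left_ge.
have all_right p q : a < p -> p <= q -> q <= b -> (q = b -> {for b, continuous u}) ->
    u q - u p = \int[mu]_(z in `]p, q]) F z.
  move=> ap pq qb cq; have [qE|qE] := eqVneq q b.
    by rewrite qE in pq cq *; exact: right (cq erefl).
  by apply: base => //; rewrite lt_neqAle qE.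
move=> ax xy yb cx cy; have [xa|xa] := eqVneq x a; last first.
  by apply: all_right => //; rewrite lt_neqAle eq_sym xa.
rewrite {}xa in ax xy cx *; have {}cx := cx erefl.
move: xy; rewrite le_eqVlt => /predU1P[<-|ay].
  by rewrite subrr set_itvoc0 Rintegral_set0.
have l1 : u y - u q @[q --> a^'+] --> u y - u a.
  by apply: cvgB; [exact: cvg_cst|exact: cvg_at_right_filter].
have l2 : \int[mu]_(z in `]a, y]) F z - \int[mu]_(z in `[a, q]) F z @[q --> a^'+] -->
    \int[mu]_(z in `]a, y]) F z - 0.
  apply: cvgB; first exact: cvg_cst.
  apply: cvg_at_right_filter.
  exact: (parameterized_integral_cvg_left ay (iFc a y)).
rewrite subr0 in l2.
apply: (cvg_unique (@Rhausdorff R) l1).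
apply: cvg_trans l2; apply: near_eq_cvg; near=> q.
have aq : a < q by [].
have qy : q <= y by near: q; exact: nbhs_right_le.
rewrite -ocE (Rintegral_oc_add iF (ltW aq) qy) addrAC subrr add0r.
by apply/esym/all_right.
Unshelve. all: by end_near. Qed.

End Pieces.

(** * Gluing the three subintervals *)
Section Glue.
Context {R : realType}.
Notation mu := (@lebesgue_measure R).
Implicit Types (a b p q : R) (f g u : R -> R).

(** First and second derivatives on a subinterval, extended by 0 so that the pieces
    can be added. *)
Definition deriv1_on a b u := wderiv `]a, b[ u \_ `]a, b[.
Definition deriv2_on a b u := wderiv `]a, b[ (wderiv `]a, b[ u) \_ `]a, b[.

(** Inside a subinterval of H^2 regularity the derivative is a primitive of the second
    derivative. *)
Lemma oscillation_piece a b u p q (G G2 : R -> R) : H2 `]a, b[ u -> a <= p -> p < q -> q <= b ->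
  (forall x, a < x -> x <= b -> G x = deriv1_on a b u x) ->
  (forall x, a < x -> x <= b -> G2 x = deriv2_on a b u x) -> square_integrable G2 ->
  exists2 P : R -> Prop, {ae mu, forall x, `]p, q]%classic x -> P x} &
  forall x t, `]p, q]%classic x -> `]p, q]%classic t -> P x -> P t ->
    `|G x - G t| <= \int[mu]_(z in `]p, q]) `|G2 z|.
Proof.
move=> Hu ap pq qb GE G2E sG2.
have [w1 w2 L1 L2_] := H2_wderiv Hu.
have [P aP HP] := ae_primitive w2 L1.
exists (fun x => P x /\ x != b).
  (* b may belong to ]p, q], but the functions are only controlled inside ]a, b[. *)
  have nb : {ae mu, forall x, x != b}.
    exists [set b]; split => //; first exact: lebesgue_measure_set1.
    by move=> x /= /negP; rewrite negbK => /eqP.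
  by apply: ae_imp (ae_and aP nb).
have iG2 : mu.-integrable `]p, q] (EFin \o (fun z => `|G2 z|)).
  by apply: integrable_abs; exact: sqint_integrable_oc.
have key x t : `]p, q]%classic x -> `]p, q]%classic t -> P x -> x != b -> P t -> t != b ->
    x < t -> `|G t - G x| <= \int[mu]_(z in `]p, q]) `|G2 z|.
  rewrite /= !in_itv/= => /andP[px xq] /andP[pt tq] Px xb Pt tb xt.
  have ax : a < x := le_lt_trans ap px; have at_ : a < t := le_lt_trans ap pt.
  have xb' : x < b by rewrite lt_neqAle xb (le_trans xq).
  have tb' : t < b by rewrite lt_neqAle tb (le_trans tq).
  have xD : `]a, b[%classic x by rewrite /= in_itv/= ax.
  have tD : `]a, b[%classic t by rewrite /= in_itv/= at_.
  rewrite (GE t at_ (ltW tb')) (GE x ax (ltW xb')) /deriv1_on !patchE !mem_set//.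
  rewrite (HP x t xD tD Px Pt xt).
  have -> : \int[mu]_(z in `]x, t]) wderiv `]a, b[ (wderiv `]a, b[ u) z = \int[mu]_(z in `]x, t]) G2 z.
    apply: eq_Rintegral => z; rewrite inE/= in_itv/= => /andP[xz zt].
    have az := lt_trans ax xz; have zb := le_lt_trans zt tb'.
    by rewrite G2E ?ltW// /deriv2_on patchE mem_set//= in_itv/= az.
  have ixt : mu.-integrable `]x, t] (EFin \o G2) by exact: sqint_integrable_oc.
  apply: (le_trans (le_normr_Rintegral _ ixt)) => //.
  rewrite Rintegral_mkcond [leRHS]Rintegral_mkcond.
  have sub : `]x, t] `<=` `]p, q] by apply: subset_itv; rewrite bnd_simp// ltW.
  apply: le_Rintegral => //.
  - apply: (integrable_patch mu _ (measurable_itv _)).1.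
    by apply: integrable_abs; exact: sqint_integrable_oc.
  - exact: (integrable_patch mu _ (measurable_itv _)).1.
  move=> z _; rewrite !patchE; case: ifPn => [/set_mem/sub zD|_]; first by rewrite mem_set.
  by case: ifP => _ /=; rewrite ?normr_ge0 ?lexx.
move=> x t Kx Kt [Px xb] [Pt tb]; have [xt|tx|->] := ltgtP x t.
- by rewrite distrC; exact: key.
- exact: key.
- by rewrite subrr normr0 Rintegral_ge0.
Qed.

Lemma oscillation_zero p q (G G2 : R -> R) : (forall x, p < x -> x <= q -> G x = 0 :> R) ->
  exists2 P : R -> Prop, {ae mu, forall x, `]p, q]%classic x -> P x} &
  forall x t, `]p, q]%classic x -> `]p, q]%classic t -> P x -> P t ->
    `|G x - G t| <= \int[mu]_(z in `]p, q]) `|G2 z|.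
Proof.
move=> G0; exists (fun=> True); first by apply: aeW.
move=> x t /=; rewrite !in_itv/= => /andP[px xq] /andP[pt tq] _ _.
by rewrite !G0// subrr normr0 Rintegral_ge0.
Qed.

Variables (delta : R) (u : R -> R).
Hypothesis d0 : 0 < delta.
Hypothesis d1 : delta < 1 / 2.
Hypothesis cu : {in Omega, continuous u}.
Hypothesis Ha : H2 `]0, delta[ u.
Hypothesis Hb : H2 `]delta, 1 - delta[ u.
Hypothesis Hc : H2 `]1 - delta, 1[ u.

(** The derivative of u on (0, 1), assembled from its three pieces and 0 elsewhere;
    it may jump at delta and 1 - delta. *)
Definition glue1 x := deriv1_on 0 delta u x + deriv1_on delta (1 - delta) u x + deriv1_on (1 - delta) 1 u x.
Definition glue2 x := deriv2_on 0 delta u x + deriv2_on delta (1 - delta) u x + deriv2_on (1 - delta) 1 u x.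

Let dd : delta < 1 - delta. Proof. by move: d0 d1; lra. Qed.
Let d1' : delta < 1. Proof. by move: d0 d1; lra. Qed.
Let dm : 0 < 1 - delta. Proof. by move: d0 d1; lra. Qed.
Let dm1 : 1 - delta < 1. Proof. by move: d0 d1; lra. Qed.

Let deriv1_on_out a b x : x <= a \/ b <= x -> deriv1_on a b u x = 0.
Proof.
by rewrite /deriv1_on patchE mem_setE in_itv/= => -[h|h]; rewrite [_ < x]ltNge ?[x < _]ltNge h ?andbF.
Qed.
Let deriv2_on_out a b x : x <= a \/ b <= x -> deriv2_on a b u x = 0.
Proof.
by rewrite /deriv2_on patchE mem_setE in_itv/= => -[h|h]; rewrite [_ < x]ltNge ?[x < _]ltNge h ?andbF.
Qed.

Lemma glue1_a x : 0 < x -> x <= delta -> glue1 x = deriv1_on 0 delta u x.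
Proof.
move=> x0 xd; rewrite /glue1 (deriv1_on_out (a := delta)) ?(deriv1_on_out (a := 1 - delta)) ?addr0//.
  by left; rewrite (le_trans xd)// ltW.
by left.
Qed.
Lemma glue1_b x : delta < x -> x <= 1 - delta -> glue1 x = deriv1_on delta (1 - delta) u x.
Proof.
move=> x0 xd; rewrite /glue1 (deriv1_on_out (a := 0)) ?(deriv1_on_out (a := 1 - delta)) ?addr0 ?add0r//.
  by left.
by right; rewrite ltW.
Qed.
Lemma glue1_c x : 1 - delta < x -> x <= 1 -> glue1 x = deriv1_on (1 - delta) 1 u x.
Proof.
move=> x0 xd; rewrite /glue1 (deriv1_on_out (a := 0)) ?(deriv1_on_out (a := delta)) ?addr0 ?add0r//.
  by right; rewrite ltW.
by right; rewrite (le_trans (ltW dd))// ltW.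
Qed.
Lemma glue1_out x : x <= 0 \/ 1 <= x -> glue1 x = 0.
Proof.
move=> x01; have [h1 h2 h3] : [/\ x <= 0 \/ delta <= x, x <= delta \/ 1 - delta <= x & x <= 1 - delta \/ 1 <= x].
  by move: d0 d1 => ? ?; case: x01 => ?; split; try (by left; lra); right; lra.
by rewrite /glue1 !deriv1_on_out// !addr0.
Qed.

Lemma glue2_a x : 0 < x -> x <= delta -> glue2 x = deriv2_on 0 delta u x.
Proof.
move=> x0 xd; rewrite /glue2 (deriv2_on_out (a := delta)) ?(deriv2_on_out (a := 1 - delta)) ?addr0//.
  by left; rewrite (le_trans xd)// ltW.
by left.
Qed.
Lemma glue2_b x : delta < x -> x <= 1 - delta -> glue2 x = deriv2_on delta (1 - delta) u x.
Proof.
move=> x0 xd; rewrite /glue2 (deriv2_on_out (a := 0)) ?(deriv2_on_out (a := 1 - delta)) ?addr0 ?add0r//.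
  by left.
by right; rewrite ltW.
Qed.
Lemma glue2_c x : 1 - delta < x -> x <= 1 -> glue2 x = deriv2_on (1 - delta) 1 u x.
Proof.
move=> x0 xd; rewrite /glue2 (deriv2_on_out (a := 0)) ?(deriv2_on_out (a := delta)) ?addr0 ?add0r//.
  by right; rewrite ltW.
by right; rewrite (le_trans (ltW dd))// ltW.
Qed.

Lemma glue1_sqint : square_integrable glue1.
Proof.
have [_ _ La _] := H2_wderiv Ha; have [_ _ Lb _] := H2_wderiv Hb.
have [_ _ Lc _] := H2_wderiv Hc.
exact: sqintD (sqintD (L2_sqint La) (L2_sqint Lb)) (L2_sqint Lc).
Qed.

Lemma glue2_sqint : square_integrable glue2.
Proof.
have [_ _ _ La] := H2_wderiv Ha; have [_ _ _ Lb] := H2_wderiv Hb.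
have [_ _ _ Lc] := H2_wderiv Hc.
exact: sqintD (sqintD (L2_sqint La) (L2_sqint Lb)) (L2_sqint Lc).
Qed.

Lemma glue1_integrable : mu.-integrable setT (EFin \o glue1).
Proof.
have [_ _ La _] := H2_wderiv Ha; have [_ _ Lb _] := H2_wderiv Hb.
have [_ _ Lc _] := H2_wderiv Hc.
exact: (integrable_add measurableT (integrable_add measurableT (L2_integrable La) (L2_integrable Lb)) (L2_integrable Lc)).
Qed.

(** The three pieces have disjoint supports. *)
Lemma glue2_norm2sq : norm2sq glue2 =
  norm2sq (deriv2_on 0 delta u) + norm2sq (deriv2_on delta (1 - delta) u) + norm2sq (deriv2_on (1 - delta) 1 u).
Proof.
have [_ _ _ /L2_sqint La] := H2_wderiv Ha; have [_ _ _ /L2_sqint Lb] := H2_wderiv Hb.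
have [_ _ _ /L2_sqint Lc] := H2_wderiv Hc.
rewrite /norm2sq -RintegralD//; [|exact: sqint_sqr La|exact: sqint_sqr Lb].
rewrite -RintegralD//; [|exact: (integrable_add measurableT (sqint_sqr La) (sqint_sqr Lb))|exact: sqint_sqr Lc].
apply: eq_Rintegral => x _; rewrite /glue2.
have [xd|dx] := leP x delta.
  rewrite (deriv2_on_out (a := delta)); last by left.
  by rewrite (deriv2_on_out (a := 1 - delta)) ?expr0n ?addr0//; left; rewrite (le_trans xd)// ltW.
rewrite (deriv2_on_out (a := 0)); last by right; rewrite ltW.
have [xd|dx'] := leP x (1 - delta).
  by rewrite (deriv2_on_out (a := 1 - delta)) ?expr0n ?addr0 ?add0r//; left.
by rewrite (deriv2_on_out (a := delta)) ?expr0n ?addr0 ?add0r//; right; rewrite ltW.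
Qed.

(** On each closed subinterval this is [piece_primitive]; continuity of u at delta and
    1 - delta allows the pieces to be chained. *)
Lemma glue1_primitive x y : 0 < x -> x <= y -> y < 1 ->
  u y - u x = \int[mu]_(z in `]x, y]) glue1 z.
Proof.
move=> x0 xy y1.
pose P x y := 0 < x -> y < 1 -> u y - u x = \int[mu]_(z in `]x, y]) glue1 z.
have ps : path <%R 0 [:: delta; 1 - delta; 1] by rewrite /= d0 dd dm1.
apply: (mesh_chain_sub (P := P) ps _ _ _ (ltW x0) xy (ltW y1) x0 y1).
- by move=> z _ _; rewrite subrr set_itvoc0 Rintegral_set0.
- move=> p q r pq qr Ppq Pqr p0 r1.
  rewrite (Rintegral_oc_add glue1_integrable pq qr) -(Ppq p0 (le_lt_trans qr r1)).
  by rewrite -(Pqr (lt_le_trans p0 pq) r1) [RHS]addrC addrA subrK.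
move=> K p q KE Kp pq qK p0 q1.
have cuO z : 0 < z -> z < 1 -> {for z, continuous u}.
  by move=> z0 z1; apply: cu; rewrite inE /Omega /= in_itv/= z0.
have piece a b : 0 <= a -> a < b -> b <= 1 -> H2 `]a, b[ u -> a <= p -> q <= b ->
   (forall x, a < x -> x <= b -> glue1 x = deriv1_on a b u x) ->
   u q - u p = \int[mu]_(z in `]p, q]) glue1 z.
  move=> a0 ab b1 H ap qb E; have [w _ L _] := H2_wderiv H.
  have cuab : {in `]a, b[, continuous u}.
    move=> z; rewrite in_itv/= => /andP[az zb].
    by apply: cuO; [exact: le_lt_trans az|exact: lt_le_trans b1].
  rewrite (piece_primitive ab w L cuab ap pq qb).
  - apply: eq_Rintegral => z; rewrite inE/= in_itv/= => /andP[pz zq].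
    by rewrite E// ?(le_lt_trans ap)// (le_trans zq).
  - by move=> pa; apply: cuO; rewrite -pa// (le_lt_trans pq).
  - by move=> qb'; apply: cuO; rewrite -qb'// (lt_le_trans p0).
move: KE; rewrite /elements /= !inE => /or3P[] /eqP KE; rewrite KE /= in Kp qK.
- by apply: (piece 0 delta) => //; [exact: ltW|exact: glue1_a].
- by apply: (piece delta (1 - delta)) => //; [exact: ltW|exact: ltW|exact: glue1_b].
- by apply: (piece (1 - delta) 1) => //; [exact: ltW|exact: glue1_c].
Qed.

(** By [elements_split], each element lies in the closure of one subinterval or outside
    ]0, 1[, where the glued derivative vanishes. *)
Lemma glue_oscillation s : path <%R (- delta) s -> [/\ 0 \in s, delta \in s, 1 - delta \in s & 1 \in s] ->
  forall K, K \in elements (- delta) s -> exists2 P : R -> Prop,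
  {ae mu, forall x, `]K.1, K.2]%classic x -> P x} &
  forall x t, `]K.1, K.2]%classic x -> `]K.1, K.2]%classic t -> P x -> P t ->
    `|glue1 x - glue1 t| <= \int[mu]_(z in `]K.1, K.2]) `|glue2 z|.
Proof.
move=> ps [m0 md m1d m1] K KE.
have Kl := elements_lt ps KE.
have sp p : p \in s -> K.2 <= p \/ p <= K.1.
  by move=> pm; apply: (elements_split ps _ KE); rewrite inE pm orbT.
case: (sp _ m0) => [K0|K0].
  apply: oscillation_zero => x Kx xK; apply: glue1_out; left; exact: le_trans K0.
case: (sp _ md) => [Kd|Kd].
  by apply: (oscillation_piece Ha) => //; [exact: glue1_a|exact: glue2_a|exact: glue2_sqint].
case: (sp _ m1d) => [Ke|Ke].
  by apply: (oscillation_piece Hb) => //; [exact: glue1_b|exact: glue2_b|exact: glue2_sqint].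
case: (sp _ m1) => [K1|K1].
  by apply: (oscillation_piece Hc) => //; [exact: glue1_c|exact: glue2_c|exact: glue2_sqint].
apply: oscillation_zero => x Kx xK; apply: glue1_out; right; exact: le_trans (ltW Kx).
Qed.

End Glue.

(** * The inverse estimate for affine functions *)
Section Inverse.
Context {R : realType}.
Notation mu := (@lebesgue_measure R).
Implicit Types (p q A B : R).

(** In terms of the value at the midpoint and the slope: the two contributions are
    orthogonal. *)
Lemma integral_affine_sqr A B p q : p < q ->
  \int[mu]_(x in `]p, q]) ((A * x + B) ^+ 2) =
  (q - p) * (A * ((p + q) / 2) + B) ^+ 2 + A ^+ 2 * (q - p) ^+ 3 / 12.
Proof.
move=> pq.
have c2 : continuous (fun x : R => (A * x + B) ^+ 2).
  move=> x; apply: differentiable_continuous; apply/derivable1_diffP.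
  by apply: ex_derive.
rewrite Rintegral_itv_obnd_cbnd; last first.
  by apply: (@integrable_subset _ _ _ mu `[p, q]%classic) => //; [exact: itv_oc_cc|exact: continuous_integrable_itv].
pose F x : R := A ^+ 2 / 3 * x ^+ 3 + A * B * x ^+ 2 + B ^+ 2 * x.
have dF (x : R) : is_derive x 1 F ((A * x + B) ^+ 2).
  apply: is_derive_eq; rewrite /GRing.scale/=.
  by field.
have cF : continuous F.
  move=> x; apply: differentiable_continuous; apply/derivable1_diffP.
  by case: (dF x).
rewrite /Rintegral (@continuous_FTC2 _ _ F)//.
- by rewrite /F /=; field.
- exact: continuous_subspaceT.
- split; [by move=> x _; case: (dF x)|exact/cvg_at_right_filter/cF|exact/cvg_at_left_filter/cF].
- by move=> x _; rewrite derive1E; exact: (@derive_val _ _ _ _ _ _ _ (dF x)).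
Qed.

Lemma inverse_estimate A B p q : p < q ->
  A ^+ 2 * (q - p) <= 12 / (q - p) ^+ 2 * \int[mu]_(x in `]p, q]) ((A * x + B) ^+ 2).
Proof.
move=> pq; rewrite integral_affine_sqr//.
have l0 : 0 < q - p by rewrite subr_gt0.
move: (q - p) l0 (A * _ + B) => l l0 m.
rewrite [leRHS]mulrAC ler_pdivlMr ?exprn_gt0//.
have -> : A ^+ 2 * l * l ^+ 2 = 12 * (A ^+ 2 * l ^+ 3 / 12) by field.
by rewrite ler_pM2l// lerDr mulr_ge0 ?sqr_ge0// ltW.
Qed.

End Inverse.

(** * From elementwise to global estimates *)
Section MeshNorm.
Context {R : realType}.
Notation mu := (@lebesgue_measure R).
Implicit Types (f g : R -> R) (s : seq R) (a : R).

Lemma mesh_norm2sq_le f g (C : R) a s : path <%R a s -> 0 <= C -> square_integrable f -> square_integrable g ->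
  (forall x, ~ `]a, last a s]%classic x -> f x = 0) ->
  (forall K, K \in elements a s ->
    \int[mu]_(x in `]K.1, K.2]) (f x ^+ 2) <= C * \int[mu]_(x in `]K.1, K.2]) (g x ^+ 2)) ->
  norm2sq f <= C * norm2sq g.
Proof.
move=> ps C0 sf sg f0 HK.
have int2 h D : measurable D -> square_integrable h ->
    ((\int[mu]_(x in D) (h x ^+ 2))%:E = \int[mu]_(x in D) (h x ^+ 2)%:E)%E.
  move=> mD sh; rewrite /Rintegral fineK//; apply: (@integrable_fin_num _ _ _ mu) => //.
  by apply: (@integrable_subset _ _ _ mu setT) => //; exact: sqint_sqr.
have H : (\int[mu]_(x in `]a, last a s]) (f x ^+ 2)%:E <=
   C%:E * \int[mu]_(x in `]a, last a s]) (g x ^+ 2)%:E)%E.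
  apply: (@mesh_sum_le _ (fun x => f x ^+ 2) (fun x => g x ^+ 2)) => //.
  - by apply: measurable_funX; exact: sqint_measurable.
  - by apply: measurable_funX; exact: sqint_measurable.
  - by move=> x; exact: sqr_ge0.
  - by move=> x; exact: sqr_ge0.
  by move=> K KE; rewrite -!int2// -EFinM lee_fin; exact: HK.
move: H; rewrite -!int2// -EFinM lee_fin => H.
rewrite /norm2sq -(@Rintegral_supp _ `]a, last a s]%classic); last by move=> x /f0 ->; rewrite expr0n.
apply: (le_trans H); rewrite ler_wpM2l//.
rewrite Rintegral_mkcond; apply: le_Rintegral => //.
- apply: (integrable_patch mu _ (measurable_itv _)).1.
  by apply: (@integrable_subset _ _ _ mu setT) => //; exact: sqint_sqr.
- exact: sqint_sqr.
- by move=> x _; rewrite patchE; case: ifP => // _; exact: sqr_ge0.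
Qed.

End MeshNorm.

(** * The interpolant *)
Section Interpolant.
Context {R : realType}.
Notation mu := (@lebesgue_measure R).
Variables (delta : R) (s : seq R) (u : R -> R).
Hypothesis d0 : 0 < delta.
Hypothesis d1 : delta < 1 / 2.
Hypothesis cu : {in Omega, continuous u}.
Hypothesis Ha : H2 `]0, delta[ u.
Hypothesis Hb : H2 `]delta, 1 - delta[ u.
Hypothesis Hc : H2 `]1 - delta, 1[ u.
Hypothesis ms : is_mesh delta s.
Hypothesis ds : delta \in s /\ 1 - delta \in s.

Let ps : path <%R (- delta) s. Proof. by case: ms => -[]. Qed.
Let ls : last (- delta) s = 1 + delta. Proof. by case: ms => -[_ /eqP]. Qed.
Let s0 : 0 \in s. Proof. by case: ms. Qed.
Let s1 : 1 \in s. Proof. by case: ms. Qed.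

Local Notation G := (glue1 delta u).
Local Notation G2 := (glue2 delta u).
Let sG : square_integrable G := glue1_sqint Ha Hb Hc.
Let iG : mu.-integrable setT (EFin \o G) := glue1_integrable Ha Hb Hc.
Let sG2 : square_integrable G2 := glue2_sqint Ha Hb Hc.
Local Notation Gi := (mesh_mean (- delta) s G).
Let iGi : mu.-integrable setT (EFin \o Gi) := piecewise_cst_integrable ps _.
Let sGi : square_integrable Gi := piecewise_cst_sqint ps _.
Let osc := glue_oscillation d0 d1 Ha Hb Hc ps (And4 s0 ds.1 ds.2 s1).

Lemma element_position K : K \in mesh_elements delta s ->
  [\/ K.2 <= 0, 0 <= K.1 /\ K.2 <= 1 | 1 <= K.1].
Proof.
move=> KE; have sp p : p \in s -> K.2 <= p \/ p <= K.1.
  by move=> pm; apply: (elements_split ps _ KE); rewrite inE pm orbT.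
case: (sp _ s0) => ?; first by constructor 1.
by case: (sp _ s1) => ?; [constructor 2|constructor 3].
Qed.

(** The limit of u at 0: u is only known inside ]0, 1[, whereas members of the discrete
    space are continuous on [0, 1]. *)
Definition left_trace := u (1 / 2) - \int[mu]_(t in `]0, 1 / 2]) G t.

Lemma continuous_solutionE x : Omega x -> u x = left_trace + \int[mu]_(t in `]0, x]) G t.
Proof.
rewrite /Omega /= in_itv/= => /andP[x0 x1]; rewrite /left_trace.
have h0 : 0 < 1 / 2 :> R by [].
have h1 : 1 / 2 < 1 :> R by lra.
have [xh|hx] := leP x (1 / 2).
  rewrite (Rintegral_oc_add iG (ltW x0) xh) -(glue1_primitive d0 d1 cu Ha Hb Hc x0 xh h1).
  by ring.
rewrite (Rintegral_oc_add iG (ltW h0) (ltW hx)).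
rewrite -(glue1_primitive d0 d1 cu Ha Hb Hc h0 (ltW hx) x1).
by ring.
Qed.

(** The primitive of the elementwise mean of the glued derivative. It coincides with
    the nodal interpolant, and its continuity comes for free. *)
Definition interp x : R :=
  if x \in `[0, 1] then left_trace + \int[mu]_(t in `]0, x]) Gi t else 0.

Lemma interp_element K x : K \in mesh_elements delta s -> 0 <= K.1 -> K.2 <= 1 ->
  x \in `[K.1, K.2] -> interp x = interp K.1 + element_mean G K * (x - K.1).
Proof.
move=> KE K0 K1; have Kl := elements_lt ps KE; rewrite in_itv/= => /andP[Kx xK].
rewrite /interp !in_itv/= K0 (le_trans K0 Kx) (le_trans xK K1) (le_trans (ltW Kl) K1)/=.
rewrite (Rintegral_oc_add iGi K0 Kx) addrA; congr (_ + _).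
rewrite -Rintegral_oc_cst//; apply: eq_Rintegral => t.
rewrite inE/= in_itv/= => /andP[Kt tx].
by rewrite (mesh_meanE _ ps KE)// (le_trans tx).
Qed.

Lemma interp_Vpc : Vpc delta s interp.
Proof.
split.
- have i01 : mu.-integrable `[0, 1] (EFin \o Gi) by exact: (@integrable_subset _ _ _ mu setT).
  have cp := @parameterized_integral_continuous R 0 1 Gi ler01 i01.
  have cc : {within `[0, 1], continuous (fun x => left_trace + parameterized_integral mu 0 x Gi)}.
    by move=> x; apply: cvgD; [exact: cvg_cst|exact: cp].
  apply: subspace_eq_continuous cc => x /set_mem x01'; have x01 : x \in `[0, 1] := x01'.
  rewrite /from_subspace /interp x01 /parameterized_integral; congr (_ + _).
  by rewrite Rintegral_itv_obnd_cbnd//; exact: (@integrable_subset _ _ _ mu setT).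
- move=> K KE K01; have Kl := elements_lt ps KE.
  have K0 : 0 <= K.1 by have /= := K01 K.1; rewrite !in_itv/= lexx (ltW Kl) => /(_ isT)/andP[].
  have K1 : K.2 <= 1 by have /= := K01 K.2; rewrite !in_itv/= lexx (ltW Kl) => /(_ isT)/andP[].
  exists (element_mean G K), (interp K.1 - element_mean G K * K.1) => x xK.
  by rewrite (interp_element KE K0 K1 xK); ring.
- by move=> x x01; rewrite /interp (negbTE x01).
Qed.

Lemma interp_error x : Omega x -> ext0 u x - interp x = defect (- delta) s G x.
Proof.
move=> Ox; move: (Ox); rewrite {1}/Omega /= in_itv/= => /andP[x0 x1].
rewrite /ext0 patchE mem_set// /interp in_itv/= (ltW x0) (ltW x1)/= (continuous_solutionE Ox).
have iD : mu.-integrable setT (EFin \o (fun t => G t - Gi t)) by exact: integrable_sub.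
have dn : - delta <= 0 by rewrite oppr_le0 ltW.
rewrite /defect (Rintegral_oc_add iD dn (ltW x0)) -/(defect (- delta) s G 0) defect_mesh//; last first.
  by rewrite inE s0 orbT.
rewrite add0r RintegralB//; try exact: (@integrable_subset _ _ _ mu setT).
by rewrite opprD addrACA subrr add0r.
Qed.

End Interpolant.

(** * Interpolation errors and derivatives on the unit interval *)
Section Errors.
Context {R : realType}.
Notation mu := (@lebesgue_measure R).
Variables (delta : R) (s : seq R) (u : R -> R).
Hypothesis d0 : 0 < delta.
Hypothesis d1 : delta < 1 / 2.
Hypothesis cu : {in Omega, continuous u}.
Hypothesis Ha : H2 `]0, delta[ u.
Hypothesis Hb : H2 `]delta, 1 - delta[ u.
Hypothesis Hc : H2 `]1 - delta, 1[ u.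
Hypothesis ms : is_mesh delta s.
Hypothesis ds : delta \in s /\ 1 - delta \in s.
Hypothesis su : square_integrable (ext0 u).

Let ps : path <%R (- delta) s. Proof. by case: ms => -[]. Qed.
Let ls : last (- delta) s = 1 + delta. Proof. by case: ms => -[_ /eqP]. Qed.
Let s0 : 0 \in s. Proof. by case: ms. Qed.
Let s1 : 1 \in s. Proof. by case: ms. Qed.

Local Notation G := (glue1 delta u).
Local Notation G2 := (glue2 delta u).
Let sG : square_integrable G := glue1_sqint Ha Hb Hc.
Let iG : mu.-integrable setT (EFin \o G) := glue1_integrable Ha Hb Hc.
Let sG2 : square_integrable G2 := glue2_sqint Ha Hb Hc.
Local Notation Gi := (mesh_mean (- delta) s G).
Let iGi : mu.-integrable setT (EFin \o Gi) := piecewise_cst_integrable ps _.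
Let sGi : square_integrable Gi := piecewise_cst_sqint ps _.
Let osc := glue_oscillation d0 d1 Ha Hb Hc ps (And4 s0 ds.1 ds.2 s1).
Local Notation h := (mesh_size delta s).
Local Notation v := (interp delta s u).
Let Vv : Vpc delta s v := interp_Vpc u ms.
Let sv : square_integrable v := Vpc_sqint Vv.

Lemma element_size K : K \in mesh_elements delta s -> 0 < K.2 - K.1 /\ K.2 - K.1 <= h.
Proof.
move=> KE; split; last exact: mesh_size_ge.
by rewrite subr_gt0; exact: (elements_lt ps KE).
Qed.

Lemma exists_element : exists K, K \in mesh_elements delta s.
Proof.
move: s0; rewrite /mesh_elements; case: s => // q s' _.
by exists (- delta, q); rewrite /= inE eqxx.
Qed.

Lemma mesh_size_gt0 : 0 < h.
Proof.
have [K /element_size[l0 lh]] := exists_element.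
exact: lt_le_trans lh.
Qed.

Lemma mesh_out x : ~ `]- delta, last (- delta) s]%classic x -> x <= - delta \/ last (- delta) s < x.
Proof.
move=> xI; have [xa|ax] := leP x (- delta); first by left.
have [xl|lx] := leP x (last (- delta) s); last by right.
by exfalso; apply: xI; rewrite /= in_itv/= ax.
Qed.

Lemma glue1_mesh_out x : ~ `]- delta, last (- delta) s]%classic x -> G x = 0.
Proof.
move=> /mesh_out; rewrite ls => xI; apply: (glue1_out u d0 d1).
by move: d0; case: xI => ? ?; [left|right]; lra.
Qed.

Lemma interp_deriv_error : norm2sq (fun x => G x - Gi x) <= h ^+ 2 * norm2sq G2.
Proof.
apply: (mesh_norm2sq_le ps); [exact: sqr_ge0|exact: sqintB|exact: sG2| |].
  move=> x xI; rewrite (glue1_mesh_out xI) /mesh_mean piecewise_cst_out ?subrr//; exact: mesh_out.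
move=> K KE; have [l0 lh] := element_size KE.
apply: (le_trans (element_oscillation ps sG iG sG2 osc KE)).
rewrite ler_wpM2r//; first by apply: Rintegral_ge0 => x _; exact: sqr_ge0.
by rewrite lerXn2r// nnegrE ltW// (lt_le_trans l0).
Qed.

Lemma ae_neq01 : {ae mu, forall x : R, x != 0 /\ x != 1}.
Proof.
have nb (b : R) : {ae mu, forall x, x != b}.
  exists [set b]; split => //; first exact: lebesgue_measure_set1.
  by move=> x /= /negP; rewrite negbK => /eqP.
exact: ae_and.
Qed.

(** The points 0 and 1 form a null set. *)
Lemma ae_patch_Omega f : (forall x, x \notin `[0, 1] -> f x = 0 :> R) ->
  {ae mu, forall x, f x = (f \_ (Omega : set R)) x}.
Proof.
move=> f0; apply: ae_imp ae_neq01 => x [x0 x1].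
rewrite patchE mem_setE in_itv/=; case: ifPn => // xO; apply: f0.
by apply: contra xO; rewrite in_itv/= !lt_neqAle eq_sym x0 x1.
Qed.

Lemma norm2sq_patch_Omega f : (forall x, x \notin `[0, 1] -> f x = 0 :> R) -> square_integrable f ->
  norm2sq f = norm2sq (f \_ (Omega : set R)).
Proof.
move=> f0 sf; apply: ae_eq_norm2sq; last exact: ae_patch_Omega.
- exact: sqint_measurable.
- by apply: sqint_measurable; apply: sqint_patch => //; exact: measurable_itv.
Qed.

Lemma ext0_sub_out w x : Vpc delta s w -> x \notin `[0, 1] -> ext0 u x - w x = 0.
Proof.
move=> Vw x01; rewrite (Vpc_out Vw x01) subr0 /ext0 patchE ifF//.
by apply/negbTE; apply: contra x01; rewrite mem_setE; exact: subset_itvW.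
Qed.

Lemma interp_L2_error : norm2sq (fun x => ext0 u x - v x) <= h ^+ 4 * norm2sq G2.
Proof.
have se := sqintB su sv.
rewrite norm2sq_patch_Omega//; last by move=> x; exact: ext0_sub_out.
apply: (mesh_norm2sq_le ps) => //.
- exact: exprn_even_ge0.
- by apply: sqint_patch => //; exact: measurable_itv.
- move=> x xI; rewrite patchE ifF//; apply/negbTE; apply/negP => /set_mem xO.
  apply: xI; move: xO; rewrite /Omega /= !in_itv/= ls => /andP[? ?].
  by move: d0 => ?; apply/andP; split; lra.
move=> K KE; have [l0 lh] := element_size KE.
set S := \int[mu]_(x in _) (G2 x ^+ 2).
have S0 : 0 <= S by apply: Rintegral_ge0 => x _; exact: sqr_ge0.
apply: (@le_trans _ _ ((K.2 - K.1) ^+ 3 * S * (K.2 - K.1))); last first.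
  rewrite mulrAC -exprSr ler_wpM2r// lerXn2r// nnegrE ltW// (lt_le_trans l0)//.
have Kl : K.1 <= K.2 by rewrite -subr_ge0 ltW.
rewrite -(Rintegral_oc_cst _ Kl); apply: le_Rintegral => //.
- apply: (@integrable_subset _ _ _ mu setT) => //; apply: sqint_sqr.
  by apply: sqint_patch => //; exact: measurable_itv.
- exact: integrable_oc_cst.
move=> x; rewrite /= in_itv/= => /andP[Kx xK].
have l30 : 0 <= (K.2 - K.1) ^+ 3 * S by rewrite mulr_ge0// exprn_ge0// ltW.
rewrite patchE; case: ifPn => [/set_mem xO|_]; last by rewrite expr0n.
rewrite (interp_error d0 d1 cu Ha Hb Hc ms xO).
exact: (element_defect ps sG iG sG2 osc KE Kx xK).
Qed.

Variables (uh : R -> R).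
Hypothesis Vu : Vpc delta s uh.

Definition element_inside (K : R * R) := (0 <= K.1) && (K.2 <= 1).

(** Elements outside [0, 1] are given slope 0, although uh may jump at 0 and 1. *)
Definition element_slope (K : R * R) : R :=
  if element_inside K then (uh K.2 - uh K.1) / (K.2 - K.1) else 0.

Definition discrete_slope := piecewise_cst element_slope (- delta) s.

Lemma element_slopeE K x : K \in mesh_elements delta s -> element_inside K ->
  x \in `[K.1, K.2] -> uh x = uh K.1 + element_slope K * (x - K.1).
Proof.
move=> KE Kin; have [l0 _] := element_size KE; have [_ lin _] := Vu.
have sub : `[K.1, K.2] `<=` `[0, 1].
  by move/andP: Kin => [? ?]; apply: subset_itv; rewrite bnd_simp.
have [A [B H]] := lin K KE sub.
have K1K : K.1 \in `[K.1, K.2] by rewrite in_itv/= lexx -subr_ge0 ltW.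
have K2K : K.2 \in `[K.1, K.2] by rewrite in_itv/= lexx -subr_ge0 ltW.
move=> xK; rewrite /element_slope Kin !H//.
have -> : A * K.2 + B - (A * K.1 + B) = A * (K.2 - K.1) by ring.
by rewrite mulfK ?gt_eqF//; ring.
Qed.

Lemma discrete_slope_primitive x y : 0 <= x -> x <= y -> y <= 1 ->
  \int[mu]_(t in `]x, y]) discrete_slope t = uh y - uh x.
Proof.
have iduh : mu.-integrable setT (EFin \o discrete_slope) := piecewise_cst_integrable ps _.
move=> x0 xy y1.
pose P x y := 0 <= x -> y <= 1 -> \int[mu]_(t in `]x, y]) discrete_slope t = uh y - uh x.
have dx : - delta <= x by rewrite (le_trans _ x0)// oppr_le0 ltW.
have yl : y <= last (- delta) s by rewrite ls (le_trans y1)// lerDl ltW.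
apply: (mesh_chain_sub (P := P) ps _ _ _ dx xy yl x0 y1) => {x y x0 xy y1 dx yl}.
- by move=> z _ _; rewrite subrr set_itvoc0 Rintegral_set0.
- move=> p q r pq qr Ppq Pqr p0 r1; rewrite (Rintegral_oc_add iduh pq qr).
  by rewrite (Ppq p0 (le_trans qr r1)) (Pqr (le_trans p0 pq) r1) addrC addrA subrK.
move=> K x y KE Kx xy yK x0 y1.
have [K20|[K0 K1]|K1] := element_position ms KE.
- have -> : x = y by apply/eqP; rewrite eq_le xy (le_trans yK)// (le_trans K20).
  by rewrite subrr set_itvoc0 Rintegral_set0.
- have Kin : element_inside K by rewrite /element_inside K0.
  rewrite (element_slopeE KE Kin (x := y)); last by rewrite in_itv/= (le_trans Kx).
  rewrite (element_slopeE KE Kin (x := x)); last by rewrite in_itv/= Kx (le_trans xy).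
  have -> : uh K.1 + element_slope K * (y - K.1) - (uh K.1 + element_slope K * (x - K.1)) = element_slope K * (y - x) by ring.
  rewrite -Rintegral_oc_cst//; apply: eq_Rintegral => t.
  rewrite inE/= in_itv/= => /andP[xt ty].
  by rewrite /discrete_slope (piecewise_cstE _ ps KE)// ?(le_lt_trans Kx)// (le_trans ty).
- have -> : x = y.
    by apply/eqP; rewrite eq_le xy (le_trans y1)// (le_trans K1).
  by rewrite subrr set_itvoc0 Rintegral_set0.
Qed.

Lemma discrete_slope_sqint : square_integrable discrete_slope. Proof. exact: piecewise_cst_sqint. Qed.

Lemma discrete_slope_weak_derivative : weak_derivative Omega uh discrete_slope.
Proof.
apply: primitive_weak_derivative => //.
- have [cuh _ _] := Vu.
  by have /(continuous_within_itvP _ ltr01)[] := cuh.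
- apply: open_integrable_locally; first exact: interval_open.
  by apply: (@integrable_subset _ _ _ mu setT) => //; exact: piecewise_cst_integrable.
- by move=> c d c0 cd d1'; apply: discrete_slope_primitive => //; exact: ltW.
Qed.

Lemma glue1_weak_derivative : weak_derivative Omega u G.
Proof.
apply: primitive_weak_derivative => //.
- by move=> x x01; apply: cu; rewrite inE.
- apply: open_integrable_locally; first exact: interval_open.
  exact: (@integrable_subset _ _ _ mu setT).
- move=> c d c0 cd d1'; apply/esym.
  exact: (glue1_primitive d0 d1 cu Ha Hb Hc).
Qed.

(** On an element of [0, 1] the left-hand side is the squared derivative of the affine
    function interp - uh; outside, it vanishes. *)
Lemma discrete_inverse_estimate kappa : (forall K, K \in mesh_elements delta s -> h <= kappa * (K.2 - K.1)) ->
  norm2sq (fun x => Gi x - discrete_slope x) <= 12 * kappa ^+ 2 / h ^+ 2 * norm2sq (fun x => v x - uh x).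
Proof.
move=> qu; have h0 := mesh_size_gt0; have sdu := discrete_slope_sqint.
have suh := Vpc_sqint Vu.
(* 1 / (K.2 - K.1) ^+ 2 <= kappa ^+ 2 / h ^+ 2 by quasi-uniformity. *)
have C0 : 0 <= 12 * kappa ^+ 2 / h ^+ 2.
  by apply: divr_ge0; [apply: mulr_ge0 => //; exact: sqr_ge0|exact: sqr_ge0].
apply: (mesh_norm2sq_le ps C0); [exact: sqintB|exact: sqintB| |].
  move=> x /mesh_out xI; rewrite /mesh_mean /discrete_slope !piecewise_cst_out ?subrr//.
move=> K KE; have [l0 lh] := element_size KE.
have Kl : K.1 < K.2 by rewrite -subr_gt0.
set S := \int[mu]_(x in _) ((v x - uh x) ^+ 2).
have S0 : 0 <= S by apply: Rintegral_ge0 => x _; exact: sqr_ge0.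
have E : \int[mu]_(x in `]K.1, K.2]) ((Gi x - discrete_slope x) ^+ 2) =
    (element_mean G K - element_slope K) ^+ 2 * (K.2 - K.1).
  rewrite -(Rintegral_oc_cst _ (ltW Kl)); apply: eq_Rintegral => x.
  rewrite inE/= in_itv/= => /andP[Kx xK].
  by rewrite (mesh_meanE _ ps KE Kx xK) /discrete_slope (piecewise_cstE _ ps KE Kx xK).
rewrite E.
have [Kin|Kout] := boolP (element_inside K); last first.
  have -> : element_slope K = 0 by rewrite /element_slope (negbTE Kout).
  have -> : element_mean G K = 0.
    rewrite /element_mean (_ : \int[mu]_(t in _) _ = 0) ?mul0r//.
    transitivity (\int[mu]_(t in `]K.1, K.2]) (0 : R)); last by rewrite Rintegral_cst// mul0r.
    apply: eq_Rintegral => x; rewrite inE/= in_itv/= => /andP[Kx xK].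
    apply: (glue1_out u d0 d1); have [K20|[K0 K1]|K1] := element_position ms KE.
    - by left; exact: le_trans K20.
    - by move: Kout; rewrite /element_inside K0 K1.
    - by right; rewrite (le_trans K1)// ltW.
  by rewrite subrr expr0n mul0r mulr_ge0.
set A := element_mean G K - element_slope K.
pose B := (v K.1 - uh K.1) - A * K.1.
have wE : S = \int[mu]_(x in `]K.1, K.2]) ((A * x + B) ^+ 2).
  apply: eq_Rintegral => x; rewrite inE/= in_itv/= => /andP[Kx xK].
  have xK' : x \in `[K.1, K.2] by rewrite in_itv/= xK ltW.
  rewrite (element_slopeE KE Kin xK'); move/andP: Kin => [K0 K1].
  rewrite (interp_element u ms KE K0 K1 xK') /B /A.
  by congr (_ ^+ 2); ring.
apply: (le_trans (inverse_estimate A B Kl)); rewrite -wE ler_wpM2r//.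
rewrite -mulrA ler_pM2l// ler_pdivlMr ?exprn_gt0// mulrC ler_pdivrMr ?exprn_gt0//.
rewrite -exprMn lerXn2r ?nnegrE ?(ltW h0)//; first exact: le_trans (ltW h0) (qu K KE).
exact: qu.
Qed.

End Errors.

(** * The error estimate *)
Section NormBridge.
Context {R : realType}.
Notation mu := (@lebesgue_measure R).
Implicit Types (D : set R) (f g : R -> R).

Lemma poweR_half (x : R) : 0 <= x -> (x%:E `^ 2^-1 = (Num.sqrt x)%:E)%E.
Proof. by move=> x0; rewrite poweR_EFin powR12_sqrt. Qed.

Lemma L2norm_sqrt D f : square_integrable (f \_ D) -> L2norm D f = (Num.sqrt (norm2sq (f \_ D)))%:E.
Proof. by move=> sf; rewrite L2normE -norm2sqE// poweR_half// norm2sq_ge0. Qed.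

Lemma sqrt_norm2sq_le_H2norm (a b : R) f : H2 `]a, b[ f ->
  ((Num.sqrt (norm2sq (deriv2_on a b f)))%:E <= H2norm `]a, b[ f)%E.
Proof.
move=> Hf; have [_ _ _ L2f] := H2_wderiv Hf.
rewrite -/(L2norm _ _) /H2norm -poweR_half ?norm2sq_ge0//.
have s2 := L2_sqint L2f.
have -> : ((norm2sq (deriv2_on a b f))%:E = L2norm `]a, b[ (wderiv `]a, b[ (wderiv `]a, b[ f)) ^+ 2)%E.
  by rewrite L2norm_sqrt// -EFin_expe sqr_sqrtr ?norm2sq_ge0.
have n0 D g : (0 <= L2norm D g ^+ 2)%E by rewrite sqre_ge0.
apply: gt0_ler_poweR => //.
- by rewrite in_itv/= leey n0.
- by rewrite in_itv /= leey andbT; apply: adde_ge0; [apply: adde_ge0; exact: n0|exact: n0].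
- by apply: leeDr; apply: adde_ge0; exact: n0.
Qed.

Lemma norm2sq_patch_le D f : measurable D -> square_integrable f -> norm2sq (f \_ D) <= norm2sq f.
Proof.
move=> mD sf; apply: le_Rintegral => //.
- by apply: sqint_sqr; exact: sqint_patch.
- exact: sqint_sqr.
- by move=> x _; rewrite patchE; case: ifP => // _; rewrite expr0n sqr_ge0.
Qed.

(** By the parallelogram identity. *)
Lemma norm2sqD_le f g : square_integrable f -> square_integrable g ->
  norm2sq (fun x => f x + g x) <= 2 * norm2sq f + 2 * norm2sq g.
Proof.
move=> sf sg; have sfg := sqintD sf sg; have sfg' := sqintB sf sg.
have e : norm2sq (fun x => f x + g x) + norm2sq (fun x => f x - g x) = 2 * norm2sq f + 2 * norm2sq g.
  rewrite /norm2sq -RintegralD//; [|exact: sqint_sqr sfg|exact: sqint_sqr sfg'].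
  rewrite -!RintegralZl//; [|exact: sqint_sqr|exact: sqint_sqr].
  rewrite -RintegralD//; [|apply: integrable_scale => //; exact: sqint_sqr|apply: integrable_scale => //; exact: sqint_sqr].
  by apply: eq_Rintegral => x _; ring.
by rewrite -e lerDl norm2sq_ge0.
Qed.

Lemma norm2sqB_le f g : square_integrable f -> square_integrable g ->
  norm2sq (fun x => f x - g x) <= 2 * norm2sq f + 2 * norm2sq g.
Proof.
move=> sf sg; have := norm2sqD_le sf (sqintZ (-1) sg).
rewrite norm2sqZ// sqrrN expr1n mul1r.
by rewrite (_ : (fun x => _) = (fun x => f x - g x))//; apply/funext => x; rewrite mulN1r.
Qed.

Lemma add_le_sqr_sum_sqrt (x y z : R) : 0 <= x -> 0 <= y -> 0 <= z ->
  x + y + z <= (Num.sqrt x + Num.sqrt y + Num.sqrt z) ^+ 2.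
Proof.
move=> x0 y0 z0.
rewrite -{1}(sqr_sqrtr x0) -{1}(sqr_sqrtr y0) -{1}(sqr_sqrtr z0).
have := mulr_ge0 (sqrtr_ge0 x) (sqrtr_ge0 y).
have := mulr_ge0 (sqrtr_ge0 x) (sqrtr_ge0 z).
have := mulr_ge0 (sqrtr_ge0 y) (sqrtr_ge0 z).
move: (Num.sqrt x) (Num.sqrt y) (Num.sqrt z) => p q r qr pr pq.
rewrite -subr_ge0 (_ : _ - _ = 2 * (p * q + p * r + q * r)); last by ring.
by rewrite mulr_ge0// !addr_ge0.
Qed.

(** N0 and N1 stand for the squared L2 errors of the solution and of its derivative,
    N2 for the derivative error of the interpolant, N3 and N4 for the distance between
    interpolant and discrete solution, in derivative and in value; S is the squared norm
    of the second derivative and n1, n2, n3 its parts. *)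
Lemma combine_error_bounds (c k h n1 n2 n3 S N0 N1 N2 N3 N4 : R) :
  0 < h -> 0 <= c -> 0 <= S -> S <= (n1 + n2 + n3) ^+ 2 ->
  0 <= n1 + n2 + n3 ->
  N0 <= c * (h ^+ 4 * S) -> N1 <= 2 * N2 + 2 * N3 -> N2 <= h ^+ 2 * S ->
  N3 <= 12 * k ^+ 2 / h ^+ 2 * N4 -> N4 <= 2 * N0 + 2 * (h ^+ 4 * S) ->
  Num.sqrt N0 + h * Num.sqrt N1 <=
  (Num.sqrt c + Num.sqrt (2 + 48 * k ^+ 2 * (1 + c))) * h ^+ 2 * (n1 + n2 + n3).
Proof.
move=> h0 c0 S0 SS m0 H0 H1 H2 H3 H4.
set m := n1 + n2 + n3 in SS m0 *; set e := 2 + _.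
have e0 : 0 <= e by rewrite addr_ge0// mulr_ge0 ?addr_ge0// mulr_ge0 ?sqr_ge0.
have sqrtS : Num.sqrt S <= m by rewrite -(ger0_norm m0) -sqrtr_sqr ler_sqrt ?sqr_ge0.
have h4 : h ^+ 4 = (h ^+ 2) ^+ 2 by rewrite -exprM.
have A1 : Num.sqrt N0 <= Num.sqrt c * h ^+ 2 * m.
  have : Num.sqrt N0 <= Num.sqrt (c * (h ^+ 4 * S)).
    by rewrite ler_sqrt ?mulr_ge0 ?exprn_ge0 ?(ltW h0).
  move=> /le_trans; apply.
  rewrite sqrtrM// sqrtrM ?exprn_ge0 ?(ltW h0)// h4 sqrtr_sqr ger0_norm ?sqr_ge0//.
  by rewrite -mulrA ler_wpM2l ?sqrtr_ge0// ler_wpM2l ?sqr_ge0.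
have N1e : N1 <= h ^+ 2 * (e * S).
  have h2 : 0 < h ^+ 2 by rewrite exprn_gt0.
  have B4 : N4 <= 2 * (1 + c) * (h ^+ 4 * S).
    by move: H0 H4; move: (h ^+ 4 * S) => t ? ?; lra.
  have k0 : 0 <= 12 * k ^+ 2 / h ^+ 2.
    by apply: divr_ge0; [apply: mulr_ge0 => //; exact: sqr_ge0|exact: sqr_ge0].
  have B3 : N3 <= 24 * k ^+ 2 * (1 + c) * h ^+ 2 * S.
    apply: (le_trans H3); apply: (le_trans (ler_wpM2l k0 B4)).
    rewrite le_eqVlt; apply/orP; left; apply/eqP; rewrite h4; field.
    by rewrite gt_eqF.
  apply: (le_trans H1).
  have -> : h ^+ 2 * (e * S) = 2 * (h ^+ 2 * S) + 2 * (24 * k ^+ 2 * (1 + c) * h ^+ 2 * S).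
    by rewrite /e; ring.
  by apply: lerD; rewrite ler_pM2l.
have A2 : h * Num.sqrt N1 <= Num.sqrt e * h ^+ 2 * m.
  have : Num.sqrt N1 <= h * (Num.sqrt e * m).
    have : Num.sqrt N1 <= Num.sqrt (h ^+ 2 * (e * S)).
      by rewrite ler_sqrt//; apply: mulr_ge0; [exact: sqr_ge0|exact: mulr_ge0].
    move=> /le_trans; apply.
    rewrite sqrtrM ?sqr_ge0// sqrtr_sqr (ger0_norm (ltW h0)) ler_pM2l// sqrtrM//.
    by rewrite ler_wpM2l ?sqrtr_ge0.
  rewrite -(ler_pM2l h0) => /le_trans; apply.
  by rewrite le_eqVlt; apply/orP; left; apply/eqP; ring.
by rewrite mulrDl mulrDl lerD.
Qed.

End NormBridge.

Theorem theorem4p3 (R : realType) (delta : R)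
    (gamma : R -> R -> R) (tgamma : R -> R)
    (I : Type) (mesh : I -> seq R) :
  0 < delta -> delta < 1 / 2 ->
  (forall x y, gamma x y = gamma y x) ->
  kernel_K1 delta gamma ->
  kernel_K2 gamma tgamma ->
  (forall r, delta < r -> tgamma r = 0) ->
  quasi_uniform_family delta mesh ->
  (forall i, delta \in mesh i /\ 1 - delta \in mesh i) ->
  exists C : R, forall b u : R -> R,
    L2 Omega b ->
    {in Omega, continuous b} ->
    nonlocal_solution delta gamma b u ->
    {in Omega, continuous u} ->
    H2 `]0, delta[ u ->
    H2 `]delta, 1 - delta[ u ->
    H2 `]1 - delta, 1[ u ->
    exists2 h0 : R, 0 < h0 &
      forall (i : I) (uh : R -> R),
        let h := mesh_size delta (mesh i) in
        h < h0 ->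
        discrete_solution delta gamma b (mesh i) uh ->
        (L2norm Omega (u \- uh)%R
           + h%:E * L2norm Omega (wderiv Omega u \- wderiv Omega uh)%R
         <= (C * h ^+ 2)%:E *
            (H2norm `]0%R, delta[ u + H2norm `]delta, (1 - delta)%R[ u
             + H2norm `](1 - delta)%R, 1%R[ u))%E.
Proof.
move=> d0 d1 _ K1 K2 tg0 [meshes [kappa qu] _] dmesh.
have [c c0 Hcea] := cea d0 d1 K1 K2 tg0.
exists (Num.sqrt c + Num.sqrt (2 + 48 * kappa ^+ 2 * (1 + c))).
move=> b u Lb _ sol cu Ha Hb Hc; exists 1 => // i uh h _ dsol.
have ms := meshes i; have ds := dmesh i; have qi := qu i.
have mO : measurable (Omega : set R) by exact: measurable_itv.
have su := ext0_sqint sol.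
have [Vu _] := dsol.
have suh := Vpc_sqint Vu.
have Vv := interp_Vpc u ms; have sv := Vpc_sqint Vv.
have h0 : 0 < h := mesh_size_gt0 ms.
have s_e := sqintB su suh; have s_eta := sqintB su sv.
have ps : path <%R (- delta) (mesh i) by case: ms => -[].
have sG := glue1_sqint Ha Hb Hc; have sGi : square_integrable (mesh_mean (- delta) (mesh i) (glue1 delta u)) := piecewise_cst_sqint ps _.
have sdu := discrete_slope_sqint ms uh.
have E0 : L2norm Omega (u \- uh)%R = (Num.sqrt (norm2sq (fun x => ext0 u x - uh x)))%:E.
  have pE : (u \- uh) \_ Omega = (fun x => ext0 u x - uh x) \_ Omega.
    by apply/funext => x; rewrite !patchE; case: ifP => //= xO; rewrite /ext0 patchE xO.
  rewrite (norm2sq_patch_Omega (fun x => ext0_sub_out u Vu (x := x)) s_e) -pE.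
  by apply: L2norm_sqrt; rewrite pE; exact: sqint_patch.
have aeu := wderiv_ae (glue1_weak_derivative d0 d1 cu Ha Hb Hc).
have aeh := wderiv_ae (discrete_slope_weak_derivative d0 ms Vu).
have muw : measurable_fun Omega (wderiv Omega u) by have [_ [+ _ _] _] := wderivP (glue1_weak_derivative d0 d1 cu Ha Hb Hc).
have muhw : measurable_fun Omega (wderiv Omega uh) by have [_ [+ _ _] _] := wderivP (discrete_slope_weak_derivative d0 ms Vu).
pose dd := fun x => glue1 delta u x - discrete_slope delta (mesh i) uh x.
have sdd : square_integrable dd := sqintB sG sdu.
have mw : measurable_fun setT ((wderiv Omega u \- wderiv Omega uh) \_ Omega).
  by apply: measurable_patch => //; exact: measurable_funB.
have aew : {ae lebesgue_measure, forall x, ((wderiv Omega u \- wderiv Omega uh) \_ Omega) x = (dd \_ Omega) x}.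
  apply: ae_imp (ae_and aeu aeh) => x [xu xh]; rewrite !patchE; case: ifPn => // /set_mem xO.
  by rewrite /= xu// xh.
have sddO : square_integrable (dd \_ Omega) by exact: sqint_patch.
have E1 : (L2norm Omega (wderiv Omega u \- wderiv Omega uh)%R <= (Num.sqrt (norm2sq dd))%:E)%E.
  have nE := ae_eq_norm2sq mw (sqint_measurable sddO) aew.
  rewrite L2norm_sqrt; last first.
    split => //; have [_] := sddO; apply: le_lt_trans.
    rewrite le_eqVlt; apply/orP; left; apply/eqP; apply: ae_eq_integral => //.
    - by apply/measurable_EFinP; exact: measurable_funX.
    - by apply/measurable_EFinP; apply: measurable_funX; exact: sqint_measurable.
    - by apply: ae_imp aew => x -> .
  by rewrite nE lee_fin ler_sqrt ?norm2sq_ge0//; exact: norm2sq_patch_le.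
pose n1 := Num.sqrt (norm2sq (deriv2_on 0 delta u)).
pose n2 := Num.sqrt (norm2sq (deriv2_on delta (1 - delta) u)).
pose n3 := Num.sqrt (norm2sq (deriv2_on (1 - delta) 1 u)).
have Sle : norm2sq (glue2 delta u) <= (n1 + n2 + n3) ^+ 2.
  rewrite (glue2_norm2sq d0 d1 Ha Hb Hc).
  exact: add_le_sqr_sum_sqrt (norm2sq_ge0 _) (norm2sq_ge0 _) (norm2sq_ge0 _).
have T1 := interp_L2_error d0 d1 cu Ha Hb Hc ms ds su.
have T2 := interp_deriv_error d0 d1 Ha Hb Hc ms ds.
have T3 := discrete_inverse_estimate u d0 d1 ms Vu qi.
have T0 := Hcea b u (mesh i) uh _ Lb sol dsol Vv.
have D1 : norm2sq dd <= 2 * norm2sq (fun x => glue1 delta u x - mesh_mean (- delta) (mesh i) (glue1 delta u) x) +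
    2 * norm2sq (fun x => mesh_mean (- delta) (mesh i) (glue1 delta u) x - discrete_slope delta (mesh i) uh x).
  have := norm2sqD_le (sqintB sG sGi) (sqintB sGi sdu).
  by rewrite (_ : (fun x => _) = dd)//; apply/funext => x; rewrite /dd addrA subrK.
have D2 : norm2sq (fun x => interp delta (mesh i) u x - uh x) <=
    2 * norm2sq (fun x => ext0 u x - uh x) + 2 * norm2sq (fun x => ext0 u x - interp delta (mesh i) u x).
  have := norm2sqB_le s_e s_eta.
  by rewrite (_ : (fun x => _ - (_ - _)) = (fun x => interp delta (mesh i) u x - uh x))//;
    apply/funext => x; ring.
have m0 : 0 <= n1 + n2 + n3 by rewrite !addr_ge0// sqrtr_ge0.
have FA := @combine_error_bounds R c kappa h n1 n2 n3 (norm2sq (glue2 delta u)) _ _ _ _ _ h0 (ltW c0)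
  (norm2sq_ge0 _) Sle m0 (le_trans T0 (ler_wpM2l (ltW c0) T1)) D1 T2 T3
  (le_trans D2 (lerD (lexx _) (ler_wpM2l (ler0n _ 2) T1))).
rewrite E0.
apply: (@le_trans _ _ ((Num.sqrt (norm2sq (fun x => ext0 u x - uh x)))%:E + h%:E * (Num.sqrt (norm2sq dd))%:E)%E).
  by rewrite leeD2l// lee_wpmul2l// lee_fin ltW.
rewrite -EFinM -EFinD.
apply: (@le_trans _ _ (((Num.sqrt c + Num.sqrt (2 + 48 * kappa ^+ 2 * (1 + c))) * h ^+ 2)%:E * (n1 + n2 + n3)%:E)%E).
  by rewrite -EFinM lee_fin.
apply: lee_wpmul2l.
  by rewrite lee_fin mulr_ge0 ?sqr_ge0// addr_ge0// sqrtr_ge0.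
rewrite !EFinD; apply: leeD; first apply: leeD; exact: sqrt_norm2sq_le_H2norm.
Qed.
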